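(* In the setting described in the context, assume (A1)–(A2) and Assumption (S) with constants $\underline\delta,\bar\delta>0$, $K\ge1$, and suppose that the Riccati system (IESREJ) admits a solution $(P_k,\Lambda_k,\Gamma_k)_{k=1,2}$ with $\mathbb P(0<P_k(t)\le K\text{ for all }t\in[0,T])=1$, $k=1,2$. Then for $d\mathbb P\otimes dt$-a.e. $(\omega,t)$ the Hamiltonians $H_1$ and $H_2$, evaluated at $(P_1(t-),P_2(t-),\Lambda_1(t),\Gamma_1(t,\cdot),\Gamma_2(t,\cdot))$ and $(P_1(t-),P_2(t-),\Lambda_2(t),\Gamma_1(t,\cdot),\Gamma_2(t,\cdot))$ respectively, admit unique saddle points on $\Pi_1\times\Pi_2$, denoted respectively by $\Theta^+=(\Theta_1^+,\Theta_2^+)$ and $\Theta^-=(\Theta_1^-,\Theta_2^-)$. These saddle-point selectors admit predictable versions. Moreover, there is a deterministic constant $c>0$ such that, along the solution, $$\big|H_k^*(\omega,t,P_1,P_2,\Lambda_k,\Gamma_1,\Gamma_2)\big|\le c\,(1+|\Lambda_k|^2),\qquad k=1,2,$$ and $$|\Theta^+|\le c\,(1+|\Lambda_1|),\qquad|\Theta^-|\le c\,(1+|\Lambda_2|).$$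
   Context: Probability setting. $T>0$; $(\Omega,\mathcal F,\mathbb P)$ is a complete probability space carrying a one-dimensional Brownian motion $W$ and an independent Poisson random measure $N(dt,dz)$ on $[0,T]\times U_0$, where $U_0$ is a nonempty Borel subset of a Euclidean space, with compensator $\nu(dz)dt$, $\nu(U_0)<\infty$. $\mathbb F$ is the usual augmentation of the filtration generated by $W$ and $N$; $\widetilde N(dt,dz)=N(dt,dz)-\nu(dz)dt$; $\mathcal P$ is the predictable $\sigma$-field. $L^2_{\mathbb F}(0,T;\mathbb R)$: predictable $\phi$ with $\mathbb E\int_0^T|\phi|^2dt<\infty$. $\mathcal L^{2,\nu}_{\mathcal P}(0,T;\mathbb R)$: $\mathcal P\otimes\mathcal B(U_0)$-measurable $\phi$ with $\mathbb E\int_0^T\int_{U_0}|\phi|^2\nu(dz)dt<\infty$. $r^+=\max\{r,0\}$, $r^-=\max\{-r,0\}$; $\preceq,\succeq$ is the order of symmetric matrices. Data. (A1) $A,C$ ($\mathbb R$-valued), $B_k,D_k$ ($\mathbb R^{m_k}$-valued), $k=1,2$, are predictable and essentially bounded; $E$ ($\mathbb R$-valued), $F_k$ ($\mathbb R^{m_k}$-valued) are $\mathcal P\otimes\mathcal B(U_0)$-measurable and essentially bounded with respect to $d\mathbb P\otimes dt\otimes\nu(dz)$. (A2) $Q$ ($\mathbb R$-valued), $R_{kk}$ (symmetric $m_k\times m_k$), $R_{12}=R_{21}^\top$ ($m_1\times m_2$) are predictable and essentially bounded; $G=G(T)$ is a bounded $\mathcal F_T$-measurable real random variable. $\Pi_k\subseteq\mathbb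 R^{m_k}$, $k=1,2$, are nonempty closed convex cones. The constant $\bar c>0$ is fixed such that, a.e. and for $k=1,2$: $|2A+C^2|\le\bar c$, $\int_{U_0}E(z)^2\nu(dz)\le\bar c$, $|B_k+CD_k|^2\le\bar c$, $D_kD_k^\top+\int_{U_0}F_k(z)F_k(z)^\top\nu(dz)\preceq\bar cI_{m_k}$, $|Q|\le\bar c$, $|G|\le\bar c$. Assumption (S): there are constants $\underline\delta>0$, $\bar\delta>0$, $K\ge1$ with $R_{11}\succeq\underline\delta I_{m_1}$, $R_{22}\preceq-(\bar\delta+K\bar c)I_{m_2}$, $Q\ge0$, $\underline\delta\le G\le\bar c\le K$, and $D_kD_k^\top+\int_{U_0}F_k(z)F_k(z)^\top\nu(dz)\succeq\underline\delta I_{m_k}$, $k=1,2$. Hamiltonians. Set $M_{kk'}=R_{kk}+P_{k'}D_kD_k^\top$ and the row vector $N_{kk'}=P_{k'}B_k^\top+P_{k'}D_k^\top C+D_k^\top\Lambda_{k'}$. With $\ell(z)=F_1(z)^\top v_1+F_2(z)^\top v_2$, $$\begin{aligned}H_1(v_1,v_2)={}&v_1^\top M_{11}v_1+2N_{11}v_1+2v_1^\top(P_1D_1D_2^\top+R_{12})v_2+v_2^\top M_{21}v_2+2N_{21}v_2\\&+\int_{U_0}\Big[(P_1+\Gamma_1(z))\big(((1+E(z)+\ell(z))^+)^2-1\big)-2P_1(E(z)+\ell(z))\\&\qquad+(P_2+\Gamma_2(z))((1+E(z)+\ell(z))^-)^2\Big]\nu(dz),\\H_2(v_1,v_2)={}&v_1^\top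 M_{12}v_1-2N_{12}v_1+2v_1^\top(P_2D_1D_2^\top+R_{12})v_2+v_2^\top M_{22}v_2-2N_{22}v_2\\&+\int_{U_0}\Big[(P_2+\Gamma_2(z))\big(((-1-E(z)+\ell(z))^-)^2-1\big)+2P_2(-E(z)+\ell(z))\\&\qquad+(P_1+\Gamma_1(z))((-1-E(z)+\ell(z))^+)^2\Big]\nu(dz),\end{aligned}$$ where $H_k$ depends also on $(\omega,t,P_1,P_2,\Lambda_k,\Gamma_1,\Gamma_2)$, and $$H_k^*(\omega,t,P_1,P_2,\Lambda_k,\Gamma_1,\Gamma_2)=\sup_{v_2\in\Pi_2}\inf_{v_1\in\Pi_1}H_k(v_1,v_2).$$ A saddle point of $H_k$ on $\Pi_1\times\Pi_2$ is $(\theta_1,\theta_2)\in\Pi_1\times\Pi_2$ with $H_k(\theta_1,v_2)\le H_k(\theta_1,\theta_2)\le H_k(v_1,\theta_2)$ for all $(v_1,v_2)\in\Pi_1\times\Pi_2$. (IESREJ): for $k=1,2$, $$dP_k(t)=-\Big\{(2A+C^2)P_k(t-)+2C\Lambda_k+Q+H_k^*\big(\omega,t,P_1(t-),P_2(t-),\Lambda_k(t),\Gamma_1(t,\cdot),\Gamma_2(t,\cdot)\big)\Big\}dt+\Lambda_k(t)dW(t)+\int_{U_0}\Gamma_k(t,z)\widetilde N(dt,dz),\quad P_k(T)=G(T).$$ A solution consists of càdlàg adapted real processes $P_k$, $\Lambda_k\in L^2_{\mathbb F}(0,T;\mathbb R)$, $\Gamma_k\in\mathcal L^{2,\nu}_{\mathcal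 P}(0,T;\mathbb R)$. *)

(* Defs.v *)
(* MathComp-Analysis, over an arbitrary [R : realType]. *)
From HB Require Import structures.
From mathcomp Require Import all_boot all_order all_algebra.
From mathcomp Require Import all_classical all_reals all_analysis.
From mathcomp Require Import measurable_realfun.

Set Implicit Arguments.
Unset Strict Implicit.
Unset Printing Implicit Defensive.

Import Order.TTheory GRing.Theory Num.Theory.
Import numFieldNormedType.Exports.

Local Open Scope classical_set_scope.
Local Open Scope ring_scope.

(* R^l with its Borel sigma-algebra (the norm topology on ['rV[R]_l] is the
   usual one). *)
Notation borelrV R l :=
  (g_sigma_algebraType ([set A | open A] : set (set 'rV[R]_l))).

Notation leb := lebesgue_measure.

Section finite_dimension.
Context {R : realType}.

Definition bil m n (v : 'cV[R]_m) (M : 'M[R]_(m, n)) (w : 'cV[R]_n) : R :=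
  (v^T *m M *m w) 0 0.

(* The library norm on matrices is the sup norm; these are the Euclidean
   norm and its square. *)
Definition enormsq m (v : 'cV[R]_m) : R := \sum_i v i 0 ^+ 2.
Definition enorm m (v : 'cV[R]_m) : R := Num.sqrt (enormsq v).
Definition enorm_pair m n (v : 'cV[R]_m) (w : 'cV[R]_n) : R :=
  Num.sqrt (enormsq v + enormsq w).

Definition loewner_le m (M N : 'M[R]_m) : Prop :=
  forall x : 'cV[R]_m, 0 <= bil x (N - M) x.

Definition closed_convex_cone m (Pi : set 'cV[R]_m) : Prop :=
  [/\ Pi !=set0, closed Pi,
      convex_set (Pi : set (convex_lmodType 'cV[R]_m)) &
      forall (a : R) v, 0 <= a -> Pi v -> Pi (a *: v)].

Definition saddle_point m n (Pi1 : set 'cV[R]_m) (Pi2 : set 'cV[R]_n)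
    (H : 'cV[R]_m -> 'cV[R]_n -> R) (th1 : 'cV[R]_m) (th2 : 'cV[R]_n) : Prop :=
  [/\ Pi1 th1, Pi2 th2 &
      forall v1 v2, Pi1 v1 -> Pi2 v2 ->
        H th1 v2 <= H th1 th2 /\ H th1 th2 <= H v1 th2].

Definition supinf m n (Pi1 : set 'cV[R]_m) (Pi2 : set 'cV[R]_n)
    (H : 'cV[R]_m -> 'cV[R]_n -> R) : \bar R :=
  ereal_sup [set ereal_inf [set (H v1 v2)%:E | v1 in Pi1] | v2 in Pi2].

Definition cadlag (T : R) (f : R -> R) : Prop :=
  (forall t : R, 0 <= t < T -> f @ t^'+ --> f t) /\
  (forall t : R, 0 < t <= T -> cvg (f @ t^'-)).

(* f(t-).  Processes are only meaningful on [0, T], so the value at t = 0 is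
   irrelevant; it is only used for dt-almost every t. *)
Definition left_limit (f : R -> R) (t : R) : R := lim (f @ t^'-).

End finite_dimension.

Section noise.
Context {R : realType} {d : measure_display} {Omega : measurableType d}.
Context (Pr : probability Omega R) (T : R).

Definition independent_classes (G H : set (set Omega)) : Prop :=
  forall A B, G A -> H B -> Pr (A `&` B) = (Pr A * Pr B)%E.

Definition events_of (X : Omega -> R) : set (set Omega) :=
  [set X @^-1` B | B in measurable].

Definition W_events (W : R -> Omega -> R) (t : R) : set (set Omega) :=
  \bigcup_(s in `[0, t]) events_of (W s).

Record brownian_motion (W : R -> Omega -> R) : Prop := {
  bm_measurable : forall t : R, 0 <= t <= T -> measurable_fun setT (W t) ;
  bm_start : {ae Pr, forall w, W 0 w = 0} ;
  bm_normal : forall s t : R, 0 <= s -> s < t -> t <= T ->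
    forall B : set R, measurable B ->
      Pr ((fun w => W t w - W s w) @^-1` B)
      = normal_prob 0 (Num.sqrt (t - s)) B ;
  bm_indep : forall s t : R, 0 <= s -> s < t -> t <= T ->
    independent_classes <<s W_events W s >>
                        (events_of (fun w => W t w - W s w)) ;
  bm_continuous : {ae Pr, forall w, {within `[0, T], continuous (W ^~ w)}} }.

Context {d' : measure_display} {U : measurableType d'}.
Context (U0 : set U) (nu : {finite_measure set U -> \bar R}).

Definition N_events (N : Omega -> {measure set (R * U) -> \bar R}) (t : R) :
    set (set Omega) :=
  [set E | exists A (B : set (\bar R)),
    [/\ measurable A, A `<=` `[0, t] `*` U0, measurable B &
        E = [set w | B (N w A)]]].

(* [poisson_prob r _] is the Poisson law of rate [r]; its [nat] argument is
   unused.  [poisson_prob 0 _] is the Dirac mass at 0, whereas the library's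
   [poisson_pmf 0] is not a probability mass function. *)
Record poisson_random_measure (N : Omega -> {measure set (R * U) -> \bar R}) :
    Prop := {
  prm_integer : forall w A, measurable A -> A `<=` `[0, T] `*` U0 ->
    N w A = +oo%E \/ exists n : nat, N w A = n%:R%:E ;
  prm_measurable : forall A, measurable A -> A `<=` `[0, T] `*` U0 ->
    measurable_fun setT (fun w => N w A) ;
  prm_law : forall A, measurable A -> A `<=` `[0, T] `*` U0 ->
    forall k : nat, Pr [set w | N w A = k%:R%:E]
      = poisson_prob (fine ((leb \x nu)%E A)) 0 [set k] ;
  prm_indep : forall (n : nat) (A : 'I_n -> set (R * U)),
    (forall i, measurable (A i) /\ A i `<=` `[0, T] `*` U0) ->
    trivIset setT A ->
    forall B : 'I_n -> set (\bar R), (forall i, measurable (B i)) ->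
      Pr [set w | forall i, B i (N w (A i))]
      = (\prod_(i < n) Pr [set w | B i (N w (A i))])%E }.

End noise.

Section stochastic_basis.
Context {R : realType} {d : measure_display} {Omega : measurableType d}.
Context {d' : measure_display} {U : measurableType d'}.
Context (Pr : probability Omega R) (T : R).
Context (U0 : set U) (nu : {finite_measure set U -> \bar R}).

(* Usual augmentation of the filtration generated by [W] and [N]: the index
   set of the intersection is ]t, T] (together with T, which only matters
   when t = T). *)
Definition augmented_filtration (W : R -> Omega -> R)
    (N : Omega -> {measure set (R * U) -> \bar R}) (t : R) :
    set (set Omega) :=
  \bigcap_(s in [set s : R | t < s <= T \/ s = T])
    <<s W_events W s `|` N_events U0 N s `|` Pr.-negligible >>.

Section filtration.
Context (F : R -> set (set Omega)).

Definition adapted (X : R -> Omega -> R) : Prop :=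
  forall t : R, 0 <= t <= T -> events_of (X t) `<=` F t.

Definition predictable_rectangles : set (set (R * Omega)) :=
  [set E | (exists2 A, F 0 A & E = [set 0] `*` A) \/
           (exists (s t : R) A, [/\ 0 <= s, s < t, t <= T, F s A &
                              E = `]s, t] `*` A])].

(* [R * Omega] with a sigma-algebra whose trace on [0, T] * Omega is the
   predictable sigma-field. *)
Let predictable_type := g_sigma_algebraType predictable_rectangles.

Definition predictable (phi : R -> Omega -> R) : Prop :=
  measurable_fun (`[0, T] `*` setT : set predictable_type)
    (fun p : predictable_type => phi p.1 p.2).

Definition predictable_mark (phi : R -> Omega -> U -> R) : Prop :=
  measurable_fun ((`[0, T] `*` setT) `*` U0 : set (predictable_type * U))
    (fun q : predictable_type * U => phi q.1.1 q.1.2 q.2).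

Definition predictable_mx m n (phi : R -> Omega -> 'M[R]_(m, n)) : Prop :=
  forall i j, predictable (fun t w => phi t w i j).

Definition predictable_mark_mx m n (phi : R -> Omega -> U -> 'M[R]_(m, n)) :
    Prop :=
  forall i j, predictable_mark (fun t w z => phi t w z i j).

End filtration.

Definition ae_dt_dP (Q : R -> Omega -> Prop) : Prop :=
  {ae (leb \x Pr)%E, forall p : R * Omega, 0 <= p.1 <= T -> Q p.1 p.2}.

Definition ae_dt_dP_dnu (Q : R -> Omega -> U -> Prop) : Prop :=
  {ae ((leb \x Pr) \x nu)%E, forall q : R * Omega * U,
    0 <= q.1.1 <= T -> U0 q.2 -> Q q.1.1 q.1.2 q.2}.

Definition ess_bounded (V : normedModType R) (phi : R -> Omega -> V) : Prop :=
  exists c : R, ae_dt_dP (fun t w => `|phi t w| <= c).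

Definition ess_bounded_mark (V : normedModType R)
    (phi : R -> Omega -> U -> V) : Prop :=
  exists c : R, ae_dt_dP_dnu (fun t w z => `|phi t w z| <= c).

(* E int_0^T |phi|^2 dt *)
Definition sqnorm_dt_dP (phi : R -> Omega -> R) : \bar R :=
  (\int[leb \x Pr]_(p in `[0%R, T] `*` setT) (phi p.1 p.2 ^+ 2)%:E)%E.

Definition L2_F (F : R -> set (set Omega)) (phi : R -> Omega -> R) : Prop :=
  predictable F phi /\ (sqnorm_dt_dP phi < +oo)%E.

Definition L2_nu (F : R -> set (set Omega)) (phi : R -> Omega -> U -> R) :
    Prop :=
  predictable_mark F phi /\
  (\int[(leb \x Pr) \x nu]_(q in (`[0%R, T] `*` setT) `*` U0)
     (phi q.1.1 q.1.2 q.2 ^+ 2)%:E < +oo)%E.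

(* The integrand \sum_(i < n) xi_i 1_{]tau_i, tau_(i+1)]}. *)
Record simple_integrand := SimpleIntegrand {
  si_size : nat ;
  si_time : nat -> R ;
  si_coef : nat -> Omega -> R }.

Definition simple_predictable (F : R -> set (set Omega))
    (S : simple_integrand) : Prop :=
  [/\ 0 <= si_time S 0, si_time S (si_size S) <= T,
      forall i, (i < si_size S)%N -> si_time S i <= si_time S i.+1 &
      forall i, (i < si_size S)%N ->
        events_of (si_coef S i) `<=` F (si_time S i) /\
        exists c : R, forall w, `|si_coef S i w| <= c].

Definition simple_process (S : simple_integrand) (t : R) (w : Omega) : R :=
  \sum_(i < si_size S)
    si_coef S i w * \1_(`]si_time S i, si_time S i.+1]) t.

Definition simple_integral (W : R -> Omega -> R) (S : simple_integrand)
    (t : R) (w : Omega) : R :=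
  \sum_(i < si_size S)
    si_coef S i w * (W (Num.min (si_time S i.+1) t) w
                     - W (Num.min (si_time S i) t) w).

(* [M] is a continuous version of the Ito integral t |-> int_0^t phi dW:
   [M t] is, for every t, the L^2(Pr)-limit of the integrals of simple
   predictable integrands converging to [phi] in L^2(dt * Pr).  This
   determines [M] up to indistinguishability. *)
Definition ito_integral (F : R -> set (set Omega)) (W : R -> Omega -> R)
    (phi M : R -> Omega -> R) : Prop :=
  [/\ adapted F M,
      {ae Pr, forall w, {within `[0, T], continuous (M ^~ w)}} &
      exists S : nat -> simple_integrand,
        [/\ forall n, simple_predictable F (S n),
            sqnorm_dt_dP (fun t w => simple_process (S n) t w - phi t w)
              @[n --> \oo] --> 0%E &
            forall t : R, 0 <= t <= T ->
              (\int[Pr]_w ((simple_integral W (S n) t w - M t w) ^+ 2)%:E)%E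
                @[n --> \oo] --> 0%E]].

(* int_0^t int_U0 phi d(N - nu ds).  As nu is finite, for phi in [L2_nu] both
   integrals converge absolutely almost surely, and their difference is the
   stochastic integral against the compensated measure. *)
Definition compensated_integral (N : Omega -> {measure set (R * U) -> \bar R})
    (phi : R -> Omega -> U -> R) (t : R) (w : Omega) : R :=
  \int[N w]_(q in `]0, t] `*` U0) phi q.1 w q.2
  - \int[(leb \x nu)%E]_(q in `]0, t] `*` U0) phi q.1 w q.2.

(* dX(t) = - f(t) dt + L(t) dW(t) + int_U0 G(t, z) Ntilde(dt, dz), X(T) = xi,
   on [0, T], in integrated form; [f] may take infinite values, on a dt-null
   set. *)
Record backward_sde (F : R -> set (set Omega)) (W : R -> Omega -> R)
    (N : Omega -> {measure set (R * U) -> \bar R})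
    (f : R -> Omega -> \bar R) (xi : Omega -> R)
    (X L : R -> Omega -> R) (G : R -> Omega -> U -> R) : Prop := {
  bsde_adapted : adapted F X ;
  bsde_cadlag : {ae Pr, forall w, cadlag T (X ^~ w)} ;
  bsde_L : L2_F F L ;
  bsde_G : L2_nu F G ;
  bsde_drift : {ae Pr, forall w, leb.-integrable `[0, T] (f ^~ w)} ;
  bsde_eq : exists2 M, ito_integral F W L M &
    {ae Pr, forall w (t : R), 0 <= t <= T ->
      X t w = xi w + fine (\int[leb]_(s in `[t, T]) f s w)%E
              - (M T w - M t w)
              - (compensated_integral N G T w - compensated_integral N G t w)} }.

End stochastic_basis.

Section riccati_system.
Context {R : realType} {d : measure_display} {Omega : measurableType d}.
Context {d' : measure_display} {U : measurableType d'}.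
Context (m1 m2 : nat).

Record coefficients := Coefficients {
  cA : R -> Omega -> R ;
  cC : R -> Omega -> R ;
  cB1 : R -> Omega -> 'cV[R]_m1 ;
  cB2 : R -> Omega -> 'cV[R]_m2 ;
  cD1 : R -> Omega -> 'cV[R]_m1 ;
  cD2 : R -> Omega -> 'cV[R]_m2 ;
  cE : R -> Omega -> U -> R ;
  cF1 : R -> Omega -> U -> 'cV[R]_m1 ;
  cF2 : R -> Omega -> U -> 'cV[R]_m2 ;
  cQ : R -> Omega -> R ;
  cR11 : R -> Omega -> 'M[R]_m1 ;
  cR22 : R -> Omega -> 'M[R]_m2 ;
  cR12 : R -> Omega -> 'M[R]_(m1, m2) ;
  cG : Omega -> R }.

Context (Pr : probability Omega R) (T : R).
Context (U0 : set U) (nu : {finite_measure set U -> \bar R}).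
Context (F : R -> set (set Omega)).

Record assumption_A1 (co : coefficients) : Prop := {
  A1_A : predictable T F (cA co) /\ ess_bounded Pr T (cA co) ;
  A1_C : predictable T F (cC co) /\ ess_bounded Pr T (cC co) ;
  A1_B1 : predictable_mx T F (cB1 co) /\ ess_bounded Pr T (cB1 co) ;
  A1_B2 : predictable_mx T F (cB2 co) /\ ess_bounded Pr T (cB2 co) ;
  A1_D1 : predictable_mx T F (cD1 co) /\ ess_bounded Pr T (cD1 co) ;
  A1_D2 : predictable_mx T F (cD2 co) /\ ess_bounded Pr T (cD2 co) ;
  A1_E : predictable_mark T U0 F (cE co) /\
         ess_bounded_mark Pr T U0 nu (cE co) ;
  A1_F1 : predictable_mark_mx T U0 F (cF1 co) /\
          ess_bounded_mark Pr T U0 nu (cF1 co) ;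
  A1_F2 : predictable_mark_mx T U0 F (cF2 co) /\
          ess_bounded_mark Pr T U0 nu (cF2 co) }.

(* R21 is the transpose of R12, so only R12 is recorded. *)
Record assumption_A2 (co : coefficients) : Prop := {
  A2_Q : predictable T F (cQ co) /\ ess_bounded Pr T (cQ co) ;
  A2_R11 : predictable_mx T F (cR11 co) /\ ess_bounded Pr T (cR11 co) ;
  A2_R22 : predictable_mx T F (cR22 co) /\ ess_bounded Pr T (cR22 co) ;
  A2_R12 : predictable_mx T F (cR12 co) /\ ess_bounded Pr T (cR12 co) ;
  A2_sym1 : forall (t : R) w, 0 <= t <= T ->
    (cR11 co t w)^T = cR11 co t w ;
  A2_sym2 : forall (t : R) w, 0 <= t <= T ->
    (cR22 co t w)^T = cR22 co t w ;
  A2_G : events_of (cG co) `<=` F T /\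
         exists c : R, {ae Pr, forall w, `|cG co w| <= c} }.

(* D D^T + int_U0 F(z) F(z)^T nu(dz) *)
Definition diffusion_gram m (D : 'cV[R]_m) (Fz : U -> 'cV[R]_m) : 'M[R]_m :=
  D *m D^T + \matrix_(i, j) \int[nu]_(z in U0) (Fz z i 0 * Fz z j 0).

Record bounded_by (co : coefficients) (cbar : R) : Prop := {
  bb_pos : 0 < cbar ;
  bb_A : ae_dt_dP Pr T (fun t w => `|2 * cA co t w + cC co t w ^+ 2| <= cbar) ;
  bb_E : ae_dt_dP Pr T (fun t w =>
    \int[nu]_(z in U0) (cE co t w z ^+ 2) <= cbar) ;
  bb_B1 : ae_dt_dP Pr T (fun t w =>
    enormsq (cB1 co t w + cC co t w *: cD1 co t w) <= cbar) ;
  bb_B2 : ae_dt_dP Pr T (fun t w =>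
    enormsq (cB2 co t w + cC co t w *: cD2 co t w) <= cbar) ;
  bb_D1 : ae_dt_dP Pr T (fun t w =>
    loewner_le (diffusion_gram (cD1 co t w) (cF1 co t w)) cbar%:M) ;
  bb_D2 : ae_dt_dP Pr T (fun t w =>
    loewner_le (diffusion_gram (cD2 co t w) (cF2 co t w)) cbar%:M) ;
  bb_Q : ae_dt_dP Pr T (fun t w => `|cQ co t w| <= cbar) ;
  bb_G : {ae Pr, forall w, `|cG co w| <= cbar} }.

Record assumption_S (co : coefficients) (cbar dlow dbar K : R) : Prop := {
  S_dlow : 0 < dlow ;
  S_dbar : 0 < dbar ;
  S_K : 1 <= K ;
  S_R11 : ae_dt_dP Pr T (fun t w => loewner_le dlow%:M (cR11 co t w)) ;
  S_R22 : ae_dt_dP Pr T (fun t w =>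
    loewner_le (cR22 co t w) (- (dbar + K * cbar))%:M) ;
  S_Q : ae_dt_dP Pr T (fun t w => 0 <= cQ co t w) ;
  S_G : {ae Pr, forall w, dlow <= cG co w <= cbar} ;
  S_cbar : cbar <= K ;
  S_D1 : ae_dt_dP Pr T (fun t w =>
    loewner_le dlow%:M (diffusion_gram (cD1 co t w) (cF1 co t w))) ;
  S_D2 : ae_dt_dP Pr T (fun t w =>
    loewner_le dlow%:M (diffusion_gram (cD2 co t w) (cF2 co t w))) }.

Definition pospart (r : R) : R := Num.max r 0.
Definition negpart (r : R) : R := Num.max (- r) 0.

(* M_{kk'} and N_{kk'}: the matrix data carry the index k, and p = P_{k'},
   l = Lambda_{k'}. *)
Definition Mmx m (Rkk : 'M[R]_m) (D : 'cV[R]_m) (p : R) : 'M[R]_m :=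
  Rkk + p *: (D *m D^T).
Definition Nrow m (B D : 'cV[R]_m) (c p l : R) : 'rV[R]_m :=
  p *: B^T + (p * c) *: D^T + l *: D^T.

Section hamiltonians.
Context (co : coefficients) (t : R) (w : Omega).
Context (p1 p2 l : R) (g1 g2 : U -> R) (v1 : 'cV[R]_m1) (v2 : 'cV[R]_m2).

Let C := cC co t w.
Let B1 := cB1 co t w.
Let B2 := cB2 co t w.
Let D1 := cD1 co t w.
Let D2 := cD2 co t w.
Let E := cE co t w.
Let R11 := cR11 co t w.
Let R22 := cR22 co t w.
Let R12 := cR12 co t w.

Let ell (z : U) : R :=
  ((cF1 co t w z)^T *m v1) 0 0 + ((cF2 co t w z)^T *m v2) 0 0.

Definition H1 : R :=
  bil v1 (Mmx R11 D1 p1) v1 + 2 * (Nrow B1 D1 C p1 l *m v1) 0 0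
  + 2 * bil v1 (p1 *: (D1 *m D2^T) + R12) v2
  + bil v2 (Mmx R22 D2 p1) v2 + 2 * (Nrow B2 D2 C p1 l *m v2) 0 0
  + \int[nu]_(z in U0)
      ((p1 + g1 z) * (pospart (1 + E z + ell z) ^+ 2 - 1)
       - 2 * p1 * (E z + ell z)
       + (p2 + g2 z) * negpart (1 + E z + ell z) ^+ 2).

Definition H2 : R :=
  bil v1 (Mmx R11 D1 p2) v1 - 2 * (Nrow B1 D1 C p2 l *m v1) 0 0
  + 2 * bil v1 (p2 *: (D1 *m D2^T) + R12) v2
  + bil v2 (Mmx R22 D2 p2) v2 - 2 * (Nrow B2 D2 C p2 l *m v2) 0 0
  + \int[nu]_(z in U0)
      ((p2 + g2 z) * (negpart (- 1 - E z + ell z) ^+ 2 - 1)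
       + 2 * p2 * (- E z + ell z)
       + (p1 + g1 z) * pospart (- 1 - E z + ell z) ^+ 2).

End hamiltonians.

Record riccati_processes := RiccatiProcesses {
  rP1 : R -> Omega -> R ;
  rP2 : R -> Omega -> R ;
  rL1 : R -> Omega -> R ;
  rL2 : R -> Omega -> R ;
  rG1 : R -> Omega -> U -> R ;
  rG2 : R -> Omega -> U -> R }.

Definition H1_along (co : coefficients) (S : riccati_processes) (t : R)
    (w : Omega) : 'cV[R]_m1 -> 'cV[R]_m2 -> R :=
  H1 co t w (left_limit (rP1 S ^~ w) t) (left_limit (rP2 S ^~ w) t)
    (rL1 S t w) (rG1 S t w) (rG2 S t w).

Definition H2_along (co : coefficients) (S : riccati_processes) (t : R)
    (w : Omega) : 'cV[R]_m1 -> 'cV[R]_m2 -> R :=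
  H2 co t w (left_limit (rP1 S ^~ w) t) (left_limit (rP2 S ^~ w) t)
    (rL2 S t w) (rG1 S t w) (rG2 S t w).

Context (Pi1 : set 'cV[R]_m1) (Pi2 : set 'cV[R]_m2).

Definition H1star (co : coefficients) (S : riccati_processes) (t : R)
    (w : Omega) : \bar R := supinf Pi1 Pi2 (H1_along co S t w).

Definition H2star (co : coefficients) (S : riccati_processes) (t : R)
    (w : Omega) : \bar R := supinf Pi1 Pi2 (H2_along co S t w).

Definition riccati_drift (co : coefficients) (P L : R -> Omega -> R)
    (Hstar : R -> Omega -> \bar R) (t : R) (w : Omega) : \bar R :=
  (((2 * cA co t w + cC co t w ^+ 2) * left_limit (P ^~ w) t
    + 2 * cC co t w * L t w + cQ co t w)%:E + Hstar t w)%E.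

Definition riccati_solution (W : R -> Omega -> R)
    (N : Omega -> {measure set (R * U) -> \bar R})
    (co : coefficients) (S : riccati_processes) : Prop :=
  backward_sde Pr T U0 nu F W N
    (riccati_drift co (rP1 S) (rL1 S) (H1star co S)) (cG co)
    (rP1 S) (rL1 S) (rG1 S) /\
  backward_sde Pr T U0 nu F W N
    (riccati_drift co (rP2 S) (rL2 S) (H2star co S)) (cG co)
    (rP2 S) (rL2 S) (rG2 S).

End riccati_system.

Arguments coefficients R {d} Omega {d'} U m1 m2.
Arguments riccati_processes R {d} Omega {d'} U.

(* Main.v *)
(* At a fixed [(w, t)] stack the two controls into one vector.  The Hamiltonian
   is then differentiable with a Lipschitz gradient.  It is strongly convex in
   the first control, since [R11 >= dlow] and the weights [P_k + Gamma_k] of the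
   jump part are nonnegative; it is strongly concave in the second one, since
   these weights and [P_k] are at most [K], so that the convex diffusion and jump
   terms contribute at most [K * cbar], which [R22 <= - (dbar + K * cbar)] absorbs.
   Changing the sign of the second component of the gradient gives a strongly
   monotone Lipschitz operator, so the projected gradient iteration with a small
   deterministic step contracts to the solution of a variational inequality,
   which is the unique saddle point.  Its distance to 0 is controlled by the
   operator at 0, whence the growth bounds, and it is predictable as the limit of
   the predictable iterates started at 0.  [H2] is [H1] with the two processes
   exchanged, evaluated at the opposite controls.

   What remains is [0 <= P_k(t-) + Gamma_k(t, z) <= K] for almost all [(t, w, z)].
   Almost surely [N] is finite and charges each slice [{t} * U0] at most once, so
   at an atom [(t, z)] of [N] the path of [P_k] jumps by [Gamma_k(t, z)], and
   [P_k(t-) + Gamma_k(t, z) = P_k(t)] lies in [[0, K]].  Hence [N] does not charge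
   the predictable set [D] where the bound fails, and the compensation formula
   [E N(D) = (dt * dP * nu)(D)] shows that [D] is null. *)

Require Import Defs.
From HB Require Import structures.
From mathcomp Require Import all_boot all_order all_algebra.
From mathcomp Require Import all_classical all_reals all_analysis.
From mathcomp Require Import measurable_realfun.
From mathcomp Require Import ring lra.

Set Implicit Arguments.
Unset Strict Implicit.
Unset Printing Implicit Defensive.

Import Order.TTheory GRing.Theory Num.Theory.
Import numFieldNormedType.Exports.

Local Open Scope classical_set_scope.
Local Open Scope ring_scope.

(** * Euclidean space *)

(** The hypotheses bound [P_k] but not [Gamma_k], which is determined only up to null sets, so a
    bound on [P_k + Gamma_k] has to be read off the jumps of the paths. Paths are càdlàg only almost
    surely; a process [pleft] that is predictable without exception therefore replaces the left
    limit in the set tested by the compensation formula. On rectangles that formula needs [N] to be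
    independent of the past in the right-continuous filtration, to which [W] and the negligible sets
    also contribute; a Dynkin class extends it. Marks are treated as points of an arbitrary
    measurable space: instead of exhibiting the mark charged by [N], the proof shows that a
    measurable function is almost everywhere constant for an integer-valued measure of mass one.

    No measurable selection is involved: the step of the iteration depends on deterministic bounds
    only, each projection is a nonexpansive map, and upper limits of predictable iterates are
    predictable. The bounds on the data hold for almost every mark, so at each point the game is
    solved on a measurable set of marks of full measure, over which all integrals are the same. *)

Section euclidean.
Context {R : realType}.

Definition dot n (v w : 'cV[R]_n) : R := \sum_i v i 0 * w i 0.

Variable n : nat.
Implicit Types u v w : 'cV[R]_n.

Lemma dotC v w : dot v w = dot w v.
Proof. by apply: eq_bigr => i _; rewrite mulrC. Qed.

Lemma dotDr u v w : dot u (v + w) = dot u v + dot u w.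
Proof. by rewrite -big_split; apply: eq_bigr => i _; rewrite mxE mulrDr. Qed.

Lemma dotZr a u v : dot u (a *: v) = a * dot u v.
Proof. by rewrite mulr_sumr; apply: eq_bigr => i _; rewrite mxE mulrCA. Qed.

Lemma dotNr u v : dot u (- v) = - dot u v.
Proof. by rewrite -scaleN1r dotZr mulN1r. Qed.

Lemma dotBr u v w : dot u (v - w) = dot u v - dot u w.
Proof. by rewrite dotDr dotNr. Qed.

Lemma dotDl u v w : dot (u + v) w = dot u w + dot v w.
Proof. by rewrite !(dotC _ w) dotDr. Qed.

Lemma dotNl u v : dot (- u) v = - dot u v.
Proof. by rewrite !(dotC _ v) dotNr. Qed.

Lemma dotBl u v w : dot (u - v) w = dot u w - dot v w.
Proof. by rewrite dotDl dotNl. Qed.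

Lemma dotZl a u v : dot (a *: u) v = a * dot u v.
Proof. by rewrite !(dotC _ v) dotZr. Qed.

Lemma dot0r u : dot u 0 = 0.
Proof. by rewrite /dot big1 // => i _; rewrite mxE mulr0. Qed.

Lemma dot0l u : dot 0 u = 0.
Proof. by rewrite dotC dot0r. Qed.

Lemma dotE u v : (u^T *m v) 0 0 = dot u v.
Proof. by rewrite mxE; apply: eq_bigr => i _; rewrite mxE. Qed.

Lemma enormsqE v : enormsq v = dot v v.
Proof. by apply: eq_bigr => i _; rewrite expr2. Qed.

Lemma enormsq_ge0 v : 0 <= enormsq v.
Proof. by apply: sumr_ge0 => i _; exact: sqr_ge0. Qed.

Lemma enormsqN v : enormsq (- v) = enormsq v.
Proof. by rewrite !enormsqE dotNl dotNr opprK. Qed.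

Lemma enormsqB v w : enormsq (v - w) = enormsq v - 2 * dot v w + enormsq w.
Proof. by rewrite !enormsqE !(dotBl, dotBr) (dotC w v); ring. Qed.

Lemma enormsqZ a v : enormsq (a *: v) = a ^+ 2 * enormsq v.
Proof. by rewrite !enormsqE dotZl dotZr mulrA -expr2. Qed.

Lemma enormsq_eq0 v : enormsq v = 0 -> v = 0.
Proof.
move=> v0; apply/colP => i; rewrite mxE; apply/eqP.
rewrite -sqrf_eq0 eq_le sqr_ge0 andbT -v0 /enormsq (bigD1 i)//= lerDl.
by apply: sumr_ge0 => j _; exact: sqr_ge0.
Qed.

Lemma enorm_ge0 v : 0 <= enorm v. Proof. exact: sqrtr_ge0. Qed.

Lemma sqr_enorm v : enorm v ^+ 2 = enormsq v.
Proof. by rewrite sqr_sqrtr ?enormsq_ge0. Qed.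

Lemma enormN v : enorm (- v) = enorm v.
Proof. by rewrite /enorm enormsqN. Qed.

Lemma ler_abs_enorm v i : `|v i 0| <= enorm v.
Proof.
rewrite -sqrtr_sqr ler_wsqrtr// /enormsq (bigD1 i)//= lerDl.
by apply: sumr_ge0 => j _; exact: sqr_ge0.
Qed.

Lemma enormsq_le v (c : R) : (forall i, `|v i 0| <= c) ->
  enormsq v <= n%:R * c ^+ 2.
Proof.
move=> vc; apply: (@le_trans _ _ (\sum_(i < n) c ^+ 2)).
  apply: ler_sum => i _; rewrite -real_normK ?num_real//.
  by rewrite lerXn2r ?nnegrE//; exact: le_trans (vc i).
by rewrite sumr_const card_ord mulr_natl.
Qed.

Lemma enorm_le v (c : R) : 0 <= c -> (enormsq v <= c ^+ 2) = (enorm v <= c).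
Proof.
by move=> c0; rewrite -sqr_enorm ler_pXn2r// nnegrE enorm_ge0.
Qed.

Lemma dot_le v w : 2 * dot v w <= enormsq v + enormsq w.
Proof. have := enormsq_ge0 (v - w); rewrite enormsqB; lra. Qed.

(* [dot_le] for the normalised vectors. *)
Lemma dot_enorm v w : dot v w <= enorm v * enorm w.
Proof.
have [v0|v0] := eqVneq (enorm v) 0.
  by rewrite v0 mul0r (@enormsq_eq0 v) ?dot0l// -sqr_enorm v0 expr0n.
have [w0|w0] := eqVneq (enorm w) 0.
  by rewrite w0 mulr0 (@enormsq_eq0 w) ?dot0r// -sqr_enorm w0 expr0n.
have := dot_le ((enorm v)^-1 *: v) ((enorm w)^-1 *: w).
rewrite dotZl dotZr !enormsqZ -!sqr_enorm -!exprMn !mulVf// !expr1n.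
have vp : 0 < enorm v by rewrite lt_neqAle eq_sym v0 enorm_ge0.
have wp : 0 < enorm w by rewrite lt_neqAle eq_sym w0 enorm_ge0.
move=> h.
have {h}: (enorm v)^-1 * ((enorm w)^-1 * dot v w) <= 1 by lra.
by rewrite mulrA -invfM ler_pdivrMl ?mulr_gt0// mulr1.
Qed.

Lemma ler_enormD v w : enorm (v + w) <= enorm v + enorm w.
Proof.
rewrite -enorm_le ?addr_ge0 ?enorm_ge0//.
rewrite -{1}(opprK w) enormsqB enormsqN dotNr -!sqr_enorm.
have := dot_enorm v w; nra.
Qed.

End euclidean.

Section geometric_convergence.
Context {R : realType} (n : nat).
Implicit Types u : nat -> 'cV[R]_n.

Lemma entrywise_cvg u (l : 'cV[R]_n) :
  (forall i, u k i 0 @[k --> \oo] --> l i 0) -> u @ \oo --> l.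
Proof.
move=> ul; apply/cvg_mx_entourageP => A entA.
have: forall ij : 'I_n * 'I_1, \forall k \near \oo,
    (l ij.1 ij.2, u k ij.1 ij.2) \in A.
  move=> [i j]; rewrite /= (ord1 j).
  by have /cvg_app_entourageP/(_ _ entA) := ul i; apply: filterS => k; rewrite inE.
move=> /filter_forall; apply: filterS => k + i j => /(_ (i, j)); exact.
Qed.

Lemma cvg_entrywise u (l : 'cV[R]_n) : u @ \oo --> l ->
  forall i, u k i 0 @[k --> \oo] --> l i 0.
Proof. by move=> ul i; exact: cvg_comp ul (@coord_continuous _ _ _ i 0 l). Qed.

(** Each coordinate is a telescoping series dominated by a geometric one, so completeness is used
    for real sequences only. *)
Lemma geometric_is_cvg u (c q : R) : 0 <= q < 1 ->
  (forall k, enorm (u k.+1 - u k) <= c * q ^+ k) -> cvgn u.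
Proof.
move=> /andP[q0 q1] uc.
have c0 : 0 <= c by have := uc 0%N; rewrite expr0 mulr1; exact/le_trans/enorm_ge0.
have cvgi i : cvgn (fun k => u k i 0).
  have : cvgn (series (fun k => u k.+1 i 0 - u k i 0)).
    apply: normed_cvg; apply: (@series_le_cvg _ _ (geometric c q)).
    - by move=> k /=.
    - by move=> k /=; rewrite mulr_ge0 ?exprn_ge0.
    - move=> k /=; apply: le_trans (uc k).
      by have := ler_abs_enorm (u k.+1 - u k) i; rewrite !mxE.
    - by apply: is_cvg_geometric_series; rewrite ger0_norm.
  have -> : series (fun k => u k.+1 i 0 - u k i 0) =
            (fun k => u k i 0 - u 0%N i 0).
    by apply/funext => k; exact: (telescope_sumr (fun k => u k i 0)).
  move=> h; suff -> : (fun k => u k i 0) =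
      (fun=> u 0%N i 0) \+ (fun k => u k i 0 - u 0%N i 0).
    exact: is_cvgD (is_cvg_cst _) h.
  by apply/funext => k /=; rewrite addrC subrK.
apply/cvg_ex; exists (\col_i limn (fun k => u k i 0)).
by apply: entrywise_cvg => i; rewrite mxE; exact: cvgi.
Qed.

Lemma closed_seq_cvg (A : set 'cV[R]_n) u (l : 'cV[R]_n) : closed A ->
  (forall k, A (u k)) -> u @ \oo --> l -> A l.
Proof.
by move=> cA uA ul; apply: (@closed_cvg _ _ _ _ u A cA _ _ ul); exact: nearW.
Qed.

Lemma cvg_dot u v (l m : 'cV[R]_n) : u @ \oo --> l -> v @ \oo --> m ->
  dot (u k) (v k) @[k --> \oo] --> dot l m.
Proof.
move=> ul vm; apply: cvg_big => [|i _]; first exact: add_continuous.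
by apply: cvgM; exact: cvg_entrywise.
Qed.

Lemma cvg_enormsqB v u (l : 'cV[R]_n) : u @ \oo --> l ->
  enormsq (v - u k) @[k --> \oo] --> enormsq (v - l).
Proof.
move=> ul; under eq_fun do rewrite enormsqE; rewrite enormsqE.
by apply: cvg_dot; apply: cvgB => //; exact: cvg_cst.
Qed.

End geometric_convergence.

(** * Projections and variational inequalities *)

Section projection.
Context {R : realType} (n : nat) (A : set 'cV[R]_n).
Hypotheses (A0 : A !=set0) (closedA : closed A).
Hypothesis convexA : forall x y (t : R), 0 <= t <= 1 -> A x -> A y ->
  A (x + t *: (y - x)).
Implicit Types x y p v : 'cV[R]_n.

(** In a convex set the midpoint of [u] and [v] is no nearer to [x] than the infimum, so two almost
    nearest points are close to each other. *)
Lemma parallelogram x u v :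
  enormsq (v - u) = 2 * enormsq (x - u) + 2 * enormsq (x - v)
                    - 4 * enormsq (x - (u + 2^-1 *: (v - u))).
Proof.
rewrite !enormsqE !(dotDr, dotDl, dotZl, dotZr, dotNl, dotNr).
rewrite !(dotC v u) !(dotC u x) !(dotC v x); lra.
Qed.

Lemma exists_nearest x :
  exists2 p, A p & forall v, A v -> enormsq (x - p) <= enormsq (x - v).
Proof.
pose D := [set enormsq (x - v) | v in A].
have infD : has_inf D.
  split; first by case: A0 => v Av; exists (enormsq (x - v)), v.
  by exists 0 => _ [v _ <-]; exact: enormsq_ge0.
have ltinf v : A v -> inf D <= enormsq (x - v).
  by move=> Av; apply: ge_inf; [case: infD|exists v].
(* The tolerance is a square so that gaps are geometric: with [e = (2^-1 ^+ k) ^+ 2], the squared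
   gap is at most [2 * (e + e / 4)], hence at most [4 * e]. *)
have minimizing k : exists v, A v /\ enormsq (x - v) < inf D + (2^-1 ^+ k) ^+ 2.
  have e0 : (0 : R) < (2^-1 ^+ k) ^+ 2 by rewrite !exprn_gt0.
  have [_ [v Av <-] h] := inf_adherent e0 infD.
  by exists v.
have [u uP] := choice minimizing.
have cvgu : cvgn u.
  apply: (@geometric_is_cvg R n u 2 2^-1); first by lra.
  move=> k; have [Ak hk] := uP k; have [Ak1 hk1] := uP k.+1.
  rewrite -enorm_le; last by rewrite mulr_ge0// exprn_ge0// invr_ge0.
  rewrite exprMn.
  rewrite (parallelogram x).
  have := ltinf _ (convexA (ltac:(lra) : 0 <= 2^-1 <= (1 : R)) Ak Ak1).
  move: hk1; rewrite [_ ^+ k.+1]exprS exprMn; have : 0 <= (2^-1 ^+ k : R) ^+ 2 by exact: sqr_ge0.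
  lra.
pose p := limn u; have up : u @ \oo --> p by [].
exists p; first by apply: closed_seq_cvg up => // k; case: (uP k).
move=> v Av; apply: le_trans (ltinf v Av).
have h : inf D + (2^-1 ^+ 2) ^+ k @[k --> \oo] --> inf D.
  rewrite -[X in _ --> X]addr0; apply: cvgD; first exact: cvg_cst.
  by apply: cvg_expr; rewrite ger0_norm ?sqr_ge0//; lra.
apply: (ler_cvg_to (cvg_enormsqB up) h).
by apply: nearW => k; rewrite exprAC ltW//; case: (uP k).
Qed.

(** The obtuse-angle characterisation of the nearest point of a convex set; both nonexpansiveness
    and the variational inequality are read off it. *)
Definition is_proj x p := A p /\ forall v, A v -> dot (x - p) (v - p) <= 0.

Lemma exists_proj x : exists p, is_proj x p.
Proof.
have [p Ap pmin] := exists_nearest x; exists p; split=> // v Av.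
rewrite leNgt; apply/negP; set a := dot _ _ => a0.
set N := enormsq (v - p); have N0 : 0 <= N by exact: enormsq_ge0.
have aN : 0 < a + N by rewrite ltr_pwDl.
(* Moving from [p] to [p + t *: (v - p)] changes the squared distance to [x] by
   [t ^+ 2 * N - 2 * t * a]; since [t * N <= a], this is at most [- t * a < 0], against the
   minimality of [p]. *)
pose t := a / (a + N).
have t01 : 0 <= t <= 1.
  by apply/andP; split; [exact: ltW (divr_gt0 _ _)|rewrite ler_pdivrMr// mul1r lerDl].
have t0 : 0 < t by rewrite divr_gt0.
have := pmin _ (convexA t01 Ap Av).
rewrite opprD addrA [leRHS]enormsqB dotZr enormsqZ -/a -/N.
have tN : t * N <= a.
  rewrite /t mulrAC ler_pdivrMr// ler_wpM2l ?ltW//; lra.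
nra.
Qed.

Definition metric_proj x := xget 0 (is_proj x).

Lemma projP x : is_proj x (metric_proj x).
Proof. by rewrite /metric_proj; apply: (@xgetPex _ 0 (is_proj x)); exact: exists_proj. Qed.

(** Test the criterion of each projection at the other one and add: the squared distance of the
    projections is at most the product of [x - y] with their difference, and Cauchy-Schwarz
    concludes. *)
Lemma proj_nonexpansive x y : enorm (metric_proj x - metric_proj y) <= enorm (x - y).
Proof.
have [Ax /(_ _ (proj1 (projP y))) hx] := projP x.
have [Ay /(_ _ Ax) hy] := projP y.
set p := metric_proj x in hx hy *; set q := metric_proj y in hx hy *.
have h : enorm (p - q) ^+ 2 <= enorm (x - y) * enorm (p - q).
  apply: le_trans (dot_enorm _ _).
  move: hx hy; rewrite sqr_enorm enormsqE !dotBl !dotBr.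
  rewrite (dotC q p); lra.
have [->|pq] := eqVneq (enorm (p - q)) 0; first exact: enorm_ge0.
by rewrite -(@ler_pM2r _ (enorm (p - q))) -?expr2// lt_neqAle eq_sym pq enorm_ge0.
Qed.

Lemma proj_id x : A x -> metric_proj x = x.
Proof.
move=> Ax; have [Ap /(_ _ Ax)] := projP x.
rewrite -enormsqE => h; apply/esym/eqP; rewrite -subr_eq0; apply/eqP.
by apply: enormsq_eq0; apply/eqP; rewrite eq_le h enormsq_ge0.
Qed.

End projection.

(** * The projected iteration and its fixed point *)

Section variational_inequality.
Context {R : realType} (n : nat) (A : set 'cV[R]_n).
Hypotheses (A0 : A 0) (closedA : closed A).
Hypothesis convexA : forall x y (t : R), 0 <= t <= 1 -> A x -> A y ->
  A (x + t *: (y - x)).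
Context (G : 'cV[R]_n -> 'cV[R]_n) (tau q : R).
Hypotheses (tau0 : 0 < tau) (q01 : 0 <= q < 1).
Hypothesis contr : forall x y,
  enorm ((x - tau *: G x) - (y - tau *: G y)) <= q * enorm (x - y).

Let An : A !=set0. Proof. by exists 0. Qed.

Definition proj_step x := metric_proj A (x - tau *: G x).
Definition proj_iter k := iter k proj_step 0.

Lemma proj_step_contr x y :
  enorm (proj_step x - proj_step y) <= q * enorm (x - y).
Proof. exact: le_trans (proj_nonexpansive _ _ _ _ _) (contr x y). Qed.

Lemma proj_iter_is_cvg : cvgn proj_iter.
Proof.
apply: (@geometric_is_cvg _ _ _ (enorm (proj_iter 1 - proj_iter 0)) q) => //.
elim=> [|k IH]; first by rewrite expr0 mulr1.
rewrite exprS mulrCA; apply: le_trans (proj_step_contr _ _) _.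
by rewrite ler_wpM2l//; case/andP: q01.
Qed.

Definition vi_sol := limn proj_iter.

Lemma proj_iter_cvg : proj_iter @ \oo --> vi_sol.
Proof. exact: proj_iter_is_cvg. Qed.

(** The distance from [proj_step vi_sol] to the iterate [k.+1] is at most [q] times that from
    [vi_sol] to the iterate [k]; in the limit nothing is left between [proj_step vi_sol] and
    [vi_sol]. *)
Lemma vi_sol_fixed : proj_step vi_sol = vi_sol.
Proof.
apply/eqP; rewrite -subr_eq0; apply/eqP/enormsq_eq0/eqP.
rewrite eq_le enormsq_ge0 andbT.
have h1 : enormsq (proj_step vi_sol - proj_iter k.+1) @[k --> \oo]
    --> enormsq (proj_step vi_sol - vi_sol).
  by apply: cvg_enormsqB; rewrite cvg_shiftS; exact: proj_iter_cvg.
have h2 : q ^+ 2 * enormsq (vi_sol - proj_iter k) @[k --> \oo] --> (0 : R).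
  rewrite -(mulr0 (q ^+ 2)); apply: cvgMr.
  have := @cvg_enormsqB _ _ vi_sol _ _ proj_iter_cvg.
  by rewrite subrr [enormsq 0]enormsqE dot0l.
apply: (ler_cvg_to h1 h2); apply: nearW => k.
rewrite -!sqr_enorm -exprMn ler_pXn2r ?nnegrE ?mulr_ge0 ?enorm_ge0//.
  exact: proj_step_contr.
by case/andP: q01.
Qed.

Lemma vi_sol_in : A vi_sol.
Proof. by rewrite -vi_sol_fixed; case: (projP An closedA convexA (vi_sol - tau *: G vi_sol)). Qed.

(** At a fixed point the obtuse-angle criterion for [vi_sol - tau *: G vi_sol] reads [- (tau * dot
    (G vi_sol) (v - vi_sol)) <= 0]. *)
Lemma vi_solP v : A v -> 0 <= dot (G vi_sol) (v - vi_sol).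
Proof.
move=> Av; have [_ /(_ _ Av)] :=
  projP An closedA convexA (vi_sol - tau *: G vi_sol).
rewrite -/(proj_step vi_sol) vi_sol_fixed addrAC subrr sub0r dotNl dotZl.
by rewrite oppr_le0 pmulr_rge0.
Qed.

(** The a priori estimate of Banach's theorem started at 0. As 0 is its own projection, the first
    iterate has norm at most [tau * enorm (G 0)]. *)
Lemma vi_sol_bound : enorm vi_sol <= tau / (1 - q) * enorm (G 0).
Proof.
have q1 : 0 < 1 - q by case/andP: q01; lra.
rewrite mulrAC ler_pdivlMr//.
have h0 : enorm (proj_step 0) <= tau * enorm (G 0).
  have := proj_nonexpansive An closedA convexA (0 - tau *: G 0) 0.
  rewrite (proj_id An closedA convexA A0) !subr0 sub0r enormN => h.
  rewrite /proj_step sub0r; apply: le_trans h _; rewrite {1}/enorm enormsqZ sqrtrM ?sqr_ge0//.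
  by rewrite sqrtr_sqr gtr0_norm.
have h := proj_step_contr vi_sol 0; rewrite vi_sol_fixed subr0 in h.
have := ler_enormD (vi_sol - proj_step 0) (proj_step 0); rewrite subrK; lra.
Qed.

End variational_inequality.

(* Strong monotonicity and Lipschitz continuity make a short enough gradient
   step contracting: [|x - tau G x - (y - tau G y)|^2] is at most
   [(1 - 2 tau mu + tau^2 L^2) |x - y|^2]. *)
Lemma gradient_step_contraction (R : realType) n (G : 'cV[R]_n -> 'cV[R]_n)
    (mu L : R) : 0 < mu -> mu <= L ->
  (forall x y, mu * enormsq (x - y) <= dot (G x - G y) (x - y)) ->
  (forall x y, enormsq (G x - G y) <= L ^+ 2 * enormsq (x - y)) ->
  forall x y, enorm ((x - (mu / L ^+ 2) *: G x) - (y - (mu / L ^+ 2) *: G y))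
    <= Num.sqrt (1 - (mu / L) ^+ 2) * enorm (x - y).
Proof.
move=> mu0 muL mono lip x y; set tau := mu / _.
have L0 : 0 < L by exact: lt_le_trans muL.
have -> : x - tau *: G x - (y - tau *: G y) = (x - y) - tau *: (G x - G y).
  by apply/matrixP => i j; rewrite !mxE; ring.
rewrite -sqrtrM; last first.
  by rewrite subr_ge0 exprn_ile1 ?ler_pdivrMr ?mul1r// ltW// divr_gt0.
rewrite ler_wsqrtr// [leLHS]enormsqB dotZr enormsqZ dotC.
have t0 : 0 < tau by rewrite divr_gt0// exprn_gt0.
have := mono x y; have := lip x y; set a := enormsq _; set b := dot _ _.
set e := enormsq _ => h1 h2.
have tL : tau * L ^+ 2 = mu by rewrite divfK// lt0r_neq0// exprn_gt0.
have -> : (mu / L) ^+ 2 = tau * mu by rewrite expr_div_n /tau expr2; ring.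
clearbody tau.
have h3 : tau * (tau * a) <= tau * (tau * (L ^+ 2 * e)) by rewrite !ler_pM2l.
have h4 : tau * (mu * e) <= tau * b by rewrite ler_pM2l.
have : tau * (tau * (L ^+ 2 * e)) = tau * (mu * e) by rewrite -tL !mulrA.
nra.
Qed.

(** * Bounded measurable integrands *)

Section bounded_measurable.
Context {R : realType} {d : measure_display} {V : measurableType d}.
Context (mu : {finite_measure set V -> \bar R}) (Z : set V).
Hypothesis mZ : measurable Z.
Implicit Types f g : V -> R.

(** A class stable under sums, products, powers and positive or negative parts, and integrable for a
    finite measure, so that linearity of the integral costs no separate integrability argument. *)
Definition bdmeas f := measurable_fun Z f /\
  exists M, forall z, Z z -> `|f z| <= M.

Lemma bdmeas_cst (r : R) : bdmeas (fun=> r).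
Proof. by split; [exact: measurable_cst|exists `|r|]. Qed.

Lemma bdmeasD f g : bdmeas f -> bdmeas g -> bdmeas (fun z => f z + g z).
Proof.
move=> [mf [M fM]] [mg [N gN]]; split; first exact: measurable_funD.
by exists (M + N) => z Zz; apply: le_trans (ler_normD _ _) _; apply: lerD; auto.
Qed.

Lemma bdmeasM f g : bdmeas f -> bdmeas g -> bdmeas (fun z => f z * g z).
Proof.
move=> [mf [M fM]] [mg [N gN]]; split; first exact: measurable_funM.
by exists (M * N) => z Zz; rewrite normrM ler_pM//; auto.
Qed.

Lemma bdmeasN f : bdmeas f -> bdmeas (fun z => - f z).
Proof.
by move=> hf; under eq_fun do rewrite -mulN1r; apply: bdmeasM => //; exact: bdmeas_cst.
Qed.

Lemma bdmeasB f g : bdmeas f -> bdmeas g -> bdmeas (fun z => f z - g z).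
Proof. by move=> hf hg; apply: bdmeasD => //; exact: bdmeasN. Qed.

Lemma bdmeasX f k : bdmeas f -> bdmeas (fun z => f z ^+ k).
Proof.
move=> hf; elim: k => [|k IH]; first by under eq_fun do rewrite expr0; exact: bdmeas_cst.
by under eq_fun do rewrite exprS; exact: bdmeasM.
Qed.

Lemma bdmeas_pospart f : bdmeas f -> bdmeas (fun z => pospart (f z)).
Proof.
move=> [mf [M fM]]; split; first exact: measurable_maxr.
exists M => z /fM; rewrite /pospart => h; have [] := leP (f z) 0; rewrite ?normr0// => _.
exact: le_trans h.
Qed.

Lemma bdmeas_negpart f : bdmeas f -> bdmeas (fun z => negpart (f z)).
Proof. by move=> /bdmeasN; exact: bdmeas_pospart. Qed.

Lemma bdmeas_sum (I : Type) (s : seq I) (f : I -> V -> R) :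
  (forall i, bdmeas (f i)) -> bdmeas (fun z => \sum_(i <- s) f i z).
Proof.
move=> hf; elim: s => [|i s IH].
  by under eq_fun do rewrite big_nil; exact: bdmeas_cst.
by under eq_fun do rewrite big_cons; exact: bdmeasD.
Qed.

Lemma bdmeas_integrable f : bdmeas f -> mu.-integrable Z (EFin \o f).
Proof.
move=> [mf [M fM]].
apply: (le_integrable mZ _ _ (finite_measure_integrable_cst mu `|M| mZ)).
  exact/measurable_EFinP.
by move=> z /fM fz; rewrite lee_fin/= normr_id; exact: le_trans fz (ler_norm _).
Qed.

Lemma Rintegral_bdmeasD f g : bdmeas f -> bdmeas g ->
  \int[mu]_(z in Z) (f z + g z) = \int[mu]_(z in Z) f z + \int[mu]_(z in Z) g z.
Proof. by move=> hf hg; rewrite RintegralD//; exact: bdmeas_integrable. Qed.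

Lemma Rintegral_bdmeasB f g : bdmeas f -> bdmeas g ->
  \int[mu]_(z in Z) (f z - g z) = \int[mu]_(z in Z) f z - \int[mu]_(z in Z) g z.
Proof. by move=> hf hg; rewrite RintegralB//; exact: bdmeas_integrable. Qed.

Lemma Rintegral_bdmeasZ (r : R) f : bdmeas f ->
  \int[mu]_(z in Z) (r * f z) = r * \int[mu]_(z in Z) f z.
Proof. by move=> hf; rewrite RintegralZl//; exact: bdmeas_integrable. Qed.

Lemma Rintegral_bdmeas_sum (I : Type) (s : seq I) (f : I -> V -> R) :
  (forall i, bdmeas (f i)) ->
  \int[mu]_(z in Z) (\sum_(i <- s) f i z) = \sum_(i <- s) \int[mu]_(z in Z) f i z.
Proof.
move=> hf; elim: s => [|i s IH].
  under eq_Rintegral do rewrite big_nil.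
  by rewrite big_nil Rintegral_cst// mul0r.
under eq_Rintegral do rewrite big_cons.
by rewrite Rintegral_bdmeasD ?IH ?big_cons//; exact: bdmeas_sum.
Qed.

Lemma le_Rintegral_bdmeas f g : bdmeas f -> bdmeas g ->
  (forall z, Z z -> f z <= g z) ->
  \int[mu]_(z in Z) f z <= \int[mu]_(z in Z) g z.
Proof. by move=> hf hg; apply: le_Rintegral => //; exact: bdmeas_integrable. Qed.

Lemma normr_Rintegral_le f (M : R) : bdmeas f ->
  (forall z, Z z -> `|f z| <= M) ->
  `|\int[mu]_(z in Z) f z| <= M * fine (mu Z).
Proof.
move=> hf fM; rewrite -Rintegral_cst//.
have hM := bdmeas_cst M; rewrite ler_norml; apply/andP; split; last first.
  by apply: le_Rintegral_bdmeas => // z /fM; rewrite ler_norml => /andP[].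
rewrite -mulN1r -Rintegral_bdmeasZ//; apply: le_Rintegral_bdmeas => //.
  by apply: bdmeasM => //; exact: bdmeas_cst.
by move=> z /fM; rewrite mulN1r ler_norml => /andP[].
Qed.

End bounded_measurable.

(** * Squares of positive and negative parts *)

Section positive_negative_parts.
Context {R : realType}.
Implicit Types x y : R.

Lemma pospart_ge0 x : 0 <= pospart x.
Proof. by rewrite /pospart le_max lexx orbT. Qed.

Lemma negpart_ge0 x : 0 <= negpart x.
Proof. exact: pospart_ge0. Qed.

Lemma pospart_sub_negpart x : pospart x - negpart x = x.
Proof. by rewrite /negpart /pospart; have [] := leP x 0; have [] := leP (- x) 0; lra. Qed.

Lemma negpartE x : negpart x = pospart x - x.
Proof. by have := pospart_sub_negpart x; lra. Qed.

Lemma pospart_mul_negpart x : pospart x * negpart x = 0.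
Proof.
rewrite /negpart /pospart; have [] := leP x 0; have [] := leP (- x) 0; rewrite ?mul0r ?mulr0//; lra.
Qed.

Lemma pospart_le x : pospart x <= `|x|.
Proof. by rewrite /pospart ge_max ler_norm normr_ge0. Qed.

Lemma negpart_le x : negpart x <= `|x|.
Proof. by rewrite -normrN; exact: pospart_le. Qed.

(** A difference quotient in [[0, 1]] stands in for the derivative, which is missing at the kink
    0. *)
Lemma pospart_slope x y :
  exists2 s, 0 <= s <= 1 & pospart y - pospart x = s * (y - x).
Proof.
rewrite /pospart; have [x0|x0] := leP x 0; have [y0|y0] := leP y 0.
- by exists 0; lra.
- exists (y / (y - x)); last by rewrite divfK; lra.
  by rewrite divr_ge0 ?ler_pdivrMr; lra.
- exists (x / (x - y)); last by rewrite -(opprB x y) mulrN divfK; lra.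
  by rewrite divr_ge0 ?ler_pdivrMr; lra.
- by exists 1; lra.
Qed.

(* The derivative of [a (x^+)^2 + c (x^-)^2] is nondecreasing and
   2K-Lipschitz when [0 <= a, c <= K]. *)
Lemma wsquare_slope (a c K x y : R) : 0 <= a <= K -> 0 <= c <= K ->
  exists2 s, 0 <= s <= 2 * K &
    (2 * a * pospart y - 2 * c * negpart y)
    - (2 * a * pospart x - 2 * c * negpart x) = s * (y - x).
Proof.
move=> aK cK; have [s s01 hs] := pospart_slope x y.
exists (2 * (a * s + c * (1 - s))); first by nra.
by rewrite !negpartE; nra.
Qed.

(** The remainders [t1] and [t2] of the two squares are nonnegative and add up to [(y - x) ^+ 2];
    weighting them by numbers of [[0, K]] gives both bounds. *)
Lemma wsquare_taylor (a c K x y : R) : 0 <= a <= K -> 0 <= c <= K ->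
  0 <= (a * pospart y ^+ 2 + c * negpart y ^+ 2)
       - (a * pospart x ^+ 2 + c * negpart x ^+ 2)
       - (2 * a * pospart x - 2 * c * negpart x) * (y - x)
    <= K * (y - x) ^+ 2.
Proof.
move=> aK cK.
set t1 := pospart y ^+ 2 - pospart x ^+ 2 - 2 * pospart x * (y - x).
set t2 := negpart y ^+ 2 - negpart x ^+ 2 + 2 * negpart x * (y - x).
have hx := pospart_sub_negpart x; have hy := pospart_sub_negpart y.
have mx := pospart_mul_negpart x; have my := pospart_mul_negpart y.
have px := pospart_ge0 x; have nx := negpart_ge0 x.
have py := pospart_ge0 y; have ny := negpart_ge0 y.
have t12 : t1 + t2 = (y - x) ^+ 2 by rewrite /t1 /t2 -[in RHS]hx -[in RHS]hy; nra.
have t1_ge0 : 0 <= t1.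
  have -> : t1 = (pospart y - pospart x) ^+ 2 + 2 * (pospart x * negpart y).
    by rewrite /t1 -[X in X - x]hy -[X in _ - X]hx; ring: mx.
  by rewrite addr_ge0 ?sqr_ge0// !mulr_ge0.
have t2_ge0 : 0 <= t2.
  have -> : t2 = (negpart y - negpart x) ^+ 2 + 2 * (negpart x * pospart y).
    by rewrite /t2 -[X in X - x]hy -[X in _ - X]hx; ring: mx.
  by rewrite addr_ge0 ?sqr_ge0// !mulr_ge0.
rewrite -t12 (_ : _ - _ - _ = a * t1 + c * t2); last by rewrite /t1 /t2; ring.
by nra.
Qed.

End positive_negative_parts.

(** * The Hamiltonian at a fixed time and scenario *)

Section cone_product.
Context {R : realType} (m1 m2 : nat).
Context (Pi1 : set 'cV[R]_m1) (Pi2 : set 'cV[R]_m2).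
Hypotheses (cone1 : closed_convex_cone Pi1) (cone2 : closed_convex_cone Pi2).

Lemma cone0 m (Pi : set 'cV[R]_m) : closed_convex_cone Pi -> Pi 0.
Proof. by move=> [[v Pv] _ _ /(_ 0 v (lexx _) Pv)]; rewrite scale0r. Qed.

Lemma cone_convex m (Pi : set 'cV[R]_m) : closed_convex_cone Pi ->
  forall x y (t : R), 0 <= t <= 1 -> Pi x -> Pi y -> Pi (x + t *: (y - x)).
Proof.
move=> [_ _ cvx _] x y t t01 Px Py.
move: t01; rewrite le_eqVlt => /andP[/predU1P[<- _|t0]].
  by rewrite scale0r addr0.
rewrite le_eqVlt => /predU1P[->|t1]; first by rewrite scale1r addrC subrK.
have t01 : 0 <= t <= 1 by rewrite !ltW.
have := cvx y x (Itv01 (ltW t0) (ltW t1)).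
rewrite !inE => /(_ Py Px); congr Pi; rewrite /conv/=.
by rewrite scalerBr scalerBl scale1r addrCA addrA.
Qed.

Definition cone_prod : set 'cV[R]_(m1 + m2) :=
  [set v | Pi1 (usubmx v) /\ Pi2 (dsubmx v)].

Lemma cone_prod0 : cone_prod 0.
Proof. by split; rewrite linear0; exact: cone0. Qed.

Lemma cone_prod_convex x y (t : R) : 0 <= t <= 1 -> cone_prod x -> cone_prod y ->
  cone_prod (x + t *: (y - x)).
Proof.
by move=> t01 [x1 x2] [y1 y2]; split; rewrite linearD linearZ linearB/=;
  exact: cone_convex.
Qed.

Lemma cone_prod_closed : closed cone_prod.
Proof.
case: cone1 => _ c1 _ _; case: cone2 => _ c2 _ _.
apply: closedI.
  apply: (@preimage_closed _ _ (@usubmx R m1 m2 1)) => // x _.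
  move=> P /nbhs_ballP[e e0 eP]; apply/nbhs_ballP; exists e => // y [_ xy].
  by apply: eP; split=> // i j; rewrite !mxE; exact: xy.
apply: (@preimage_closed _ _ (@dsubmx R m1 m2 1)) => // x _.
move=> P /nbhs_ballP[e e0 eP]; apply/nbhs_ballP; exists e => // y [_ xy].
by apply: eP; split=> // i j; rewrite !mxE; exact: xy.
Qed.

End cone_product.

Section hamiltonian.
Context {R : realType} {d : measure_display} {V : measurableType d}.
Context (mu : {finite_measure set V -> \bar R}) (Z : set V).
Context (m1 m2 : nat).
Local Notation n := (m1 + m2)%N.
Context (M : 'M[R]_n) (D b : 'cV[R]_n) (p : R).
Context (F : V -> 'cV[R]_n) (E a c : V -> R).

Definition jump_cost (z : V) (y : R) : R :=
  a z * (pospart (1 + E z + y) ^+ 2 - 1) - 2 * p * (E z + y)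
  + c z * negpart (1 + E z + y) ^+ 2.

(** The derivative of [jump_cost z] in [y]. *)
Definition jump_slope (z : V) (y : R) : R :=
  2 * a z * pospart (1 + E z + y) - 2 * c z * negpart (1 + E z + y) - 2 * p.

(* In [H1] and [H2] the pair of controls is [v = col_mx v1 v2], and the
   matrices and vectors of the two players are stacked accordingly. *)
Definition ham (v : 'cV[R]_n) : R :=
  dot v (M *m v) + p * dot D v ^+ 2 + 2 * dot b v
  + \int[mu]_(z in Z) jump_cost z (dot (F z) v).

(** That this is the gradient of [ham] is used through the expansion [ham_taylor], an algebraic
    identity that avoids differentiating under the integral. *)
Definition ham_grad (v : 'cV[R]_n) : 'cV[R]_n :=
  2 *: (M *m v) + (2 * p * dot D v) *: D + 2 *: b
  + \col_i \int[mu]_(z in Z) (jump_slope z (dot (F z) v) * F z i 0).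

Context (K kappa nuZ : R).
Hypotheses (mZ : measurable Z) (symM : M^T = M).
Hypotheses (mE : measurable_fun Z E) (ma : measurable_fun Z a)
  (mc : measurable_fun Z c) (mF : forall i, measurable_fun Z (fun z => F z i 0)).
Hypotheses (E_le : forall z, Z z -> `|E z| <= kappa)
  (a_itv : forall z, Z z -> 0 <= a z <= K) (c_itv : forall z, Z z -> 0 <= c z <= K)
  (F_le : forall z, Z z -> forall i, `|F z i 0| <= kappa).
Hypotheses (p_itv : 0 <= p <= K) (kappa0 : 0 <= kappa) (muZ : fine (mu Z) <= nuZ).
Hypotheses (D_le : forall i, `|D i 0| <= kappa)
  (M_le : forall i j, `|M i j| <= kappa).

Lemma bdmeas_E : bdmeas Z E. Proof. by split=> //; exists kappa. Qed.

Lemma bdmeas_a : bdmeas Z a.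
Proof. by split=> //; exists K => z /a_itv/andP[a0 aK]; rewrite ger0_norm. Qed.

Lemma bdmeas_c : bdmeas Z c.
Proof. by split=> //; exists K => z /c_itv/andP[a0 aK]; rewrite ger0_norm. Qed.

Lemma bdmeas_F i : bdmeas Z (fun z => F z i 0).
Proof. by split=> //; exists kappa => z /F_le; exact. Qed.

Lemma bdmeas_dotF v : bdmeas Z (fun z => dot (F z) v).
Proof.
apply: bdmeas_sum => // i; apply: bdmeasM => //; [exact: bdmeas_F|exact: bdmeas_cst].
Qed.

Lemma bdmeas_jump_cost v : bdmeas Z (fun z => jump_cost z (dot (F z) v)).
Proof.
have hE := bdmeas_E; have ha := bdmeas_a; have hc := bdmeas_c.
have hl := bdmeas_dotF v.
have k (r : R) := @bdmeas_cst R d V Z r.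
have hx := bdmeasD (bdmeasD (k 1) hE) hl.
apply: bdmeasD => //; last first.
  by apply: bdmeasM => //; apply: bdmeasX => //; exact: bdmeas_negpart.
apply: bdmeasB => //; first apply: bdmeasM => //.
  apply: bdmeasB => //; first by apply: bdmeasX => //; exact: bdmeas_pospart.
by apply: bdmeasM => //; exact: bdmeasD.
Qed.

Lemma bdmeas_jump_slope v : bdmeas Z (fun z => jump_slope z (dot (F z) v)).
Proof.
have hE := bdmeas_E; have ha := bdmeas_a; have hc := bdmeas_c.
have hl := bdmeas_dotF v.
have k (r : R) := @bdmeas_cst R d V Z r.
have hx := bdmeasD (bdmeasD (k 1) hE) hl.
apply: bdmeasB => //; apply: bdmeasB => //.
  apply: bdmeasM => //; [exact: bdmeasM|exact: bdmeas_pospart].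
apply: bdmeasM => //; [exact: bdmeasM|exact: bdmeas_negpart].
Qed.

Lemma dot_col_Rintegral (f : V -> R) v : bdmeas Z f ->
  dot (\col_i \int[mu]_(z in Z) (f z * F z i 0)) v
    = \int[mu]_(z in Z) (f z * dot (F z) v).
Proof.
move=> hf; have k (r : R) := @bdmeas_cst R d V Z r.
have hfF i := bdmeasM hf (bdmeas_F i).
under [RHS]eq_Rintegral do rewrite mulr_sumr.
rewrite Rintegral_bdmeas_sum//; last first.
  by move=> i; apply: bdmeasM => //; apply: bdmeasM => //; exact: bdmeas_F.
apply: eq_bigr => i _; rewrite mxE mulrC -Rintegral_bdmeasZ//.
by apply: eq_Rintegral => z _; rewrite mulrC mulrA.
Qed.

Lemma dot_mulmx_sym v w : dot v (M *m w) = dot w (M *m v).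
Proof.
rewrite -!dotE (_ : v^T *m _ = (w^T *m (M *m v))^T) 1?[LHS]mxE//.
by rewrite !trmx_mul symM trmxK mulmxA.
Qed.

(** The quadratic part is its own second-order remainder; only the jump remainder has to be
    estimated. *)
Lemma ham_taylor v w :
  ham w - ham v - dot (ham_grad v) (w - v) =
  dot (w - v) (M *m (w - v)) + p * dot D (w - v) ^+ 2
  + \int[mu]_(z in Z) (jump_cost z (dot (F z) w) - jump_cost z (dot (F z) v)
      - jump_slope z (dot (F z) v) * (dot (F z) (w - v))).
Proof.
have hw := bdmeas_jump_cost w; have hv := bdmeas_jump_cost v.
have hs := bdmeas_jump_slope v; have hl := bdmeas_dotF (w - v).
rewrite Rintegral_bdmeasB//; [|exact: bdmeasB|exact: bdmeasM].
rewrite Rintegral_bdmeasB// /ham /ham_grad !dotDl dot_col_Rintegral// !dotZl.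
rewrite mulmxBr !dotBr !dotNl !(dotC (M *m v)) (dot_mulmx_sym v w).
ring.
Qed.

Lemma ham_grad_dot v w e :
  dot (ham_grad w - ham_grad v) e =
  2 * dot e (M *m (w - v)) + 2 * p * dot D (w - v) * dot D e
  + \int[mu]_(z in Z) ((jump_slope z (dot (F z) w) - jump_slope z (dot (F z) v))
                      * dot (F z) e).
Proof.
have hw := bdmeas_jump_slope w; have hv := bdmeas_jump_slope v.
have hl := bdmeas_dotF e.
under eq_Rintegral do rewrite mulrBl.
rewrite Rintegral_bdmeasB//; [|exact: bdmeasM|exact: bdmeasM].
rewrite /ham_grad dotBl !dotDl !dot_col_Rintegral// !dotZl mulmxBr !dotBr.
rewrite !(dotC e) (dotC D w) (dotC D v); ring.
Qed.

Lemma jump_cost_taylor z x y : Z z ->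
  0 <= jump_cost z y - jump_cost z x - jump_slope z x * (y - x)
    <= K * (y - x) ^+ 2.
Proof.
move=> Zz; have := wsquare_taylor (1 + E z + x) (1 + E z + y) (a_itv Zz) (c_itv Zz).
rewrite (_ : 1 + E z + y - (1 + E z + x) = y - x); last by ring.
rewrite /jump_cost /jump_slope => /andP[h1 h2]; apply/andP; split.
  by apply: le_trans h1 _; rewrite le_eqVlt; apply/orP; left; apply/eqP; ring.
by apply: le_trans h2; rewrite le_eqVlt; apply/orP; left; apply/eqP; ring.
Qed.

Lemma jump_slope_slope z x y : Z z ->
  exists2 s, 0 <= s <= 2 * K & jump_slope z y - jump_slope z x = s * (y - x).
Proof.
move=> Zz.
have [s sK hs] := wsquare_slope (1 + E z + x) (1 + E z + y) (a_itv Zz) (c_itv Zz).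
exists s => //; rewrite /jump_slope; move: hs; nra.
Qed.

Lemma dot_normr_le (x v : 'cV[R]_n) (k e : R) :
  (forall i, `|x i 0| <= k) -> (forall i, `|v i 0| <= e) ->
  `|dot x v| <= n%:R * (k * e).
Proof.
move=> xk ve; apply: le_trans (ler_norm_sum _ _ _) _.
apply: (@le_trans _ _ (\sum_(i < n) k * e)).
  by apply: ler_sum => i _; rewrite normrM ler_pM.
by rewrite sumr_const card_ord mulr_natl.
Qed.

Lemma mulmx_normr_le (v : 'cV[R]_n) (e : R) : (forall i, `|v i 0| <= e) ->
  forall i, `|(M *m v) i 0| <= n%:R * (kappa * e).
Proof.
move=> ve i; rewrite (_ : (M *m v) i 0 = dot (row i M)^T v).
  by apply: dot_normr_le => // j; rewrite !mxE.
by rewrite mxE; apply: eq_bigr => j _; rewrite !mxE.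
Qed.

(** A Lipschitz constant for each entry of [ham_grad]: the first term comes from [M], the second
    from [D] and, through [nuZ], from the jumps. *)
Definition grad_lip : R :=
  2 * n%:R * kappa + 2 * K * n%:R * kappa ^+ 2 * (1 + nuZ).

Lemma K_ge0 : 0 <= K. Proof. by case/andP: p_itv; exact: le_trans. Qed.

Lemma nuZ_ge0 : 0 <= nuZ. Proof. exact: le_trans (fine_ge0 (measure_ge0 _ _)) muZ. Qed.

Lemma ham_grad_lip v w i :
  `|(ham_grad w - ham_grad v) i 0| <= grad_lip * enorm (w - v).
Proof.
set e := enorm (w - v); have e0 : 0 <= e by exact: enorm_ge0.
have K0 := K_ge0.
have he j : `|(w - v) j 0| <= e by exact: ler_abs_enorm.
have hw := bdmeas_jump_slope w; have hv := bdmeas_jump_slope v.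
have -> : (ham_grad w - ham_grad v) i 0 = 2 * (M *m (w - v)) i 0
    + 2 * p * dot D (w - v) * D i 0
    + \int[mu]_(z in Z) ((jump_slope z (dot (F z) w) - jump_slope z (dot (F z) v))
                        * F z i 0).
  have hFi := bdmeas_F i.
  under eq_Rintegral do rewrite mulrBl.
  rewrite Rintegral_bdmeasB//; [|exact: bdmeasM|exact: bdmeasM].
  by rewrite mulmxBr dotBr /ham_grad !mxE; ring.
have h1 := mulmx_normr_le he i.
have h2 := dot_normr_le D_le he.
have h3 : `|\int[mu]_(z in Z) ((jump_slope z (dot (F z) w)
            - jump_slope z (dot (F z) v)) * F z i 0)|
          <= 2 * K * (n%:R * (kappa * e)) * kappa * fine (mu Z).
  apply: normr_Rintegral_le => //.
    by apply: bdmeasM => //; [exact: bdmeasB|exact: bdmeas_F].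
  move=> z Zz; rewrite normrM ler_pM//; last exact: F_le.
  have [s sK ->] := jump_slope_slope (dot (F z) v) (dot (F z) w) Zz.
  rewrite -dotBr normrM ler_pM//; last exact: dot_normr_le (F_le Zz) he.
  by case/andP: sK => s0 ?; rewrite ger0_norm.
have h4 : `|2 * p * dot D (w - v) * D i 0| <= 2 * K * (n%:R * (kappa * e)) * kappa.
  case/andP: p_itv => p0 pK.
  by rewrite normrM ler_pM// normrM ler_pM// ger0_norm ?mulr_ge0// ler_pM2l.
have h5 : 2 * K * (n%:R * (kappa * e)) * kappa * fine (mu Z) <=
          2 * K * (n%:R * (kappa * e)) * kappa * nuZ.
  by rewrite ler_wpM2l// !mulr_ge0.
have tri (x y z : R) : `|x + y + z| <= `|x| + `|y| + `|z|.
  by apply: le_trans (ler_normD _ _) _; rewrite lerD2r ler_normD.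
apply: le_trans (tri _ _ _) _; rewrite [X in X + _ + _]normrM normr_nat.
rewrite /grad_lip; move: h1 h3 h4 h5; set N := n%:R; lra.
Qed.

Lemma jump_slope_le z y : Z z -> `|jump_slope z y| <= 2 * K * (1 + kappa + `|y|) *+ 2 + 2 * K.
Proof.
move=> Zz; case/andP: (a_itv Zz) => a0 aK; case/andP: (c_itv Zz) => c0 cK.
case/andP: p_itv => p0 pK; have K0 := K_ge0.
set x := 1 + E z + y.
have xle : `|x| <= 1 + kappa + `|y|.
  rewrite /x; apply: le_trans (ler_normD _ _) _; rewrite lerD2r.
  by apply: le_trans (ler_normD _ _) _; rewrite normr1 lerD2l; exact: E_le.
have h (r q : R) : 0 <= r <= K -> 0 <= q <= `|x| ->
    `|2 * r * q| <= 2 * K * (1 + kappa + `|y|).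
  case/andP=> r0 rK /andP[q0 qx]; rewrite ger0_norm ?mulr_ge0//.
  by rewrite ler_pM ?mulr_ge0// ?ler_pM// (le_trans qx).
rewrite /jump_slope -/x; apply: le_trans (ler_normB _ _) _; apply: lerD; last first.
  by rewrite ger0_norm ?mulr_ge0// ler_pM.
apply: le_trans (ler_normB _ _) _; rewrite mulr2n.
by apply: lerD; apply: h; rewrite ?a_itv ?c_itv// ?pospart_ge0 ?negpart_ge0 ?pospart_le ?negpart_le.
Qed.

Lemma ham_grad0_le (be : R) : (forall i, `|b i 0| <= be) ->
  forall i, `|ham_grad 0 i 0| <= 2 * be + (2 * K * (1 + kappa) *+ 2 + 2 * K) * kappa * nuZ.
Proof.
move=> b_le i; rewrite /ham_grad mulmx0 dot0r mulr0 scaler0 scale0r !add0r !mxE.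
have K0 := K_ge0.
apply: le_trans (ler_normD _ _) _; apply: lerD.
  by rewrite normrM normr_nat ler_pM2l.
set k := _ * kappa; apply: (@le_trans _ _ (k * fine (mu Z))); last first.
  by rewrite ler_wpM2l// mulr_ge0// addr_ge0 ?mulr_ge0// mulrn_wge0// !mulr_ge0// addr_ge0.
apply: normr_Rintegral_le => //.
  by apply: bdmeasM => //; [exact: bdmeas_jump_slope|exact: bdmeas_F].
move=> z Zz; rewrite normrM ler_pM//; last exact: F_le.
by apply: le_trans (jump_slope_le _ Zz) _; rewrite dot0r normr0 addr0.
Qed.

Definition flip (v : 'cV[R]_n) : 'cV[R]_n := col_mx (usubmx v) (- dsubmx v).

Lemma dot_col_mx (x1 y1 : 'cV[R]_m1) (x2 y2 : 'cV[R]_m2) :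
  dot (col_mx x1 x2) (col_mx y1 y2) = dot x1 y1 + dot x2 y2.
Proof.
by rewrite /dot big_split_ord; congr (_ + _); apply: eq_bigr => i _;
  rewrite ?col_mxEu ?col_mxEd.
Qed.

Lemma enormsq_col_mx (x1 : 'cV[R]_m1) (x2 : 'cV[R]_m2) :
  enormsq (col_mx x1 x2) = enormsq x1 + enormsq x2.
Proof. by rewrite !enormsqE dot_col_mx. Qed.

Lemma dot_flip x y : dot (flip x) y = dot x (flip y).
Proof.
by rewrite -{1}(vsubmxK y) -{2}(vsubmxK x) !dot_col_mx dotNl dotNr.
Qed.

Lemma flipB x y : flip (x - y) = flip x - flip y.
Proof. by rewrite /flip !linearB/= opp_col_mx add_col_mx opprK addrC. Qed.

Lemma col_mx_sub_dsubmx (u : 'cV[R]_m1) (v : 'cV[R]_n) :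
  col_mx u (dsubmx v) - v = col_mx (u - usubmx v) 0.
Proof. by rewrite -[X in _ - X]vsubmxK opp_col_mx add_col_mx subrr. Qed.

Lemma col_mx_sub_usubmx (u : 'cV[R]_m2) (v : 'cV[R]_n) :
  col_mx (usubmx v) u - v = col_mx 0 (u - dsubmx v).
Proof. by rewrite -[X in _ - X]vsubmxK opp_col_mx add_col_mx subrr. Qed.

Lemma enormsq_flip v : enormsq (flip v) = enormsq v.
Proof. by rewrite enormsq_col_mx enormsqN -enormsq_col_mx vsubmxK. Qed.

Lemma enorm_flip v : enorm (flip v) = enorm v.
Proof. by rewrite /enorm enormsq_flip. Qed.

(* The sign flip turns the saddle problem, convex in the first control and
   concave in the second one, into a monotone variational inequality. *)
Definition saddle_op v := flip (ham_grad v).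

Context (dlow dbar : R).
Hypotheses (dlow0 : 0 < dlow) (dbar0 : 0 < dbar).
Hypothesis M_low : forall u : 'cV[R]_m1,
  dlow * enormsq u <= dot (col_mx u 0) (M *m col_mx u 0).
Hypothesis M_upp : forall u : 'cV[R]_m2,
  dot (col_mx 0 u) (M *m col_mx 0 u)
  + K * (dot D (col_mx 0 u) ^+ 2 + \int[mu]_(z in Z) dot (F z) (col_mx 0 u) ^+ 2)
  <= - dbar * enormsq u.

(** The factor 2 is that of the gradient of a quadratic form. *)
Definition monotonicity : R := 2 * Num.min dlow dbar.

Lemma monotonicity_gt0 : 0 < monotonicity.
Proof. by rewrite mulr_gt0// lt_min dlow0. Qed.

(** Write [x - y = e1 + e2] along the two controls; its flip is [e1 - e2]. The cross terms of [M]
    cancel by symmetry, and the diffusion and jump terms become differences of squares. The squares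
    along [e1] have the good sign; those along [e2] carry weights at most [p <= K] and slopes at
    most [2 * K], and [M_upp] absorbs them. *)
Lemma saddle_op_mono x y :
  monotonicity * enormsq (x - y) <= dot (saddle_op x - saddle_op y) (x - y).
Proof.
have K0 := K_ge0; case/andP: p_itv => p0 pK.
rewrite /saddle_op -flipB dot_flip ham_grad_dot.
set e1 : 'cV[R]_n := col_mx (usubmx (x - y)) 0.
set e2 : 'cV[R]_n := col_mx 0 (dsubmx (x - y)).
have dE : x - y = e1 + e2 by rewrite add_col_mx addr0 add0r vsubmxK.
have fE : flip (x - y) = e1 - e2.
  by rewrite /e1 /e2 opp_col_mx add_col_mx oppr0 addr0 add0r.
have h1 := M_low (usubmx (x - y)); have h2 := M_upp (dsubmx (x - y)).
rewrite -/e1 in h1; rewrite -/e2 in h2.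
have sqE : enormsq (x - y) = enormsq (usubmx (x - y)) + enormsq (dsubmx (x - y)).
  by rewrite -enormsq_col_mx vsubmxK.
have hsx := bdmeas_jump_slope x; have hsy := bdmeas_jump_slope y.
have hl2 := bdmeas_dotF e2.
have h3 : - (2 * K) * (\int[mu]_(z in Z) dot (F z) e2 ^+ 2) <=
    \int[mu]_(z in Z) ((jump_slope z (dot (F z) x) - jump_slope z (dot (F z) y))
                      * dot (F z) (flip (x - y))).
  rewrite -Rintegral_bdmeasZ//; last exact: bdmeasX.
  apply: le_Rintegral_bdmeas => //.
  - by apply: bdmeasM; [exact: bdmeas_cst|exact: bdmeasX].
  - by apply: bdmeasM; [exact: bdmeasB|exact: bdmeas_dotF].
  move=> z Zz.
  have [s /andP[s0 sK] ->] := jump_slope_slope (dot (F z) y) (dot (F z) x) Zz.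
  rewrite -dotBr fE dE dotDr dotBr.
  set f1 := dot (F z) e1; set f2 := dot (F z) e2.
  rewrite (_ : s * (f1 + f2) * (f1 - f2) = s * f1 ^+ 2 - s * f2 ^+ 2); last by ring.
  have := mulr_ge0 s0 (sqr_ge0 f1); have := ler_wpM2r (sqr_ge0 f2) sK; lra.
set I2 := \int[mu]_(z in Z) dot (F z) e2 ^+ 2 in h2 h3.
apply: le_trans (lerD (lexx _) h3).
have u1_ge0 := enormsq_ge0 (usubmx (x - y)).
have u2_ge0 := enormsq_ge0 (dsubmx (x - y)).
rewrite fE sqE; set u1 := enormsq (usubmx _) in h1 u1_ge0 *.
set u2 := enormsq (dsubmx _) in h2 u2_ge0 *; clearbody u1 u2.
rewrite dE mulmxDr !dotDl !dotDr !dotNl !dotNr (dot_mulmx_sym e2 e1).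
have mle : monotonicity <= 2 * dlow /\ monotonicity <= 2 * dbar.
  by rewrite /monotonicity !ler_pM2l// !ge_min !lexx orbT.
case: mle => ml1 ml2.
have := ler_wpM2r u1_ge0 ml1; have := ler_wpM2r u2_ge0 ml2.
have h4 := mulr_ge0 p0 (sqr_ge0 (dot D e1)).
have h5 := ler_wpM2r (sqr_ge0 (dot D e2)) pK.
rewrite (_ : 2 * p * (dot D e1 + dot D e2) * (dot D e1 - dot D e2) =
  2 * (p * dot D e1 ^+ 2) - 2 * (p * dot D e2 ^+ 2)); last by ring.
move: h1 h2 h4 h5; rewrite mulrDr mulNr; lra.
Qed.

(** The summand [monotonicity] makes this at least the monotonicity constant, as
    [gradient_step_contraction] requires; the factor [n.+1] dominates the loss from entries to the
    Euclidean norm. *)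
Definition lip_const : R := monotonicity + n.+1%:R * grad_lip.

Lemma grad_lip_ge0 : 0 <= grad_lip.
Proof.
have K0 := K_ge0; have nu0 := nuZ_ge0.
by rewrite /grad_lip addr_ge0 ?mulr_ge0 ?addr_ge0 ?sqr_ge0.
Qed.

Lemma saddle_op_lip x y :
  enormsq (saddle_op x - saddle_op y) <= lip_const ^+ 2 * enormsq (x - y).
Proof.
rewrite /saddle_op -flipB enormsq_flip.
apply: le_trans (enormsq_le (ham_grad_lip y x)) _.
rewrite exprMn mulrA sqr_enorm ler_wpM2r ?enormsq_ge0//.
have g0 := grad_lip_ge0; have m0 := ltW monotonicity_gt0.
apply: (@le_trans _ _ ((n.+1%:R * grad_lip) ^+ 2)).
  rewrite exprMn ler_wpM2r ?sqr_ge0// -natrX ler_nat.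
  by rewrite (leq_trans (leqnSn _))// expnS expn1 leq_pmulr.
have hg : 0 <= n.+1%:R * grad_lip by rewrite mulr_ge0.
by rewrite /lip_const; apply: lerXn2r; rewrite ?nnegrE ?addr_ge0 ?lerDr.
Qed.

(** Step and rate are functions of the dimensions and of the bounds alone, hence the same at every
    time and scenario. *)
Definition step : R := monotonicity / lip_const ^+ 2.
Definition rate : R := Num.sqrt (1 - (monotonicity / lip_const) ^+ 2).

Lemma monotonicity_le_lipschitz : monotonicity <= lip_const.
Proof. by rewrite lerDl mulr_ge0// grad_lip_ge0. Qed.

Lemma lipschitz_gt0 : 0 < lip_const.
Proof. exact: lt_le_trans monotonicity_gt0 monotonicity_le_lipschitz. Qed.

Lemma step_gt0 : 0 < step.
Proof. by rewrite divr_gt0 ?monotonicity_gt0// exprn_gt0// lipschitz_gt0. Qed.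

Lemma rate_itv : 0 <= rate < 1.
Proof.
rewrite sqrtr_ge0/= -sqrtr1 ltr_sqrt//.
by rewrite ltrBlDr ltrDl exprn_gt0// divr_gt0 ?monotonicity_gt0 ?lipschitz_gt0.
Qed.

Lemma saddle_op_contraction x y :
  enorm ((x - step *: saddle_op x) - (y - step *: saddle_op y))
    <= rate * enorm (x - y).
Proof.
apply: gradient_step_contraction.
- exact: monotonicity_gt0.
- exact: monotonicity_le_lipschitz.
- exact: saddle_op_mono.
- exact: saddle_op_lip.
Qed.

Context (Pi1 : set 'cV[R]_m1) (Pi2 : set 'cV[R]_m2).
Hypotheses (cone1 : closed_convex_cone Pi1) (cone2 : closed_convex_cone Pi2).

Definition saddle_pt : 'cV[R]_n :=
  vi_sol (cone_prod Pi1 Pi2) saddle_op step.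

Lemma saddle_pt_cvg :
  proj_iter (cone_prod Pi1 Pi2) saddle_op step @ \oo --> saddle_pt.
Proof.
apply: (@proj_iter_cvg _ _ _ (cone_prod0 cone1 cone2)
  (cone_prod_closed cone1 cone2) (@cone_prod_convex _ _ _ _ _ cone1 cone2)
  _ _ rate).
- exact: rate_itv.
- exact: saddle_op_contraction.
Qed.

Lemma saddle_pt_in : cone_prod Pi1 Pi2 saddle_pt.
Proof.
apply: (@vi_sol_in _ _ _ (cone_prod0 cone1 cone2)
  (cone_prod_closed cone1 cone2) (@cone_prod_convex _ _ _ _ _ cone1 cone2)
  _ _ rate).
- exact: rate_itv.
- exact: saddle_op_contraction.
Qed.

Lemma saddle_ptP v : cone_prod Pi1 Pi2 v ->
  0 <= dot (saddle_op saddle_pt) (v - saddle_pt).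
Proof.
apply: (@vi_solP _ _ _ (cone_prod0 cone1 cone2)
  (cone_prod_closed cone1 cone2) (@cone_prod_convex _ _ _ _ _ cone1 cone2)
  _ _ rate).
- exact: step_gt0.
- exact: rate_itv.
- exact: saddle_op_contraction.
Qed.

Lemma saddle_pt_bound :
  enorm saddle_pt <= step / (1 - rate) * enorm (ham_grad 0).
Proof.
rewrite -(enorm_flip (ham_grad 0)).
apply: (@vi_sol_bound _ _ _ (cone_prod0 cone1 cone2)
  (cone_prod_closed cone1 cone2) (@cone_prod_convex _ _ _ _ _ cone1 cone2)
  _ _ rate).
- exact: step_gt0.
- exact: rate_itv.
- exact: saddle_op_contraction.
Qed.

Local Notation th1 := (usubmx saddle_pt).
Local Notation th2 := (dsubmx saddle_pt).

(** Testing the variational inequality with only the first control changed makes the linear term of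
    [ham_taylor] nonnegative; [M_low] gives the quadratic margin, which later yields uniqueness. *)
Lemma saddle_pt_min v1 : Pi1 v1 ->
  ham saddle_pt + dlow * enormsq (v1 - th1) <= ham (col_mx v1 th2).
Proof.
move=> Pv1; have [_ Pth2] := saddle_pt_in; case/andP: p_itv => p0 pK.
have := @saddle_ptP (col_mx v1 th2).
rewrite /cone_prod/= col_mxKu col_mxKd => /(_ (conj Pv1 Pth2)).
have := ham_taylor saddle_pt (col_mx v1 th2).
rewrite col_mx_sub_dsubmx.
rewrite dot_flip /flip col_mxKu col_mxKd oppr0.
have hl := bdmeas_dotF (col_mx (v1 - th1) 0).
set I := \int[mu]_(z in Z) _; have I0 : 0 <= I.
  apply: Rintegral_ge0 => z Zz.
  have /andP[+ _] := jump_cost_taylor (dot (F z) saddle_pt) (dot (F z) (col_mx v1 th2)) Zz.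
  by rewrite -dotBr col_mx_sub_dsubmx.
have := M_low (v1 - th1); have := mulr_ge0 p0 (sqr_ge0 (dot D (col_mx (v1 - th1) 0))).
lra.
Qed.

(** With only the second control changed the flip reverses the sign of the linear term. Here the
    upper bound of the jump remainder is what counts, and [M_upp] is matched to it. *)
Lemma saddle_pt_max v2 : Pi2 v2 ->
  ham (col_mx th1 v2) <= ham saddle_pt - dbar * enormsq (v2 - th2).
Proof.
move=> Pv2; have [Pth1 _] := saddle_pt_in; case/andP: p_itv => p0 pK.
have := @saddle_ptP (col_mx th1 v2).
rewrite /cone_prod/= col_mxKu col_mxKd => /(_ (conj Pth1 Pv2)).
have := ham_taylor saddle_pt (col_mx th1 v2).
have dE := col_mx_sub_usubmx v2 saddle_pt.
have flipE : flip (col_mx 0 (v2 - th2)) = - col_mx 0 (v2 - th2).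
  by rewrite /flip col_mxKu col_mxKd opp_col_mx oppr0.
rewrite dE dot_flip flipE dotNr.
have hl := bdmeas_dotF (col_mx 0 (v2 - th2)).
set I := \int[mu]_(z in Z) _.
have IK : I <= K * \int[mu]_(z in Z) dot (F z) (col_mx 0 (v2 - th2)) ^+ 2.
  rewrite -Rintegral_bdmeasZ//; last exact: bdmeasX.
  apply: le_Rintegral_bdmeas => //.
  - apply: bdmeasB; last by apply: bdmeasM => //; exact: bdmeas_jump_slope.
    by apply: bdmeasB; exact: bdmeas_jump_cost.
  - by apply: bdmeasM; [exact: bdmeas_cst|exact: bdmeasX].
  move=> z Zz.
  have /andP[_] := jump_cost_taylor (dot (F z) saddle_pt) (dot (F z) (col_mx th1 v2)) Zz.
  by rewrite -dotBr dE.
have := M_upp (v2 - th2); rewrite mulrDr mulNr.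
have := ler_wpM2r (sqr_ge0 (dot D (col_mx 0 (v2 - th2)))) pK.
lra.
Qed.

Lemma saddle_pt_saddle :
  saddle_point Pi1 Pi2 (fun v1 v2 => ham (col_mx v1 v2)) th1 th2.
Proof.
have [Pth1 Pth2] := saddle_pt_in; split=> // v1 v2 Pv1 Pv2; rewrite vsubmxK.
have := saddle_pt_min Pv1; have := saddle_pt_max Pv2.
have := mulr_ge0 (ltW dlow0) (enormsq_ge0 (v1 - th1)).
have := mulr_ge0 (ltW dbar0) (enormsq_ge0 (v2 - th2)).
by move=> *; split; lra.
Qed.

(** The other saddle point links the two margins: [ham] at [(v1, th2)] is at most its value at
    [(v1, v2)], itself at most that at [(th1, v2)]. Both quadratic margins must then vanish. *)
Lemma saddle_pt_unique v1 v2 :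
  saddle_point Pi1 Pi2 (fun v1 v2 => ham (col_mx v1 v2)) v1 v2 ->
  v1 = th1 /\ v2 = th2.
Proof.
move=> [Pv1 Pv2 /(_ th1 th2 saddle_pt_in.1 saddle_pt_in.2)[h1 h2]].
have := saddle_pt_min Pv1; have := saddle_pt_max Pv2.
have e1 := enormsq_ge0 (v1 - th1); have e2 := enormsq_ge0 (v2 - th2).
have := mulr_ge0 (ltW dlow0) e1; have := mulr_ge0 (ltW dbar0) e2 => d2 d1 h3 h4.
split; apply/eqP; rewrite -subr_eq0; apply/eqP/enormsq_eq0/eqP.
  have /eqP : dlow * enormsq (v1 - th1) = 0 by lra.
  by rewrite mulf_eq0 gt_eqF.
have /eqP : dbar * enormsq (v2 - th2) = 0 by lra.
by rewrite mulf_eq0 gt_eqF.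
Qed.

Lemma supinf_saddle_pt :
  supinf Pi1 Pi2 (fun v1 v2 => ham (col_mx v1 v2)) = (ham saddle_pt)%:E.
Proof.
have [Pth1 Pth2 sad] := saddle_pt_saddle.
apply/eqP; rewrite eq_le; apply/andP; split.
  apply: ge_ereal_sup => _ [v2 Pv2 <-].
  apply: (@le_trans _ _ (ham (col_mx th1 v2))%:E).
    by apply: ereal_inf_lbound; exists th1.
  by rewrite lee_fin -[in leRHS](vsubmxK saddle_pt); case: (sad th1 v2 Pth1 Pv2).
apply: le_trans (_ : _ <= ereal_inf [set (ham (col_mx v1 th2))%:E | v1 in Pi1])%E _.
  apply: le_ereal_inf_tmp => _ [v1 Pv1 <-].
  by rewrite lee_fin -[in leLHS](vsubmxK saddle_pt); case: (sad v1 th2 Pv1 Pth2).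
by apply: ereal_sup_ubound; exists th2.
Qed.

(** Majorants of the quadratic form, the diffusion square, the linear term and the jump integral, in
    this order, when the entries of [b] and [v] are at most [be] and [e]. *)
Definition ham_growth (be e : R) : R :=
  n%:R * (e * (n%:R * (kappa * e))) + K * (n%:R * (kappa * e)) ^+ 2
  + 2 * (n%:R * (be * e))
  + (K * ((1 + kappa + n%:R * (kappa * e)) ^+ 2 *+ 2 + 1)
     + 2 * K * (kappa + n%:R * (kappa * e))) * nuZ.

Lemma ham_le (v : 'cV[R]_n) (be e : R) : (forall i, `|b i 0| <= be) ->
  (forall i, `|v i 0| <= e) -> 0 <= be -> 0 <= e -> `|ham v| <= ham_growth be e.
Proof.
move=> b_le v_le be0 e0; have K0 := K_ge0; case/andP: p_itv => p0 pK.
set ke := n%:R * (kappa * e); have ke0 : 0 <= ke by rewrite !mulr_ge0.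
have tri (x y z w : R) : `|x + y + z + w| <= `|x| + `|y| + `|z| + `|w|.
  do 2 (apply: le_trans (ler_normD _ _) _; rewrite lerD2r).
  exact: ler_normD.
have hFv z : Z z -> `|dot (F z) v| <= ke.
  by move=> Zz; apply: dot_normr_le => //; exact: F_le.
apply: le_trans (tri _ _ _ _) _; rewrite /ham_growth -/ke.
apply: lerD; [apply: lerD; [apply: lerD|]|].
- by apply: dot_normr_le => //; exact: mulmx_normr_le.
- rewrite normrM ger0_norm// ler_pM// normrX lerXn2r ?nnegrE//.
  exact: dot_normr_le.
- by rewrite normrM normr_nat ler_pM2l//; exact: dot_normr_le.
set k := (X in _ <= X * _).
have k0 : 0 <= k.
  by rewrite addr_ge0 ?mulr_ge0 ?addr_ge0 ?mulrn_wge0 ?sqr_ge0.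
apply: (@le_trans _ _ (k * fine (mu Z))); last by rewrite ler_wpM2l.
apply: normr_Rintegral_le => //; first exact: bdmeas_jump_cost.
move=> z Zz; case/andP: (a_itv Zz) => a0 aK; case/andP: (c_itv Zz) => c0 cK.
have hF := hFv _ Zz; rewrite /jump_cost; set y := dot (F z) v in hF *.
set x := 1 + E z + y; have hE := E_le Zz.
have xle : `|x| <= 1 + kappa + ke.
  rewrite /x; apply: le_trans (ler_normD _ _) _; apply: lerD => //.
  by apply: le_trans (ler_normD _ _) _; rewrite normr1 lerD2l.
have sq r : 0 <= r -> r <= `|x| -> 0 <= r ^+ 2 <= (1 + kappa + ke) ^+ 2.
  move=> r0 rx; rewrite sqr_ge0/= lerXn2r ?nnegrE//; last exact: le_trans xle.
  by rewrite !addr_ge0.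
have /andP[p1 p2] := sq _ (pospart_ge0 x) (pospart_le x).
have /andP[n1 n2] := sq _ (negpart_ge0 x) (negpart_le x).
have ey : `|E z + y| <= kappa + ke.
  by apply: le_trans (ler_normD _ _) _; exact: lerD.
set S := (1 + kappa + ke) ^+ 2 in p2 n2 *.
have h1 : `|a z * (pospart x ^+ 2 - 1)| <= K * (S + 1).
  rewrite normrM ger0_norm// ler_pM// ler_norml; apply/andP; split; lra.
have h2 : `|2 * p * (E z + y)| <= 2 * K * (kappa + ke).
  by rewrite normrM ger0_norm ?mulr_ge0// ler_pM ?mulr_ge0// ler_pM2l.
have h3 : `|c z * negpart x ^+ 2| <= K * S.
  by rewrite normrM (ger0_norm c0) (ger0_norm n1) ler_pM.
apply: le_trans (ler_normD _ _) _; apply: le_trans (lerD (ler_normB _ _) h3) _.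
rewrite /k -/S mulr2n; lra.
Qed.

End hamiltonian.

(** * Integer-valued measures *)

Section integer_valued.
Context {R : realType} {d : measure_display} {V : measurableType d}.
Context (mu : {measure set V -> \bar R}) (D : set V) (mD : measurable D).
Hypothesis intD : forall A, measurable A -> A `<=` D ->
  exists n : nat, mu A = n%:R%:E.

Lemma iv_eq0 A : measurable A -> A `<=` D -> (mu A < 1)%E -> mu A = 0%E.
Proof.
move=> mA AD; have [n ->] := intD mA AD; rewrite lte_fin (_ : 1 = 1%:R)// ltr_nat.
by case: n.
Qed.

Lemma iv_fin A : measurable A -> A `<=` D -> (mu A < +oo)%E.
Proof. by move=> mA AD; have [n ->] := intD mA AD; exact: ltry. Qed.

(** A nonzero integer is at least 1, and this lower bound passes to the limit by continuity from
    above. *)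
Lemma iv_bigcap (F : (set V)^nat) : (forall k, measurable (F k)) ->
  (forall k, F k `<=` D) -> nonincreasing_seq F -> (forall k, mu (F k) <> 0%E) ->
  mu (\bigcap_k F k) <> 0%E.
Proof.
move=> mF FD niF F0 cap0.
have mcap : measurable (\bigcap_k F k) by exact: bigcapT_measurable.
have := nonincreasing_cvg_mu (iv_fin (mF 0%N) (FD 0%N)) mF mcap niF.
rewrite cap0 => h; have := cvge_to_ge h (b := 1%E).
suff h1 : \forall k \near \oo, (1 <= (mu \o F) k)%E by move=> /(_ _ h1); rewrite lee_fin; lra.
apply: nearW => k; rewrite leNgt; apply/negP => lt1.
exact/(F0 k)/iv_eq0.
Qed.

Context (g : V -> R) (mg : measurable_fun D g).

Let sublevel t := D `&` g @^-1` `]-oo, t].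

Let msublevel t : measurable (sublevel t).
Proof. by apply: mg => //; exact: measurable_itv. Qed.

Let mfiber t : measurable (D `&` g @^-1` [set t]).
Proof. by apply: mg => //; exact: measurable_set1. Qed.

(** The distribution function of [g] takes integer values, so it leaves 0 by a jump, located at the
    infimum [inf S] of the levels where it is nonzero. *)
Lemma iv_atom : mu D <> 0%E -> exists t, mu (D `&` g @^-1` [set t]) <> 0%E.
Proof.
move=> D0; pose S := [set t | mu (sublevel t) <> 0%E].
have SS s t : s <= t -> sublevel s `<=` sublevel t.
  by move=> st x [Dx /=]; rewrite !in_itv/= => gs; split=> //=; rewrite in_itv/=; exact: le_trans st.
have Sup s t : s <= t -> S s -> S t.
  move=> st Ss t0; apply: Ss; apply/eqP; rewrite -measure_le0 -t0.
  by rewrite le_measure ?inE//; exact: SS.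
have S_neq0 : S !=set0.
  apply: contrapT => /nonemptyPn S0; apply: D0.
  apply/negligibleP => //.
  have -> : D = \bigcup_k sublevel k%:R.
    apply/seteqP; split=> [x Dx|x [k _ []]//].
    exists (Num.truncn `|g x|).+1 => //; split=> //=; rewrite in_itv/=.
    by apply: le_trans (ler_norm _) _; exact/ltW/truncnS_gt.
  apply: negligible_bigcup => k; apply/negligibleP => //.
  apply: contrapT => h; have : S k%:R by [].
  by rewrite S0.
(* Otherwise all sublevels at [- k] have nonzero mass, while their intersection is empty. *)
have S_lb : has_lbound S.
  apply: contrapT => nlb.
  have Sk (k : nat) : S (- k%:R).
    apply: contrapT => nS; apply: nlb; exists (- k%:R) => s Ss.
    by rewrite leNgt; apply/negP => /ltW sk; apply: nS; exact: Sup sk Ss.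
  apply: (@iv_bigcap (fun k => sublevel (- k%:R))) => //.
  - by move=> k x [].
  - by move=> m k mk; apply/subsetPset/SS; rewrite lerN2 ler_nat.
  - rewrite (_ : \bigcap_k _ = set0) ?measure0//; apply/seteqP; split=> // x h.
    have := truncnS_gt `|g x|; set N := _.+1 => gN.
    have [_ /=] := h N I; rewrite in_itv/= => gx.
    have : `|g x| < - g x by apply: lt_le_trans gN _; rewrite lerNr.
    by rewrite ltNge -normrN ler_norm.
have infS : has_inf S by [].
exists (inf S) => fib0.
have lt0 : mu (D `&` g @^-1` `]-oo, inf S[) = 0%E.
  apply/negligibleP; first by apply: mg => //; exact: measurable_itv.
  have -> : D `&` g @^-1` `]-oo, inf S[ = \bigcup_k sublevel (inf S - k.+1%:R^-1).
    apply/seteqP; split=> [x [Dx /=]|x [k _ [Dx /=]]]; rewrite !in_itv/=.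
      rewrite -subr_gt0 => h; have [k _ /(_ k (leqnn _)) hk] := near_infty_natSinv_lt (PosNum h).
      exists k => //; split=> //=; rewrite in_itv/=.
      by rewrite lerBrDr -lerBrDl; exact: ltW hk.
    move=> h; split=> //=; apply: le_lt_trans h _.
    by rewrite ltrBlDr ltrDl invr_gt0.
  apply: negligible_bigcup => k; apply/negligibleP => //; apply: contrapT => h.
  have := ge_inf S_lb (h : S _); apply/negP; rewrite -ltNge.
  by rewrite ltrBlDr ltrDl invr_gt0.
(* The sublevels just above [inf S] all have nonzero mass; if the fibre over [inf S] were null, so
   would be their intersection. *)
apply: (@iv_bigcap (fun k => sublevel (inf S + k.+1%:R^-1))) => //.
- by move=> k x [].
- by move=> m k mk; apply/subsetPset/SS; rewrite lerD2l lef_pV2 ?posrE// ler_nat.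
- move=> k; have k0 : (0 : R) < k.+1%:R^-1 by rewrite invr_gt0.
  have [s Ss sk] := inf_adherent k0 infS; exact: Sup (ltW sk) Ss.
have -> : \bigcap_k sublevel (inf S + k.+1%:R^-1) =
    (D `&` g @^-1` `]-oo, inf S[) `|` (D `&` g @^-1` [set inf S]).
  apply/seteqP; split=> [x h|x [] [Dx /=]]; rewrite ?in_itv/=.
  - have Dx : D x by case: (h 0%N I).
    have : g x <= inf S.
      apply/ler_addgt0Pr => e e0.
      have [k _ /(_ k (leqnn _)) hk] := near_infty_natSinv_lt (PosNum e0).
      have [_ /=] := h k I; rewrite in_itv/= => /le_trans; apply.
      by rewrite lerD2l ltW.
    by rewrite le_eqVlt => /orP[/eqP gx|gx]; [right|left]; split=> //=; rewrite in_itv.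
  - move=> gx k _; split=> //=; rewrite in_itv/=.
    by rewrite (le_trans (ltW gx))// lerDl invr_ge0.
  - by move=> gx k _; split=> //=; rewrite in_itv/= gx lerDl invr_ge0.
by rewrite null_set_setU//; apply: mg => //; exact: measurable_itv.
Qed.

(** The sets where [g] exceeds [k] in absolute value decrease to the empty set, so one of them is
    null and [g] is essentially bounded. *)
Lemma iv_integrable : mu.-integrable D (EFin \o g).
Proof.
pose E (k : nat) := D `&` [set x | k%:R < `|g x|].
have mE k : measurable (E k).
  have := measurableT_comp (@normr_measurable R setT) mg mD (measurable_itv `]k%:R, +oo[).
  by congr measurable; apply/seteqP; split=> x [Dx /=]; rewrite in_itv/= ?andbT.
have [k Ek0] : exists k, mu (E k) = 0%E.
  apply: contrapT => /forallNP En0.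
  apply: (@iv_bigcap E) => //; first by move=> k x [].
  - move=> m k mk; apply/subsetPset => x [Dx /= kx]; split=> //=.
    by apply: le_lt_trans kx; rewrite ler_nat.
  - rewrite (_ : \bigcap_k _ = set0) ?measure0//; apply/seteqP; split=> // x h.
    have := truncnS_gt `|g x|; set N := _.+1 => gN.
    by have [_ /=] := h N I; rewrite ltNge (ltW gN).
apply/(negligible_integrable (mE k) mD _ Ek0); first exact/measurable_EFinP.
apply: measurable_bounded_integrable.
- exact: measurableD.
- by apply: iv_fin; [exact: measurableD|move=> x []].
- by apply: measurable_funS mg => // x [].
- exists k%:R; split; first exact: num_real.
  move=> M kM x [Dx /not_andP[//|/=]] /negP; rewrite -leNgt => gk.
  exact/ltW/(le_lt_trans gk).
Qed.

(** A fibre of nonzero mass takes the whole unit of mass. Applied to a time slice holding one point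
    of [N], it identifies the jump of the path with the value of the coefficient there. *)
Lemma iv_one : mu D = 1%E ->
  exists c, mu (D `\` (D `&` g @^-1` [set c])) = 0%E /\ \int[mu]_(x in D) g x = c.
Proof.
move=> D1; have [|c Dc] := iv_atom; first by rewrite D1; apply/eqP; rewrite onee_neq0.
have splitD : mu D = (mu (D `\` (D `&` g @^-1` [set c]))
                     + mu (D `&` g @^-1` [set c]))%E.
  by have := measureDI mu mD (mfiber c); rewrite setIA setIid.
have Dc1 : mu (D `\` (D `&` g @^-1` [set c])) = 0%E.
  have [n hn] : exists n : nat, mu (D `&` g @^-1` [set c]) = n%:R%:E.
    by apply: intD => // x [].
  have [m hm] : exists n : nat, mu (D `\` (D `&` g @^-1` [set c])) = n%:R%:E.
    by apply: intD => [|x []//]; exact: measurableD.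
  have : 1%E = (m%:R%:E + n%:R%:E)%E :> \bar R.
    by rewrite -D1 splitD hm hn.
  rewrite -EFinD => -[] /eqP; rewrite hm -natrD (_ : 1 = 1%:R)// eqr_nat.
  move: Dc; rewrite hn; case: n {hn} => [h|n _]; first by case: h.
  by case: m {hm} => [//|m]; rewrite addSn addnS.
exists c; split=> //.
have mDD : measurable (D `\` (D `&` g @^-1` [set c])) by exact: measurableD.
rewrite /Rintegral (negligible_integral mDD mD iv_integrable Dc1).
rewrite setDD setIA setIid (eq_integral (cst c%:E)); last first.
  by move=> x; rewrite inE => -[_ /= ->].
rewrite integral_cst//.
have -> : mu (D `&` g @^-1` [set c]) = 1%E.
  by rewrite -D1 splitD Dc1 add0e.
by rewrite mule1.
Qed.

End integer_valued.

(** * Jumps of the solution paths *)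

(** Dominated convergence with the absolute value of [f] as majorant: the indicators of [A_ k] are
    eventually constant at each point. *)
Lemma integral_cvg_sub {R : realType} d (V : measurableType d)
    (mu : {measure set V -> \bar R}) (D : set V) (f : V -> \bar R)
    (A_ : nat -> set V) (A : set V) :
  measurable D -> mu.-integrable D f ->
  (forall k, measurable (A_ k)) -> measurable A ->
  (forall x, D x -> \forall k \near \oo, A_ k x <-> A x) ->
  (\int[mu]_(x in D `&` A_ k) f x @[k --> \oo] --> \int[mu]_(x in D `&` A) f x)%E.
Proof.
move=> mD intf mA_ mA A_A.
have mf : measurable_fun D f by case/integrableP: intf.
have mfr (B : set V) : measurable B -> measurable_fun D (f \_ B).
  move=> mB; apply/(measurable_restrict _ mB mD).
  by apply: measurable_funS mf => // x [].
have [] := @dominated_convergence _ V R mu D mD (fun k => f \_ (A_ k)) (f \_ A)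
   (abse \o f).
- by move=> k; exact: mfr.
- exact: mfr.
- apply: aeW => x Dx; apply: cvg_near_cst; apply: filterS (A_A x Dx) => k AA.
  by rewrite /patch; congr (if _ then _ else _); apply/idP/idP; rewrite !inE => /AA.
- exact: integrable_abse.
- apply: aeW => x k Dx; rewrite /patch/=; case: ifPn => // _.
  by rewrite abse0 abse_ge0.
- by move=> _ _; rewrite -integral_mkcondr; under eq_fun do rewrite -integral_mkcondr.
Qed.

(** It starts at 0 and, for [t > 0], stays in [[0, t[], so the integrated equation is available at
    all its terms. *)
Definition left_seq {R : realType} (t : R) (k : nat) : R := t - t / k.+1%:R.

Section left_seq.
Context {R : realType} (t : R).

Lemma left_seq_itv k : 0 < t -> 0 <= left_seq t k < t.
Proof.
move=> t0; rewrite /left_seq subr_ge0 ltrBlDr ltrDl divr_gt0// andbT.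
by rewrite ler_pdivrMr// ler_pMr// ler1n.
Qed.

Lemma left_seq_cvg : left_seq t @ \oo --> t.
Proof.
rewrite -[X in _ --> X]subr0; apply: cvgB; first exact: cvg_cst.
by rewrite -(mulr0 t); apply: cvgMr; exact: cvg_harmonic.
Qed.

End left_seq.

(* [time] is the first projection of [R * U]; it is kept abstract because
   the library gives [R] two convertible measurable structures. *)
Lemma Rintegral_strip_left {R : realType} d (V : measurableType d)
    (mu : {measure set V -> \bar R}) (time : V -> R) (S : set V) (g : V -> R)
    (T t : R) :
  measurable S -> measurable_fun S time ->
  mu.-integrable (S `&` time @^-1` `]0, T]) (EFin \o g) -> 0 < t <= T ->
  \int[mu]_(q in S `&` time @^-1` `]0, t]) g q
    - \int[mu]_(q in S `&` time @^-1` `]0, left_seq t k]) g q @[k --> \oo]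
  --> \int[mu]_(q in S `&` time @^-1` [set t]) g q.
Proof.
move=> mS mtime intg /andP[t0 tT]; set D := S `&` _ in intg.
have mstrip (I : interval R) : measurable (S `&` time @^-1` [set` I]).
  by apply: mtime => //; exact: measurable_itv.
have mslice : measurable (S `&` time @^-1` [set t]).
  by apply: mtime => //; exact: measurable_set1.
have mD : measurable D by exact: mstrip.
have subD (I : interval R) : [set` I] `<=` `]0, T] ->
    S `&` time @^-1` [set` I] `<=` D.
  by move=> sub q [Sq /= /sub].
have subt : [set` `]0, t]] `<=` `]0, T].
  by move=> r /=; rewrite !in_itv/= => /andP[-> /le_trans]; exact.
have subo : [set` `]0, t[] `<=` `]0, T].
  by move=> r /=; rewrite !in_itv/= => /andP[-> /ltW/le_trans]; exact.
(* The slice is the strip over []0, t]] minus the one over []0, t[], and the latter is the limit of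
   the strips ending at [left_seq t k]. *)
have -> : \int[mu]_(q in S `&` time @^-1` [set t]) g q =
    \int[mu]_(q in S `&` time @^-1` `]0, t]) g q
    - \int[mu]_(q in S `&` time @^-1` `]0, t[) g q.
  have -> : S `&` time @^-1` `]0, t] =
      (S `&` time @^-1` `]0, t[) `|` (S `&` time @^-1` [set t]).
    apply/seteqP; split=> q /=; rewrite !in_itv/=.
      move=> [Sq /andP[r0]]; rewrite le_eqVlt => /orP[/eqP|] ?; first by right.
      by left; rewrite r0.
    by move=> [[Sq /andP[-> /ltW]//]|[Sq ->]]; rewrite t0 lexx.
  rewrite Rintegral_setU//; first by rewrite addrAC subrr add0r.
  - apply: (integrableS mD) intg; first exact: measurableU.
    rewrite subUset; split; first exact: subD.
    by move=> q [Sq /= tq]; split=> //=; rewrite tq in_itv/= t0.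
  - apply/disj_setPS => q [[_ /= rt] [_ /= re]].
    by move: rt; rewrite re in_itv/= ltxx andbF.
apply: cvgB; first exact: cvg_cst.
apply: fine_cvg; rewrite fineK; last first.
  apply: integrable_fin_num => //.
  by apply: (integrableS mD _ _ intg) => //; exact: subD.
have stripE (I : interval R) : [set` I] `<=` `]0, T] ->
    S `&` time @^-1` [set` I] = D `&` (S `&` time @^-1` [set` I]).
  move=> sub; apply/seteqP; split=> [q [Sq /= Iq]|q [_ []//]].
  by split=> //; split=> //=; exact: sub.
rewrite stripE//; under eq_fun => k.
  rewrite stripE; last first.
    move=> r /=; rewrite !in_itv/= => /andP[-> rs].
    by rewrite (le_trans rs)// (le_trans _ tT)// ltW//; case/andP: (left_seq_itv k t0).
  over.
apply: integral_cvg_sub => // q [Sq /= tq]; have [rt|tr] := ltP (time q) t.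
  have : \forall k \near \oo, time q < left_seq t k.
    exact: (cvgr_gt t (@left_seq_cvg _ t)).
  move: tq; rewrite /= !in_itv/= => /andP[q0 qT].
  by apply: filterS => k rs; rewrite /= !in_itv/= rt (ltW rs) q0.
apply: nearW => k; rewrite /= !in_itv/=; split=> -[_ /andP[r0 h]]; exfalso.
  by move: (le_trans tr h); rewrite leNgt; case/andP: (left_seq_itv k t0) => _ ->.
by move: (le_lt_trans tr h); rewrite ltxx.
Qed.

Lemma setT_prod_strip (A B : Type) (I : set A) (J : set B) :
  (setT `*` J) `&` (fst @^-1` I) = I `*` J.
Proof. by apply/seteqP; split=> [[r z] [[_ ?] ?]|[r z] []]. Qed.

Section jump_of_path.
Context {R : realType} {d' : measure_display} {U : measurableType d'}.
Context (T : R) (U0 : set U) (mU0 : measurable U0).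

Let s (t : R) := left_seq t.

Context (nu : {finite_measure set U -> \bar R}).
Context (lam : {measure set (R * U) -> \bar R}).
Context (x m : R -> R) (f : R -> \bar R) (g : R * U -> R) (xi : R).

Let C t := \int[lam]_(q in `]0, t] `*` U0) g q
  - \int[(leb \x nu)%E]_(q in `]0, t] `*` U0) g q.

(** Compare the equation at [t] and at [left_seq t k]. The drift integral and [m] are continuous,
    and the compensator does not charge the slice because [leb] has no atoms; only the integral over
    the slice against [lam] survives. *)
Lemma jump_of_path (t : R) :
  cvg (x @ t^'-) ->
  {within `[0, T], continuous m} ->
  leb.-integrable `[0, T] f ->
  lam.-integrable (`]0, T] `*` U0) (EFin \o g) ->
  (leb \x nu)%E.-integrable (`]0, T] `*` U0) (EFin \o g) ->
  (forall r : R, 0 <= r <= T -> x r = xi + fine (\int[leb]_(u in `[r, T]) f u)%E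
     - (m T - m r) - (C T - C r)) ->
  0 < t <= T ->
  x t = left_limit x t + \int[lam]_(q in [set t] `*` U0) g q.
Proof.
move=> cvgx ctsm intf intgl intgn xE tT; case/andP: (tT) => t0 tleT.
have sT k : 0 <= s t k <= T.
  by case/andP: (left_seq_itv k t0) => -> /ltW/le_trans; exact.
suff -> : left_limit x t = x t - \int[lam]_(q in [set t] `*` U0) g q by rewrite subrK.
have xs : x (s t k) @[k --> \oo] --> left_limit x t.
  have /cvg_at_leftP := cvgx; apply; split; last exact: left_seq_cvg.
  by move=> k; case/andP: (left_seq_itv k t0).
have ms : m (s t k) @[k --> \oo] --> m t.
  have /subspace_continuousP/(_ t) := ctsm.
  rewrite /= in_itv/= (ltW t0) tleT => /(_ isT) h.
  apply: cvg_trans h => B /= hB.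
  have /(@left_seq_cvg _ t) : nbhs t [set r | `[0, T]%classic r -> B (m r)] by exact: hB.
  by rewrite /nbhs/=; apply: filterS => k /=; apply; rewrite in_itv/=.
have fs : fine (\int[leb]_(u in `[s t k, T]) f u)%E @[k --> \oo] -->
          fine (\int[leb]_(u in `[t, T]) f u)%E.
  have itvE (r : R) : 0 <= r -> `[r, T]%classic = `[0, T] `&` `[r, +oo[.
    move=> r0; apply/seteqP; split=> u /=; rewrite !in_itv/= ?andbT.
      by move=> /andP[ru ->]; rewrite (le_trans r0 ru) ru.
    by move=> [/andP[_ ->] ->].
  apply: fine_cvg; rewrite fineK; last first.
    apply: integrable_fin_num; first exact: measurable_itv.
    apply: (@integrableS _ _ _ leb `[0, T]) intf => //.
    by rewrite itvE ?ltW//; exact: subIsetl.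
  rewrite itvE ?(ltW t0)//.
  have s0 k : 0 <= s t k by case/andP: (sT k).
  under eq_fun => k do rewrite (itvE _ (s0 k)).
  apply: integral_cvg_sub => //.
  move=> u _; have [ut|tu] := ltP u t; last first.
    apply: nearW => k; rewrite /= !in_itv/= !andbT tu.
    by split=> // _; apply: le_trans tu; apply: ltW; case/andP: (left_seq_itv k t0).
  have : \forall k \near \oo, u < s t k by exact: (cvgr_gt t (@left_seq_cvg _ t)).
  apply: filterS => k us; rewrite /= !in_itv/= !andbT.
  by rewrite !leNgt us ut.
have Ln : \int[(leb \x nu)%E]_(q in [set t] `*` U0) g q = 0.
  have mslice : measurable ([set t] `*` U0 : set (measurableTypeR R * U)).
    by apply: measurableX => //; exact: measurable_set1.
  rewrite /Rintegral null_set_integral//.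
  - case/integrableP: intgn => + _; apply: measurable_funS.
      by apply: measurableX => //; exact: measurable_itv.
    by move=> q [/= -> ?]; split=> //=; rewrite in_itv.
  - apply: (etrans (product_measure1E leb nu (measurable_set1 t) mU0)).
    by rewrite [X in (X * _)%E](lebesgue_measure_set1 t) mul0e.
have mST : measurable (setT `*` U0 : set (R * U)) by exact: measurableX.
have mST' : measurable (setT `*` U0 : set (measurableTypeR R * U)).
  exact: measurableX.
have jl : \int[lam]_(q in `]0, t] `*` U0) g q
    - \int[lam]_(q in `]0, left_seq t k] `*` U0) g q @[k --> \oo]
    --> \int[lam]_(q in [set t] `*` U0) g q.
  rewrite -(setT_prod_strip [set t] U0) -(setT_prod_strip `]0, t] U0).
  under eq_fun => k do rewrite -(setT_prod_strip `]0, left_seq t k] U0).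
  apply: (@Rintegral_strip_left _ _ _ lam fst (setT `*` U0) g T) => //.
    exact: measurable_funTS measurable_fst.
  by rewrite setT_prod_strip.
have jn : \int[(leb \x nu)%E]_(q in `]0, t] `*` U0) g q
    - \int[(leb \x nu)%E]_(q in `]0, left_seq t k] `*` U0) g q @[k --> \oo]
    --> (0 : R).
  pose J (S : set (measurableTypeR R * U)) := \int[(leb \x nu)%E]_(q in S) g q.
  pose strip (I : set R) : set (measurableTypeR R * U) :=
    (setT `*` U0) `&` (fst @^-1` I).
  have h : (cst (J (strip `]0, t]%classic))
      \- (fun k => J (strip `]0, left_seq t k]%classic))) @ \oo -->
      J (strip [set t]).
    apply: (@Rintegral_strip_left _ _ _ (leb \x nu)%E fst (setT `*` U0) g T) => //.
      exact: measurable_funTS measurable_fst.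
    by rewrite setT_prod_strip.
  have stripE : strip = (fun I => I `*` U0).
    by apply/funext => I; exact: setT_prod_strip.
  by rewrite stripE (Ln : J ([set t] `*` U0) = 0) in h.
have tT' : 0 <= t <= T by rewrite ltW.
have xsE k : x (s t k) = x t
    + (fine (\int[leb]_(u in `[s t k, T]) f u)%E - fine (\int[leb]_(u in `[t, T]) f u)%E)
    + (m (s t k) - m t)
    - ((\int[lam]_(q in `]0, t] `*` U0) g q - \int[lam]_(q in `]0, s t k] `*` U0) g q)
       - (\int[(leb \x nu)%E]_(q in `]0, t] `*` U0) g q
          - \int[(leb \x nu)%E]_(q in `]0, s t k] `*` U0) g q)).
  by rewrite (xE _ (sT k)) (xE _ tT') /C; ring.
rewrite (eq_cvg _ _ xsE) in xs.
apply: (cvg_unique (@Rhausdorff R) xs).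
have -> : x t - \int[lam]_(q in [set t] `*` U0) g q =
  x t + (fine (\int[leb]_(u in `[t, T]) f u)%E - fine (\int[leb]_(u in `[t, T]) f u)%E)
  + (m t - m t) - (\int[lam]_(q in [set t] `*` U0) g q - 0) by ring.
by apply: cvgB; [apply: cvgD; [apply: cvgD; [exact: cvg_cst|
  apply: cvgB => //; exact: cvg_cst]|apply: cvgB => //; exact: cvg_cst]|exact: cvgB].
Qed.

End jump_of_path.

(** * Poisson random measures *)

Section poisson_law.
Context {R : realType}.
Implicit Types r : R.

Lemma poisson_prob_set1 r k : 0 < r ->
  poisson_prob r 0 [set k] = (r ^+ k * k`!%:R^-1 * expR (- r))%:E.
Proof.
by move=> r0; rewrite /poisson_prob r0 esum_set1/= /poisson_pmf r0// lee_fin !mulr_ge0// ?expR_ge0// exprn_ge0// ltW.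
Qed.

Lemma poisson_prob_series r : (\sum_(k <oo) poisson_prob r 0 [set k] = 1)%E.
Proof.
rewrite -(@probability_setT _ _ _ (poisson_prob r 0)).
have -> : [set: nat] = \bigcup_k [set k] by apply/seteqP; split=> // k _; exists k.
rewrite measure_bigcup//; last first.
  by apply/trivIsetP => i j _ _ ij; apply/seteqP; split=> // x [-> /eqP]; rewrite (negbTE ij).
by apply: eq_eseriesl => k; rewrite in_setT.
Qed.

Lemma poisson_prob_mean r : 0 <= r ->
  (\sum_(k <oo) k%:R%:E * poisson_prob r 0 [set k] = r%:E)%E.
Proof.
rewrite le_eqVlt => /predU1P[<-|r0].
  apply: eseries0 => -[|k] _ _; first by rewrite mul0e.
  by rewrite /poisson_prob ltxx diracE memNset ?mule0.
rewrite nneseries_recl//; last by move=> k _; rewrite mule_ge0.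
rewrite mul0e add0e -nneseries_addn; last by move=> k; rewrite mule_ge0.
transitivity (\sum_(k <oo) r%:E * poisson_prob r 0 [set k])%E.
  apply: eq_eseriesr => k _; rewrite !poisson_prob_set1// -!EFinM; congr EFin.
  rewrite addn1 exprS factS natrM invfM; set a := k`!%:R^-1; set b := expR _.
  by rewrite [LHS](_ : _ = (k.+1%:R * k.+1%:R^-1) * (r * (r ^+ k * a * b)));
    [rewrite mulfV// mul1r|ring].
by rewrite nneseriesZl// poisson_prob_series mule1.
Qed.

(** From [expR (- r) >= 1 - r] and [(1 + r) * (1 - r) = 1 - r ^+ 2]: two or more points are an event
    of second order in the rate. *)
Lemma poisson_prob_tail r : 0 <= r ->
  (1 - (r ^+ 2)%:E <= poisson_prob r 0 [set 0%N] + poisson_prob r 0 [set 1%N])%E.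
Proof.
rewrite le_eqVlt => /predU1P[<-|r0].
  rewrite expr0n/= sube0; apply: le_trans (leeDl _ _) => //.
  by rewrite /poisson_prob ltxx diracE mem_set.
rewrite !poisson_prob_set1// -EFinB -EFinD lee_fin expr0 fact0 invr1 expr1 !mul1r mulr1.
have := expR_ge1Dx (- r); have := expR_ge0 (- r); nra.
Qed.

End poisson_law.

Section poisson_random_measures.
Context {R : realType} {d : measure_display} {Omega : measurableType d}.
Context {d' : measure_display} {U : measurableType d'}.
Context (Pr : probability Omega R) (T : R) (U0 : set U).
Context (nu : {finite_measure set U -> \bar R}).
Context (N : Omega -> {measure set (R * U) -> \bar R}).
Hypotheses (T0 : 0 < T) (mU0 : measurable U0).
Hypothesis PN : poisson_random_measure Pr T U0 nu N.

Let S := `[0, T]%classic `*` U0.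

Let mS : measurable S.
Proof. by apply: measurableX => //; exact: measurable_itv. Qed.

Lemma measurable_count A (B : set (\bar R)) : measurable A -> A `<=` S ->
  measurable B -> measurable [set w | B (N w A)].
Proof.
move=> mA AS mB; rewrite -[X in measurable X]setTI.
exact: (prm_measurable PN mA AS).
Qed.

Lemma measurable_count_eq A (k : nat) : measurable A -> A `<=` S ->
  measurable [set w | N w A = k%:R%:E].
Proof.
by move=> mA AS; apply: (measurable_count (B := [set k%:R%:E])).
Qed.

Lemma leb_nu_strip (a b : R) (B : set U) : measurable B -> a <= b ->
  (leb \x nu)%E (`]a, b] `*` B) = ((b - a)%:E * nu B)%E.
Proof.
move=> mB ab; rewrite product_measure1E//.
rewrite [X in (X * _)%E](lebesgue_measure_itv `]a, b]) /= lte_fin.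
case: ltP => // h; have -> : a = b by apply/eqP; rewrite eq_le ab.
by rewrite subrr.
Qed.

Lemma leb_nu_fin A : measurable A -> A `<=` S -> (leb \x nu)%E A \is a fin_num.
Proof.
move=> mA AS; rewrite ge0_fin_numE ?measure_ge0//.
apply: (@le_lt_trans _ _ ((leb \x nu)%E S)).
  by apply: le_measure; rewrite ?inE.
rewrite /S product_measure1E//.
rewrite [X in (X * _)%E](lebesgue_measure_itv `[0, T]) /= lte_fin T0 sube0.
by rewrite lte_mul_pinfty ?lee_fin ?ltW// ltey_eq fin_num_measure.
Qed.

Lemma count_trivIset A : trivIset setT (fun k : nat => [set w | N w A = k%:R%:E]).
Proof.
apply/trivIsetP => i j _ _ ij; apply/seteqP; split=> // w [/= -> [/eqP]].
by rewrite eqr_nat (negbTE ij).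
Qed.

(** An infinite count is allowed pathwise; it has probability 0 because the Poisson weights of the
    finite values sum to 1. *)
Lemma count_fin_ae A : measurable A -> A `<=` S ->
  {ae Pr, forall w, exists k : nat, N w A = k%:R%:E}.
Proof.
move=> mA AS; set G := \bigcup_k [set w | N w A = k%:R%:E].
have mG : measurable G.
  by apply: bigcupT_measurable => k; exact: measurable_count_eq.
have PG : Pr G = 1%E.
  rewrite /G measure_bigcup//; last exact: count_trivIset.
    rewrite -(poisson_prob_series (fine ((leb \x nu)%E A))).
    transitivity (\sum_(k <oo) Pr [set w | N w A = k%:R%:E])%E.
      by apply: eq_eseriesl => k; rewrite in_setT.
    by apply: eq_eseriesr => k _; exact: (prm_law PN mA AS).
  by move=> k _; exact: measurable_count_eq.
exists (~` G); split; first exact: measurableC.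
  by rewrite probability_setC// PG subee//.
by move=> w /= h [k _ kw]; apply: h; exists k.
Qed.

(** Sum over the values of the count: independence factors each term, and the mean of the Poisson
    law is its rate. The independence is a premise on [E], supplied later for events of the past. *)
Lemma integral_prm (E : set Omega) A : measurable E -> measurable A -> A `<=` S ->
  (forall k : nat, Pr (E `&` [set w | N w A = k%:R%:E])
    = (Pr E * Pr [set w | N w A = k%:R%:E])%E) ->
  (\int[Pr]_(w in E) N w A = Pr E * (leb \x nu) A)%E.
Proof.
move=> mE mA AS indep; set F := fun k : nat => E `&` [set w | N w A = k%:R%:E].
have mF k : measurable (F k) by apply: measurableI => //; exact: measurable_count_eq.
have tF : trivIset setT F.
  move=> i j Ii Ij [x [[_ Fi] [_ Fj]]].
  by apply: (@count_trivIset A) => //; exists x.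
have mUF : measurable (\bigcup_k F k) by exact: bigcupT_measurable.
have mN : measurable_fun setT (fun w => N w A) by exact: (prm_measurable PN mA AS).
have UFE : \bigcup_k F k `<=` E by move=> w [k _ []].
have EUF0 : Pr (E `\` \bigcup_k F k) = 0%E.
  apply: measure_negligible; first exact: measurableD.
  apply: negligibleS (count_fin_ae mA AS) => w [Ew nUF] [k kw]; apply: nUF.
  by exists k.
rewrite (ge0_negligible_integral _ mE _ _ EUF0)//; last 2 first.
- exact: measurableD.
- exact: measurable_funTS.
rewrite setDD (setIidr UFE) ge0_integral_bigcup//; last exact: measurable_funTS.
transitivity (\sum_(k <oo) (fine (Pr E))%:E * (k%:R%:E * Pr [set w | N w A = k%:R%:E]))%E.
  apply: eq_eseriesr => k _.
  rewrite (eq_integral (cst k%:R%:E)); last by move=> w; rewrite inE => -[_ /= ->].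
  rewrite integral_cst//.
  transitivity (k%:R%:E * (Pr E * Pr [set w | N w A = k%:R%:E]))%E.
    by congr (_ * _)%E; exact: indep.
  by rewrite fineK ?fin_num_measure// muleCA.
rewrite nneseriesZl; last by move=> k _; rewrite mule_ge0.
rewrite fineK ?fin_num_measure//; congr (_ * _)%E.
under eq_eseriesr do rewrite (prm_law PN mA AS).
by rewrite poisson_prob_mean ?fine_ge0// fineK// leb_nu_fin.
Qed.

Lemma exists_cell n (x : R) : 0 < x <= n%:R ->
  exists2 i, (i < n)%N & i%:R < x <= i.+1%:R.
Proof.
elim: n => [|n IH] /andP[x0 xn]; first by move: (lt_le_trans x0 xn); rewrite ltxx.
have [xn'|nx] := leP x n%:R; last by exists n => //; rewrite nx.
have [|i ni ix] := IH; first by rewrite x0.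
by exists i => //; exact: ltnW.
Qed.

Lemma count_ge2 A : measurable A -> A `<=` S ->
  (Pr (~` [set w | N w A = 0%E] `&` ~` [set w | N w A = 1%E])
    <= (fine ((leb \x nu) A) ^+ 2)%:E)%E.
Proof.
move=> mA AS; set r := fine _; have r0 : 0 <= r by rewrite fine_ge0.
have m0 : measurable [set w | N w A = 0%E] by exact: (measurable_count_eq 0%N).
have m1 : measurable [set w | N w A = 1%E] by exact: (measurable_count_eq 1%N).
have PU : Pr ([set w | N w A = 0%E] `|` [set w | N w A = 1%E]) =
    (poisson_prob r 0 [set 0%N] + poisson_prob r 0 [set 1%N])%E.
  apply: (etrans (measureU _ _ _ _)) => //; last first.
    by congr (_ + _)%E; [exact: (prm_law PN mA AS 0)|exact: (prm_law PN mA AS 1)].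
  by apply/seteqP; split=> // w [/= -> /eqP]; rewrite eqe eq_sym oner_eq0.
rewrite -setCU; apply: (@le_trans _ _ (1 - Pr ([set w | N w A = 0%E] `|` [set w | N w A = 1%E]))%E).
  by rewrite probability_setC//; exact: measurableU.
rewrite PU leeBlDr; last by rewrite fin_numD !fin_num_measure.
by rewrite addeC -leeBlDr//; exact: poisson_prob_tail.
Qed.

(** Cut the time interval into [n.+1] equal cells. Each holds two or more points with probability of
    order [n.+1%:R ^- 2], so some cell does with probability at most [c / n.+1%:R], which tends to
    0. *)
Lemma count_simple_ae :
  {ae Pr, forall w (t : R), 0 < t <= T -> (N w ([set t] `*` U0) <= 1)%E}.
Proof.
pose cell (n i : nat) := `](T * i%:R / n.+1%:R), (T * i.+1%:R / n.+1%:R)]%classic `*` U0.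
have mcell n i : measurable (cell n i).
  by apply: measurableX => //; exact: measurable_itv.
have cellS n i : (i < n.+1)%N -> cell n i `<=` S.
  move=> ni q [/= + Uq]; rewrite !in_itv/= => /andP[lo hi]; split => //=.
  rewrite in_itv/=; apply/andP; split.
    by apply: le_trans (ltW lo); rewrite divr_ge0// mulr_ge0// ltW.
  apply: (le_trans hi); rewrite ler_pdivrMr// ler_pM2l// ler_nat//.
pose B n i := ~` [set w | N w (cell n i) = 0%E] `&` ~` [set w | N w (cell n i) = 1%E].
have mB n i : (i < n.+1)%N -> measurable (B n i).
  move=> ni; apply: measurableI; apply: measurableC.
    exact: (measurable_count_eq 0%N (mcell n i) (cellS _ _ ni)).
  exact: (measurable_count_eq 1%N (mcell n i) (cellS _ _ ni)).
pose M n := \big[setU/set0]_(i < n.+1) B n i.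
have mM n : measurable (M n) by apply: bigsetU_measurable => i _; exact: mB.
pose c := (T * fine (nu U0)) ^+ 2.
have PM n : (Pr (M n) <= (c / n.+1%:R)%:E)%E.
  apply: le_trans (Boole_inequality _ _) _; first by move=> i; exact: mB.
  apply: (@le_trans _ _ (\sum_(i < n.+1) (c / n.+1%:R ^+ 2)%:E)%E); last first.
    rewrite sumEFin lee_fin sumr_const card_ord -[leLHS]mulr_natr.
    by rewrite expr2 invfM mulrA divfK.
  apply: lee_sum => i _; apply: le_trans (count_ge2 (mcell n i) (cellS _ _ _)) _ => //.
  rewrite lee_fin leb_nu_strip//; last first.
    by rewrite ler_pM2r ?invr_gt0// ler_pM2l// ler_nat.
  rewrite fineM ?fin_num_measure//= /c -expr_div_n le_eqVlt; apply/orP; left.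
  by apply/eqP; congr (_ ^+ 2); rewrite -[i.+1%:R]natr1; field.
(* A slice with more than one point lies in a cell of every subdivision, which puts [w] in every
   [M n]. *)
pose L := \bigcap_n M n.
have mL : measurable L by exact: bigcapT_measurable.
exists L; split=> //.
  apply/eqP; rewrite -measure_le0; apply/lee_addgt0Pr => e e0; rewrite add0e.
  have e0' : 0 < e / (c + 1) by rewrite divr_gt0// ltr_wpDl// sqr_ge0.
  have [n _ /(_ n (leqnn _)) /= hn] := near_infty_natSinv_lt (PosNum e0').
  apply: (@le_trans _ _ (Pr (M n))); first by apply: le_measure; rewrite ?inE// => w; exact.
  apply: (le_trans (PM n)); rewrite lee_fin.
  have c0 : 0 <= c by exact: sqr_ge0.
  apply: (@le_trans _ _ ((c + 1) * (e / (c + 1)))).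
    by rewrite ler_pM ?invr_ge0 ?lerDl// ltW.
  by rewrite mulrCA divff ?mulr1// gt_eqF// ltr_wpDl.
move=> w /= /existsNP[t /not_implyP[/andP[t0 tT] /negP]]; rewrite -ltNge => N1 n _.
have [|i ni /andP[it ti]] := @exists_cell n.+1 (t * n.+1%:R / T).
  by rewrite divr_gt0 ?mulr_gt0// ler_pdivrMr// mulrC ler_pM2l.
rewrite /M -bigcup_mkord; exists i => //.
have : (1 < N w (cell n i))%E.
  apply: (lt_le_trans N1); apply: le_measure; rewrite ?inE//.
    by apply: measurableX => //; exact: measurable_set1.
  move=> [r z] [/= -> Uz]; split=> //=; rewrite in_itv/=; apply/andP; split.
    by rewrite ltr_pdivrMr// mulrC -ltr_pdivlMr.
  by rewrite ler_pdivlMr// [leRHS]mulrC -ler_pdivrMr.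
by move=> h; split=> /= e; move: h; rewrite e ?ltxx// lte_fin ltr10.
Qed.

End poisson_random_measures.

(** * Independence *)

Section almost_sure_events.
Context {R : realType} {d : measure_display} {Omega : measurableType d}.
Context (Pr : probability Omega R).
Implicit Types A E X : set Omega.

Lemma probability_ae_eq A E : measurable A -> measurable E ->
  {ae Pr, forall w, A w <-> E w} -> Pr A = Pr E.
Proof.
move=> mA mE AE; rewrite -[LHS]mul1e -[RHS]mul1e.
rewrite -(integral_cst Pr mA) -(integral_cst Pr mE) integral_mkcond [RHS]integral_mkcond.
apply: ae_eq_integral => //.
- by apply/(measurable_restrictT _ mA); exact: measurable_cst.
- by apply/(measurable_restrictT _ mE); exact: measurable_cst.
apply: filterS AE => w AEw _; rewrite /patch.
by congr (if _ then _ else _); apply/idP/idP; rewrite !inE => /AEw.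
Qed.

(** For a fixed event [X] this is a Dynkin class, so independence from a sigma-algebra can be
    checked on an intersection-stable generator. *)
Definition indep_of X : set (set Omega) :=
  [set E | measurable E /\ Pr (E `&` X) = (Pr E * Pr X)%E].

Lemma indep_of_dynkin X : measurable X -> dynkin (indep_of X).
Proof.
move=> mX; split.
- by split; rewrite ?setTI// probability_setT mul1e.
- move=> E [mE EX]; split; first exact: measurableC.
  have PX : Pr X = (Pr (E `&` X) + Pr (~` E `&` X))%E.
    rewrite -measureU; [|exact: measurableI|by apply: measurableI => //; exact: measurableC|].
      by rewrite -setIUl setUv setTI.
    by rewrite setIACA setICr set0I.
  have f1 : Pr (E `&` X) \is a fin_num by apply: fin_num_measure; exact: measurableI.
  have -> : Pr (~` E `&` X) = (Pr X - Pr (E `&` X))%E.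
    by rewrite PX addeAC subee// add0e.
  have PC : Pr (~` E) = (1 - Pr E)%E by rewrite probability_setC.
  rewrite PC EX -(fineK (fin_num_measure Pr _ mE)) -(fineK (fin_num_measure Pr _ mX)).
  by rewrite -EFinM -!EFinB -EFinM; congr EFin; ring.
- move=> F tF hF; split; first by apply: bigcupT_measurable => k; case: (hF k).
  rewrite setI_bigcupl measure_bigcup; last 2 first.
  + by move=> k _; apply: measurableI => //; case: (hF k).
  + by move=> i j Ii Ij [x [[Fi _] [Fj _]]]; apply: tF => //; exists x.
  transitivity (\sum_(k <oo) (fine (Pr X))%:E * Pr (F k))%E.
    rewrite (eq_eseriesl (Q := xpredT)); last by move=> k; rewrite in_setT.
    apply: eq_eseriesr => k _; rewrite fineK ?fin_num_measure// muleC.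
    by case: (hF k).
  rewrite nneseriesZl// fineK ?fin_num_measure// muleC; congr (_ * _)%E.
  rewrite measure_bigcup//; last by move=> k _; case: (hF k).
  by apply: eq_eseriesl => k; rewrite in_setT.
Qed.

Lemma indep_of_ae X A E : measurable X -> measurable A ->
  {ae Pr, forall w, A w <-> E w} -> indep_of X E -> indep_of X A.
Proof.
move=> mX mA AE [mE EX]; split=> //.
rewrite (probability_ae_eq mA mE AE) -EX.
apply: probability_ae_eq; [exact: measurableI|exact: measurableI|].
by apply: filterS AE => w h /=; rewrite h.
Qed.

End almost_sure_events.

Lemma g_sigma_algebra_sub_dynkin T (G H : set (set T)) :
  setI_closed G -> dynkin H -> G `<=` H -> <<s G >> `<=` H.
Proof.
move=> GI dH GH; rewrite -setI_closed_g_dynkin_g_sigma_algebra//.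
exact: smallest_sub.
Qed.

Lemma measure_big_seq {R : realType} d (V : measurableType d)
    (mu : {measure set V -> \bar R}) (I : choiceType) (s : seq I) (A : I -> set V) :
  uniq s -> (forall i, measurable (A i)) -> trivIset setT A ->
  mu (\big[setU/set0]_(i <- s) A i) = (\sum_(i <- s) mu (A i))%E.
Proof.
move=> + mA tA; elim: s => [|i s IH] /=; first by rewrite !big_nil measure0.
move=> /andP[si us]; have mU : measurable (\big[setU/set0]_(j <- s) A j) by exact: bigsetU_measurable.
rewrite !big_cons -IH// -measureU//.
apply/seteqP; split=> // x [Ai]; rewrite -bigcup_seq => -[j /= js Aj].
have ij : i = j by apply: tA => //; exists x.
by rewrite ij js in si.
Qed.

Section independence_of_increments.
Context {R : realType} {d : measure_display} {Omega : measurableType d}.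
Context {d' : measure_display} {U : measurableType d'}.
Context (Pr : probability Omega R) (T : R) (U0 : set U).
Context (nu : {finite_measure set U -> \bar R}).
Context (N : Omega -> {measure set (R * U) -> \bar R}).
Hypotheses (T0 : 0 < T) (mU0 : measurable U0).
Hypothesis PN : poisson_random_measure Pr T U0 nu N.

Let S (r : R) : set (R * U) := `[0, r]%classic `*` U0.

Let mS r : measurable (S r).
Proof. by apply: measurableX => //; exact: measurable_itv. Qed.

Let SS r : r <= T -> S r `<=` S T.
Proof.
by move=> rT [t z] [/= + ?]; rewrite in_itv/= => /andP[t0 tr]; split=> //=;
  rewrite in_itv/= t0 (le_trans tr).
Qed.

Lemma prm_indep_fin (I : finType) (A : I -> set (R * U)) (B : I -> set (\bar R)) :
  (forall i, measurable (A i) /\ A i `<=` S T) -> trivIset setT A ->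
  (forall i, measurable (B i)) ->
  Pr [set w | forall i, B i (N w (A i))]
    = (\prod_(i : I) Pr [set w | B i (N w (A i))])%E.
Proof.
move=> mA tA mB.
have := @prm_indep _ _ _ _ _ _ _ _ _ _ PN #|I| (A \o enum_val) _ _ (B \o enum_val) _.
move=> /(_ (fun i => mA _)) h.
have tA' : trivIset setT (A \o (@enum_val I I)).
  by move=> i j _ _ ij; apply: enum_val_inj; exact: tA.
rewrite (big_enum_val (fun i => Pr [set w | B i (N w (A i))])) -(h tA' (fun i => mB _)).
congr (Pr _); apply/seteqP; split=> w /= hw i; first exact: hw.
by rewrite -(enum_rankK i).
Qed.

Definition cylinder (I : finType) (C : I -> set (R * U)) (D : I -> set (\bar R)) :
  set Omega := [set w | forall i, D i (N w (C i))].

Definition past (r : R) (I : finType) (C : I -> set (R * U))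
    (D : I -> set (\bar R)) : Prop :=
  forall i, [/\ measurable (C i), C i `<=` S r & measurable (D i)].

Lemma cylinder_N_events r (I : finType) C D : @past r I C D ->
  <<s N_events U0 N r >> (cylinder C D).
Proof.
move=> pCD; pose G := N_events U0 N r.
have -> : cylinder C D = \bigcap_(i in [set: I]) [set w | D i (N w (C i))].
  by apply/seteqP; split=> w h i => [_|]; exact: h.
apply: (@fin_bigcap_measurable _ (g_sigma_algebraType G)) => //.
move=> i _; apply: sub_sigma_algebra; have [mC CS mD] := pCD i.
by exists (C i), (D i).
Qed.

Lemma measurable_cylinder r (I : finType) C D : r <= T -> @past r I C D ->
  measurable (cylinder C D).
Proof.
move=> rT pCD.
have -> : cylinder C D = \bigcap_(i in [set: I]) [set w | D i (N w (C i))].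
  by apply/seteqP; split=> w h i => [_|]; exact: h.
apply: fin_bigcap_measurable => // i _; have [mC CS mD] := pCD i.
apply: (measurable_count PN) => //; exact: subset_trans (SS rT).
Qed.

(* The [C i] generate a finite partition into atoms; almost surely all counts
   are finite, and a cylinder is a countable disjoint union of events
   prescribing the count of every atom. *)
Lemma cylinder_indep r (I : finType) C D (A : set (R * U)) (B : set (\bar R)) :
  r <= T -> @past r I C D -> measurable A -> A `<=` S T -> A `&` S r = set0 ->
  measurable B ->
  indep_of Pr [set w | B (N w A)] (cylinder C D).
Proof.
move=> rT pCD mA AS Ar mB; set X := [set w | B (N w A)].
have mX : measurable X by exact: (measurable_count PN).
pose K : finType := {ffun I -> bool}.
(* The intersection with [S r] keeps the atom lying in no [C i] bounded in time and disjoint from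
   [A]. *)
pose atom (s : K) := S r `&` [set x | forall i, s i = `[< C i x >]].
have matom s : measurable (atom s).
  apply: measurableI => //.
  have -> : [set x | forall i, s i = `[< C i x >]] =
      \bigcap_(i in [set: I]) (if s i then C i else ~` C i).
    apply/seteqP; split=> x h i => [_|].
      by rewrite (h i); case: asboolP.
    by have := h i Logic.I; case: (s i) => ?; [rewrite asboolT|rewrite asboolF].
  apply: fin_bigcap_measurable => // i _; have [mC _ _] := pCD i.
  by case: (s i) => //; exact: measurableC.
have atomS s : atom s `<=` S T by apply: subset_trans (SS rT) => x [].
have tatom : trivIset setT atom.
  move=> s s' _ _ [x [[_ h] [_ h']]]; apply/ffunP => i.
  by rewrite h h'.
pose Ev (k : {ffun K -> nat}) := cylinder atom (fun s => [set (k s)%:R%:E]).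
have mEv k : measurable (Ev k).
  apply: (@measurable_cylinder r) => // s; split=> //.
  by move=> x [].
have EvX k : indep_of Pr X (Ev k).
  split=> //.
  pose A' (o : (K + unit)%type) := if o is inl s then atom s else A.
  pose B' (o : (K + unit)%type) := if o is inl s then [set (k s)%:R%:E] else B.
  have mA' o : measurable (A' o) /\ A' o `<=` S T by case: o => [s|u]; split=> //; [exact: matom|exact: atomS].
  have mB' o : measurable (B' o) by case: o => [s|u] /=.
  have tA' : trivIset setT A'.
    move=> [s|[]] [s'|[]] _ _ // [x [/= h h']]; first by congr inl; apply: tatom => //; exists x.
      have hx : (A `&` S r) x by split=> //; case: h.
      by rewrite Ar in hx.
    have hx : (A `&` S r) x by split=> //; case: h'.
    by rewrite Ar in hx.
  have -> : Ev k `&` X = [set w | forall o, B' o (N w (A' o))].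
    apply/seteqP; split=> w; first by move=> [h hX] [s|[]]//=; exact: h.
    by move=> h; split; [move=> s; exact: (h (inl s))|exact: (h (inr tt))].
  rewrite (prm_indep_fin mA' tA' mB') big_sumType/=.
  rewrite [X in (_ * X)%E](big_pred1 tt); last by case.
  congr (_ * _)%E; apply/esym.
  by apply: (@prm_indep_fin K atom (fun s => [set (k s)%:R%:E])).
pose Ki i := seq.filter (fun s : K => s i) (enum K).
have CE i : C i = \big[setU/set0]_(s <- Ki i) atom s.
  rewrite -bigcup_seq; have [_ CS _] := pCD i; apply/seteqP; split=> x.
    move=> Cx; exists [ffun j => `[< C j x >]]; last first.
      by split=> [|j]; [exact: CS|rewrite ffunE].
    by rewrite /= mem_filter ffunE mem_enum andbT asboolT.
  by move=> [s /=]; rewrite mem_filter => /andP[si _] [_ /(_ i)]; rewrite si => /esym/asboolP.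
pose good (k : {ffun K -> nat}) := `[< forall i,
  D i (\sum_(s <- Ki i) (k s)%:R%:E)%E >].
have EvG k w : Ev k w -> cylinder C D w <-> good k.
  move=> Ekw; have NC i : N w (C i) = (\sum_(s <- Ki i) (k s)%:R%:E)%E.
    have uK : uniq (Ki i) by apply: filter_uniq; exact: enum_uniq.
    rewrite {1}CE (measure_big_seq _ uK matom tatom).
    by apply: eq_bigr => s _; exact: (Ekw s).
  split=> [h|/asboolP h]; first by apply/asboolP => i; rewrite -NC; exact: h.
  by move=> i /=; rewrite NC; exact: h.
(* Count vectors are enumerated through their codes; a number that codes no vector, or a vector
   violating [D], contributes the empty set. *)
pose F (n : nat) := if @pickle_inv {ffun K -> nat} n is Some k then
  (if good k then Ev k else set0) else set0.
have indepF n : indep_of Pr X (F n).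
  rewrite /F; case: pickle_inv => [k|]; last first.
    by split=> //; rewrite set0I measure0 mul0e.
  by case: (good k) => //; split=> //; rewrite set0I measure0 mul0e.
have tF : trivIset setT F.
  move=> n m _ _ [w []]; rewrite /F.
  case En: (@pickle_inv _ n) => [k|//]; case: (good k) => // Ek.
  case Em: (@pickle_inv _ m) => [k'|//]; case: (good k') => // Ek'.
  have kk : k = k'.
    apply/ffunP => s; have := Ek s; rewrite (Ek' s : N w _ = _) => -[] /eqP.
    by rewrite eqr_nat => /eqP.
  have := @pickle_invK {ffun K -> nat} n; have := @pickle_invK {ffun K -> nat} m.
  by rewrite /oapp En Em kk => <- <-.
have mC : measurable (cylinder C D) by exact: measurable_cylinder pCD.
apply: (indep_of_ae mX mC _ (dynkinU (indep_of_dynkin Pr mX) tF indepF)).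
apply: filterS (count_fin_ae PN (mS T) (@subset_refl _ _)) => w [n0 Nw].
have fin (s : K) : exists k : nat, N w (atom s) = k%:R%:E.
  have [oo|//] := prm_integer PN w (matom s) (@atomS s).
  have : (N w (atom s) <= N w (S T))%E by apply: le_measure; rewrite ?inE.
  by rewrite oo Nw leye_eq.
have [k hk] := choice fin.
have Ekw : Ev [ffun s => k s] w by move=> s /=; rewrite ffunE.
split.
  move=> /(EvG _ _ Ekw) gk; exists (pickle [ffun s => k s]) => //.
  by rewrite /F pickleK_inv gk.
move=> [n _]; rewrite /F; case: pickle_inv => [k'|//].
by case gk': (good k') => // Ek'; apply/(EvG _ _ Ek').
Qed.

End independence_of_increments.

(** * Counts are independent of the augmented past *)

Section filtration_independence.
Context {R : realType} {d : measure_display} {Omega : measurableType d}.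
Context {d' : measure_display} {U : measurableType d'}.
Context (Pr : probability Omega R) (T : R) (U0 : set U).
Context (nu : {finite_measure set U -> \bar R}) (W : R -> Omega -> R).
Context (N : Omega -> {measure set (R * U) -> \bar R}).
Hypotheses (T0 : 0 < T) (mU0 : measurable U0).
Hypothesis completeP : measure_is_complete Pr.
Hypothesis mW : forall t : R, 0 <= t <= T -> measurable_fun setT (W t).
Hypothesis PN : poisson_random_measure Pr T U0 nu N.
Hypothesis WN : independent_classes Pr <<s W_events W T >> <<s N_events U0 N T >>.

Let S (r : R) : set (R * U) := `[0, r]%classic `*` U0.

(** The completed filtration before it is made right-continuous. *)
Definition raw_filtration (r : R) : set (set Omega) :=
  <<s W_events W r `|` N_events U0 N r `|` Pr.-negligible >>.

Let F := augmented_filtration Pr T U0 W N.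

Lemma W_events_measurable r : r <= T -> W_events W r `<=` measurable.
Proof.
move=> rT _ [s /= + [B mB <-]]; rewrite in_itv/= => /andP[s0 sr].
rewrite -[X in measurable X]setTI; apply: mW => //.
by rewrite s0 (le_trans sr).
Qed.

Lemma N_events_measurable r : r <= T -> N_events U0 N r `<=` measurable.
Proof.
move=> rT _ [A [B [mA AS mB ->]]]; apply: (measurable_count PN) => //.
apply: subset_trans AS _ => -[t z] [/= + ?]; rewrite in_itv/= => /andP[t0 tr].
by split=> //=; rewrite in_itv/= t0 (le_trans tr).
Qed.

Lemma raw_filtration_measurable r : r <= T -> raw_filtration r `<=` measurable.
Proof.
move=> rT; apply: smallest_sub; first exact: sigma_algebra_measurable.
rewrite !subUset; split; last exact: completeP.
by split; [exact: W_events_measurable|exact: N_events_measurable].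
Qed.

Lemma sub_g_sigma_algebra_measurable (G : set (set Omega)) :
  G `<=` measurable -> <<s G >> `<=` measurable.
Proof. by apply: smallest_sub; exact: sigma_algebra_measurable. Qed.

(** Two independences combine: the events of [W] are independent of those of [N], to which both the
    cylinder and [X] belong, and the cylinder is independent of [X] because [A] avoids the strip
    [S r]. *)
Lemma raw_filtration_indep r (A : set (R * U)) (B : set (\bar R)) :
  r <= T -> measurable A -> A `<=` S T -> A `&` S r = set0 -> measurable B ->
  raw_filtration r `<=` indep_of Pr [set w | B (N w A)].
Proof.
move=> rT mA AS Ar mB; set X := [set w | B (N w A)].
have mX : measurable X by exact: (measurable_count PN).
(* Almost sure equality lets [gen] contain the negligible sets. Intersections stay in [gen] by
   joining the index types of the cylinders, and [W] is taken up to [T] since all of it is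
   independent of [N]. *)
pose gen := [set E | measurable E /\ exists EW : set Omega,
  <<s W_events W T >> EW /\ exists (I : finType) C D, @past _ _ _ U0 r I C D /\
  {ae Pr, forall w, E w <-> (EW w /\ cylinder N C D w)}].
have sWT : <<s W_events W T >> `<=` measurable.
  by apply: sub_g_sigma_algebra_measurable; exact: W_events_measurable.
have empty_past : past U0 r (fun _ : void => set0 : set (R * U)) (fun=> setT).
  by case.
have genI : setI_closed gen.
  move=> E E' [mE [EW [sE [I [C [D [p h]]]]]]] [mE' [EW' [sE' [I' [C' [D' [p' h']]]]]]].
  split; first exact: measurableI.
  exists (EW `&` EW'); split.
    exact: (@measurableI _ (g_sigma_algebraType (W_events W T))).
  exists (I + I')%type, (fun i => match i with inl j => C j | inr j => C' j end),
    (fun i => match i with inl j => D j | inr j => D' j end).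
  split; first by case=> i; [exact: p|exact: p'].
  apply: filterS2 h h' => w h h'; split.
    by move=> [/h[? c] /h'[? c']]; split=> // -[i|i]; [exact: c|exact: c'].
  by move=> [[e e'] c]; split; [apply/h|apply/h']; split=> // i;
    [exact: (c (inl i))|exact: (c (inr i))].
have genX : gen `<=` indep_of Pr X.
  move=> E [mE [EW [sE [I [C [D [p h]]]]]]].
  apply: (indep_of_ae mX mE h); split.
    by apply: measurableI; [exact: sWT|exact: (measurable_cylinder PN rT p)].
  have [mC CX] := cylinder_indep mU0 PN rT p mA AS Ar mB.
  have pT : past U0 T C D.
    move=> i; have [mCi Ci mDi] := p i; split=> //; apply: subset_trans Ci _.
    move=> -[t z] [/= + ?]; rewrite in_itv/= => /andP[t0 tr].
    by split=> //=; rewrite in_itv/= t0 (le_trans tr).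
  have sC := @cylinder_N_events _ _ Omega _ _ U0 N _ _ _ _ pT.
  have sX : <<s N_events U0 N T >> X.
    by apply: sub_sigma_algebra; exists A, B.
  rewrite -setIA (WN sE); last first.
    exact: (@measurableI _ (g_sigma_algebraType (N_events U0 N T))).
  by rewrite CX muleA (WN sE sC).
apply: subset_trans (g_sigma_algebra_sub_dynkin genI (indep_of_dynkin Pr mX) genX).
apply: smallest_sub; first exact: smallest_sigma_algebra.
apply: subset_trans (@sub_sigma_algebra _ setT gen).
move=> E [[EW|EN]|En].
- split; first exact: (W_events_measurable rT).
  exists E; split.
    apply: sub_sigma_algebra; case: EW => s /= sr h; exists s => //=.
    by move: sr; rewrite !in_itv/= => /andP[-> /le_trans]; apply.
  exists void, (fun=> set0), (fun=> setT); split=> //.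
  by apply: aeW => w; split=> [|[]//]; split=> // -[].
- split; first exact: (N_events_measurable rT).
  exists setT; split.
    exact: (@measurableT _ (g_sigma_algebraType (W_events W T))).
  case: EN => A' [B' [mA' A'S mB' ->]].
  exists unit, (fun=> A'), (fun=> B'); split=> //.
  by apply: aeW => w; split=> [h|[_ /(_ tt)]//]; split.
- split; first exact: completeP.
  exists set0; split.
    exact: (@measurable0 _ (g_sigma_algebraType (W_events W T))).
  exists void, (fun=> set0), (fun=> setT); split=> //.
  have [M [mM M0 EM]] := En; exists M; split=> // w /= h; apply: EM.
  by apply: contrapT => nE; apply: h; split=> // -[].
Qed.

Lemma filtration_sub_raw s r : s < r <= T \/ r = T -> F s `<=` raw_filtration r.
Proof. by move=> h E; apply. Qed.

Lemma filtration_measurable s : F s `<=` measurable.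
Proof.
apply: subset_trans (@filtration_sub_raw s T _) _; first by right.
exact: raw_filtration_measurable.
Qed.

Lemma filtrationI s A B : F s A -> F s B -> F s (A `&` B).
Proof.
move=> FA FB r h; apply: (@measurableI _ (g_sigma_algebraType
  (W_events W r `|` N_events U0 N r `|` Pr.-negligible))); [exact: FA|exact: FB].
Qed.

Lemma filtrationT s : F s setT.
Proof.
by move=> r h; exact: (@measurableT _ (g_sigma_algebraType
  (W_events W r `|` N_events U0 N r `|` Pr.-negligible))).
Qed.

Lemma filtration_negligible s A : Pr.-negligible A -> F s A.
Proof. by move=> nA r h; apply: sub_sigma_algebra; right. Qed.

Lemma filtration0 s : F s set0.
Proof. by apply: filtration_negligible; exact: negligible_set0. Qed.

Lemma filtrationC s A : F s A -> F s (~` A).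
Proof.
by move=> FA r h; apply: (@measurableC _ (g_sigma_algebraType
  (W_events W r `|` N_events U0 N r `|` Pr.-negligible))); exact: FA.
Qed.

Lemma filtration_mono s t : s <= t -> F s `<=` F t.
Proof.
move=> st A FA r [/andP[tr rT]|rT]; apply: FA; last by right.
by left; rewrite (le_lt_trans st).
Qed.

(* [N] has independent increments with respect to the right-continuous
   filtration: approximate [s] by times [r_k] decreasing to [s]. *)
Lemma integral_prm_strip (s t : R) (E : set Omega) (B : set U) :
  0 <= s -> s < t -> t <= T -> F s E -> measurable B -> B `<=` U0 ->
  (\int[Pr]_(w in E) N w (`]s, t]%classic `*` B)
    = Pr E * ((t - s)%:E * nu B))%E.
Proof.
move=> s0 st tT FE mB BU; have mE := filtration_measurable FE.
(* These times are strictly after [s], so [F s] lies in the raw filtration at [r k]. The strip for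
   [r 0 = t] is empty, and the strips increase to the one over []s, t]]. *)
pose r (k : nat) : R := s + (t - s) / k.+1%:R.
have sr k : s < r k by rewrite /r ltrDl divr_gt0// subr_gt0.
have rt k : r k <= t.
  rewrite /r -lerBrDl ler_pdivrMr//.
  by apply: ler_peMr; [rewrite subr_ge0 ltW|rewrite ler1n].
have rT k : r k <= T by exact: le_trans (rt k) tT.
pose A (k : nat) : set (R * U) := `](r k), t]%classic `*` B.
have mA k : measurable (A k) by apply: measurableX => //; exact: measurable_itv.
have AS k : A k `<=` S T.
  move=> [u z] [/= + /BU Uz]; rewrite in_itv/= => /andP[ru ut]; split=> //=.
  by rewrite in_itv/= (le_trans ut tT) andbT (le_trans s0)// ltW// (lt_trans (sr k)).
have Ar k : A k `&` S (r k) = set0.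
  apply/seteqP; split=> // -[u z] [[/= + _] [/= + _]]; rewrite !in_itv/=.
  by move=> /andP[ru _] /andP[_]; rewrite leNgt ru.
have ndA : {homo A : k m / (k <= m)%N >-> k `<=` m}.
  move=> k m km [u z] [/= + Bz]; rewrite in_itv/= => /andP[ru ut]; split=> //=.
  rewrite in_itv/= ut andbT (le_lt_trans _ ru)// lerD2l ler_pM2l ?subr_gt0//.
  by rewrite lef_pV2 ?posrE// ler_nat.
have UA : \bigcup_k A k = `]s, t]%classic `*` B.
  apply/seteqP; split=> -[u z].
    move=> [k _ [/= + Bz]]; rewrite in_itv/= => /andP[ru ut]; split=> //=.
    by rewrite in_itv/= ut (lt_trans (sr k)).
  move=> [/= + Bz]; rewrite in_itv/= => /andP[su ut].
  have e0 : 0 < (u - s) / (t - s) by rewrite divr_gt0 ?subr_gt0.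
  have [k _ /(_ k (leqnn _)) /= hk] := near_infty_natSinv_lt (PosNum e0).
  exists k => //; split=> //=; rewrite in_itv/= ut andbT.
  by rewrite /r -ltrBrDl mulrC -ltr_pdivlMr ?subr_gt0.
have mstrip : measurable (`]s, t]%classic `*` B : set (R * U)).
  by apply: measurableX => //; exact: measurable_itv.
have Ak k : (\int[Pr]_(w in E) N w (A k) = Pr E * (leb \x nu) (A k))%E.
  apply: (integral_prm T0 mU0 PN mE (mA k) (AS k)) => n.
  have mn : measurable [set n%:R%:E : \bar R] by [].
  have rE : raw_filtration (r k) E by apply: filtration_sub_raw FE; left; rewrite sr rT.
  by have [] := raw_filtration_indep (rT k) (mA k) (AS k) (Ar k) mn rE.
have cvgN : (\int[Pr]_(w in E) N w (A k) @[k --> \oo]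
    --> \int[Pr]_(w in E) N w (`]s, t]%classic `*` B))%E.
  rewrite -UA.
  have NE w : N w (\bigcup_k A k) = limn (fun k => N w (A k)).
    apply/esym/cvg_lim => //; apply: nondecreasing_cvg_mu => //.
      by rewrite UA.
    by move=> k m km; apply/subsetPset/ndA.
  under eq_integral do rewrite NE.
  apply: cvg_monotone_convergence => //.
  - move=> k; apply: measurable_funTS; exact: (prm_measurable PN (mA k) (AS k)).
  - by move=> w _ k m km; apply: le_measure; rewrite ?inE//; exact: ndA.
have cvgL : ((Pr E * (leb \x nu) (A k))%E @[k --> \oo]
    --> (Pr E * (leb \x nu) (`]s, t]%classic `*` B))%E).
  apply: cvgeZl; first exact: fin_num_measure.
  rewrite -UA; apply: nondecreasing_cvg_mu => //; first by rewrite UA.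
  by move=> k m km; apply/subsetPset/ndA.
rewrite -leb_nu_strip ?ltW//; rewrite -(eq_cvg _ _ Ak) in cvgL.
exact: (cvg_unique (@ereal_hausdorff R) cvgN cvgL).
Qed.

End filtration_independence.

(** * The compensation formula *)

Section compensation.
Context {R : realType} {d : measure_display} {Omega : measurableType d}.
Context {d' : measure_display} {U : measurableType d'}.
Context (Pr : probability Omega R) (T : R) (U0 : set U).
Context (nu : {finite_measure set U -> \bar R}) (W : R -> Omega -> R).
Context (N : Omega -> {measure set (R * U) -> \bar R}).
Hypotheses (T0 : 0 < T) (mU0 : measurable U0).
Hypothesis completeP : measure_is_complete Pr.
Hypothesis mW : forall t : R, 0 <= t <= T -> measurable_fun setT (W t).
Hypothesis PN : poisson_random_measure Pr T U0 nu N.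
Hypothesis WN : independent_classes Pr <<s W_events W T >> <<s N_events U0 N T >>.

Let F := augmented_filtration Pr T U0 W N.
Let P := g_sigma_algebraType (predictable_rectangles T F).
Let S0 : set (R * U) := `]0, T]%classic `*` U0.
Let base : set (R * Omega * U) := (`]0, T]%classic `*` setT) `*` U0.

Let mF s : F s `<=` measurable.
Proof. by move=> A; exact: (filtration_measurable completeP mW PN). Qed.

Let mS0 : measurable S0.
Proof. by apply: measurableX => //; exact: measurable_itv. Qed.

Let S0S : S0 `<=` `[0, T]%classic `*` U0.
Proof.
by move=> [t z] [/= + ?]; rewrite in_itv/= => /andP[t0 tT]; split=> //=;
  rewrite in_itv/= (ltW t0).
Qed.

Definition mark_section (D : set (R * Omega * U)) (w : Omega) : set (R * U) :=
  [set q | D (q.1, w, q.2)] `&` (`]0, T]%classic `*` U0).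

(** An almost sure event lying in every [F s], because its complement is negligible; rectangles over
    events of [F s] may thus be restricted to it. *)
Definition finite_count : set Omega :=
  [set w | exists k : nat, N w (`]0, T]%classic `*` U0) = k%:R%:E].

Lemma finite_count_ae : {ae Pr, forall w, finite_count w}.
Proof. exact: (count_fin_ae PN mS0 S0S). Qed.

Lemma finite_count_F s : F s finite_count.
Proof.
rewrite -(setCK finite_count); apply: filtrationC.
apply: filtration_negligible; exact: finite_count_ae.
Qed.

Lemma measurable_finite_count : measurable finite_count.
Proof. exact: mF (@finite_count_F 0). Qed.

Lemma probability_finite_countI A : measurable A -> Pr (finite_count `&` A) = Pr A.
Proof.
move=> mA; apply: probability_ae_eq => //.
  by apply: measurableI => //; exact: measurable_finite_count.
by apply: filterS finite_count_ae => w fw; split=> [[]|].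
Qed.

(** The measurability clauses travel with the formula through complements and unions; the first one
    also provides the measurability in [(t, z)] of predictable integrands at a fixed scenario. *)
Definition compensated (D : set (R * Omega * U)) : Prop :=
  [/\ forall w, measurable (mark_section D w),
      measurable_fun finite_count (fun w => N w (mark_section D w)),
      measurable (D `&` base : set (measurableTypeR R * Omega * U)) &
      (\int[Pr]_(w in finite_count) N w (mark_section D w)
        = ((leb \x Pr) \x nu) (D `&` base))%E].

Lemma mark_sectionI D w : mark_section (D `&` base) w = mark_section D w.
Proof. by apply/seteqP; split=> -[t z] [/=]; [move=> [? _]|move=> ? [? ?]]. Qed.

Lemma compensated_ext D D' : D `&` base = D' `&` base ->
  compensated D' -> compensated D.
Proof.
move=> e; have secE : mark_section D = mark_section D'.
  by apply/funext => w; rewrite -mark_sectionI e mark_sectionI.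
by rewrite /compensated secE e.
Qed.

Lemma leb_Pr_nu_rectangle (s t : R) (A : set Omega) (B : set U) :
  s < t -> measurable A -> measurable B ->
  (((leb \x Pr) \x nu) ((`]s, t]%classic `*` A) `*` B)
    = (t - s)%:E * Pr A * nu B)%E.
Proof.
move=> st mA mB; apply: etrans (product_measure1E (leb \x Pr)%E nu _ mB) _.
  by apply: measurableX => //; exact: (measurable_itv `]s, t]).
congr (_ * _)%E; apply: etrans (product_measure1E leb Pr _ mA) _.
  exact: (measurable_itv `]s, t]).
congr (_ * _)%E; apply: etrans (lebesgue_measure_itv `]s, t]) _.
by rewrite /= lte_fin st.
Qed.

Lemma compensated_rectangle (s t : R) (A : set Omega) (B : set U) :
  0 <= s -> s < t -> t <= T -> F s A -> measurable B ->
  compensated ((`]s, t]%classic `*` A) `*` B).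
Proof.
move=> s0 st tT FA mB; set D := _ `*` B.
have mA : measurable A by exact: mF FA.
have mBU : measurable (B `&` U0) by exact: measurableI.
have itvsub : `]s, t]%classic `<=` `]0, T]%classic.
  move=> r /=; rewrite !in_itv/= => /andP[sr rt].
  by rewrite (le_lt_trans s0 sr) (le_trans rt tT).
pose strip : set (R * U) := `]s, t]%classic `*` (B `&` U0).
have mstrip : measurable strip by apply: measurableX => //; exact: measurable_itv.
have stripS : strip `<=` `[0, T]%classic `*` U0.
  by move=> q [/= h [_ ?]]; apply: S0S; split=> //; exact: itvsub.
have secT w : A w -> mark_section D w = strip.
  move=> Aw; apply/seteqP; split=> -[r z] /=; first by move=> [[[]]] ? ? ? [].
  by move=> [rst [? ?]]; split; split=> //; exact: itvsub.
have secF w : ~ A w -> mark_section D w = set0.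
  by move=> nA; apply/seteqP; split=> // -[r z] [[[_ /=]]].
have secE : (fun w => N w (mark_section D w)) = (fun w => N w strip) \_ A.
  apply/funext => w; rewrite /patch; case: ifPn => [|/negP]; rewrite inE => Aw.
    by rewrite secT.
  by rewrite secF// measure0.
have DE : D `&` base = (`]s, t]%classic `*` A) `*` (B `&` U0).
  apply/seteqP; split=> -[[r w] z] /=; first by move=> [[[? ?] ?] [[_ _] ?]].
  by move=> [[? ?] [? ?]]; split; split=> //; split=> //; exact: itvsub.
have mN : measurable_fun setT (fun w => N w strip) by exact: (prm_measurable PN).
split.
- by move=> w; have [Aw|nA] := pselect (A w); [rewrite secT|rewrite secF].
- rewrite secE; apply: measurable_funTS; apply/(measurable_restrictT _ mA).
  exact: measurable_funTS.
- rewrite DE; apply: measurableX => //; apply: measurableX => //.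
- rewrite secE -integral_mkcondr.
  have FfA : F s (finite_count `&` A) := filtrationI (@finite_count_F s) FA.
  have BU : B `&` U0 `<=` U0 by move=> z [].
  rewrite (integral_prm_strip T0 mU0 completeP mW PN WN s0 st tT FfA mBU BU).
  rewrite probability_finite_countI// DE leb_Pr_nu_rectangle//.
  by rewrite muleA (muleC (Pr A)).
Qed.

Lemma compensated_setT : compensated setT.
Proof.
apply: (@compensated_ext _ ((`]0, T]%classic `*` setT) `*` setT)).
  by apply/seteqP; split=> -[[r w] z] /= [_ [[? _] ?]].
by apply: compensated_rectangle => //; exact: filtrationT.
Qed.

Let total : \bar R := ((leb \x Pr) \x nu)%E base.

(** Complements are obtained by subtraction, from the total count at each scenario and from the
    total mass in expectation. Both are finite, the former thanks to [finite_count]. *)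
Lemma compensated_dynkin : dynkin compensated.
Proof.
have mbase : measurable (base : set (measurableTypeR R * Omega * U)).
  by apply: measurableX => //; apply: measurableX => //; exact: (measurable_itv `]0, T]).
have fin_count w A : finite_count w -> measurable A -> A `<=` S0 ->
    N w A \is a fin_num.
  move=> [k hk] mA AS; rewrite ge0_fin_numE//; apply: (@le_lt_trans _ _ (N w S0)).
    by apply: le_measure; rewrite ?inE.
  by rewrite hk ltry.
have secS D w : mark_section D w `<=` S0 by move=> q [].
split; first exact: compensated_setT.
- move=> D [mD mND mDb ID]; have [mT mNT _ IT] := compensated_setT.
  rewrite setTI in IT.
  have secC w : mark_section (~` D) w = S0 `\` mark_section D w.
    apply/seteqP; split=> q /=; first by move=> [nD S0q]; split=> // -[].
    by move=> [S0q nD]; split=> // Dq; apply: nD.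
  have secTE w : mark_section setT w = S0 by exact: setTI.
  have mDC w : measurable (mark_section (~` D) w).
    by rewrite secC; exact: measurableD.
  have split_count w : N w S0 = (N w (mark_section D w) + N w (mark_section (~` D) w))%E.
    rewrite -measureU//; last by apply/seteqP; split=> // q [[? _] []].
    congr (N w _); rewrite secC; apply/seteqP; split=> q.
      by move=> S0q; have [?|?] := pselect (mark_section D w q); [left|right].
    by move=> [/secS|[]].
  have mNDC : measurable_fun finite_count (fun w => N w (mark_section (~` D) w)).
    apply: (eq_measurable_fun (fun w => N w S0 - N w (mark_section D w))%E).
      move=> w; rewrite inE => fw; rewrite split_count addeAC subee ?add0e//.
      exact: fin_count.
    apply: emeasurable_funB => //.
    by rewrite (_ : (fun w => N w S0) = (fun w => N w (mark_section setT w)))//;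
      apply/funext => w; rewrite secTE.
  have mDCb : measurable (~` D `&` base : set (measurableTypeR R * Omega * U)).
    have -> : ~` D `&` base = base `\` (D `&` base).
      apply/seteqP; split=> x /=; first by move=> [nD bx]; split=> // -[].
      by move=> [bx nD]; split=> // Dx; apply: nD.
    exact: measurableD.
  split=> //.
  have totE : (total = ((leb \x Pr) \x nu) (D `&` base)
                       + ((leb \x Pr) \x nu) (~` D `&` base))%E.
    rewrite -measureU//; last by rewrite setIACA setICr set0I.
    by rewrite -setIUl setUv setTI.
  have totN : (total = \int[Pr]_(w in finite_count) N w (mark_section D w)
       + \int[Pr]_(w in finite_count) N w (mark_section (~` D) w))%E.
    rewrite /total -IT -ge0_integralD//; last exact: measurable_finite_count.
    by apply: eq_integral => w _; rewrite secTE.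
  have tot_fin : total \is a fin_num.
    rewrite /total /base leb_Pr_nu_rectangle// probability_setT.
    by rewrite !fin_numM// fin_num_measure.
  have a_fin : ((leb \x Pr) \x nu)%E (D `&` base) \is a fin_num.
    rewrite ge0_fin_numE//; apply: (@le_lt_trans _ _ total).
      by rewrite totE leeDl.
    by rewrite ltey_eq tot_fin.
  move: totN; rewrite totE ID => /(congr1 (fun x => x - ((leb \x Pr) \x nu) (D `&` base))%E).
  by rewrite addeAC subee// add0e addeAC subee// add0e.
- move=> G tG hG.
  have secU w : mark_section (\bigcup_k G k) w = \bigcup_k mark_section (G k) w.
    apply/seteqP; split=> q; first by move=> [[k _ Gk] S0q]; exists k.
    by move=> [k _ [Gk S0q]]; split=> //; exists k.
  have tsec w : trivIset setT (fun k => mark_section (G k) w).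
    by move=> i j _ _ [q [[h _] [h' _]]]; apply: tG => //; exists (q.1, w, q.2).
  have msec w k : measurable (mark_section (G k) w) by case: (hG k).
  have NU w : N w (mark_section (\bigcup_k G k) w) =
      (\sum_(k <oo) N w (mark_section (G k) w))%E.
    rewrite secU (measure_bigcup _ _ _ (fun k _ => msec w k) (tsec w)).
    by apply: eq_eseriesl => k; rewrite in_setT.
  have UbE : (\bigcup_k G k) `&` base = \bigcup_k (G k `&` base) by rewrite setI_bigcupl.
  split.
  + by move=> w; rewrite secU; exact: bigcupT_measurable.
  + under eq_fun do rewrite NU.
    by apply: ge0_emeasurable_sum => // k _; case: (hG k).
  + by rewrite UbE; apply: bigcupT_measurable => k; case: (hG k).
  + under eq_integral do rewrite NU.
    rewrite integral_nneseries//; last 2 first.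
    * exact: measurable_finite_count.
    * by move=> k; case: (hG k).
    have mGb k : setT k -> measurable (G k `&` base : set (measurableTypeR R * Omega * U)).
      by case: (hG k).
    have tGb : trivIset setT (fun k => G k `&` base).
      by move=> i j _ _ [x [[Gi _] [Gj _]]]; apply: tG => //; exists x.
    rewrite UbE (measure_bigcup _ _ _ mGb tGb) [RHS](eq_eseriesl (Q := xpredT)); last by move=> k; rewrite in_setT.
    by apply: eq_eseriesr => k _; case: (hG k).
Qed.

(** Predictable rectangles do not reach times outside [[0, T]]; the side [setT] is added so that the
    sets [setT * B], which express measurability of the mark, belong to the generator. *)
Let rects : set (set (R * Omega * U)) :=
  [set A `*` B | A in predictable_rectangles T F `|` [set setT] &
                 B in (measurable : set (set U))].

Lemma predictable_rectanglesI : setI_closed (predictable_rectangles T F).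
Proof.
have empty : predictable_rectangles T F set0.
  by left; exists set0; [exact: filtration0|rewrite setX0].
have disj A (s t : R) A' : 0 <= s -> ([set 0] `*` A) `&` (`]s, t]%classic `*` A') = set0.
  move=> s0; apply/seteqP; split=> // -[r w] [[/= r0 _] [/= rs _]].
  by move: rs; rewrite r0 in_itv/= ltNge s0.
move=> E E' [[A FA ->]|[s [t [A [s0 st tT FA ->]]]]] [[A' FA' ->]|[s' [t' [A' [s0' st' tT' FA' ->]]]]].
- left; exists (A `&` A'); first exact: filtrationI.
  by rewrite -setXI setIid.
- by rewrite disj.
- by rewrite setIC disj.
- rewrite -setXI.
  have [lt|ge] := ltP (Num.max s s') (Num.min t t'); last first.
    rewrite (_ : `]s, t]%classic `&` `]s', t']%classic = set0) ?set0X//.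
    apply/seteqP; split=> // r [/=]; rewrite !in_itv/= => /andP[sr rt] /andP[sr' rt'].
    have sr2 : Num.max s s' < r by rewrite gt_max sr.
    have rt2 : r <= Num.min t t' by rewrite le_min rt.
    by have := lt_le_trans sr2 rt2; rewrite ltNge ge.
  right; exists (Num.max s s'), (Num.min t t'), (A `&` A'); split=> //.
  + by rewrite le_max s0.
  + by rewrite ge_min tT.
  + by apply: filtrationI; [apply: filtration_mono FA|apply: filtration_mono FA'];
      rewrite le_max lexx ?orbT.
  + congr (_ `*` _); apply/seteqP; split=> r /=; rewrite !in_itv/=.
      by move=> [/andP[sr rt] /andP[sr' rt']]; rewrite gt_max le_min sr rt sr'.
    by rewrite gt_max le_min => /andP[/andP[-> ->] /andP[-> ->]].
Qed.

Lemma rectsI : setI_closed rects.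
Proof.
move=> _ _ [A hA [B mB <-]] [A' hA' [B' mB' <-]].
exists (A `&` A'); last by exists (B `&` B'); [exact: measurableI|rewrite setXI].
case: hA => [hA|->]; last by rewrite setTI.
case: hA' => [hA'|->]; last by rewrite setIT; left.
by left; exact: predictable_rectanglesI.
Qed.

Lemma rects_compensated : rects `<=` compensated.
Proof.
move=> _ [A hA [B mB <-]]; case: hA => [[[A' FA ->]|[s [t [A' [s0 st tT FA ->]]]]]|->].
- apply: (@compensated_ext _ ((`]0, T]%classic `*` set0) `*` B)).
    apply/seteqP; split=> -[[r w] z] /= [[[]]]//.
    by move=> -> _ _ [[/=]]; rewrite in_itv/= ltxx.
  apply: (compensated_rectangle (lexx 0) T0 (lexx T)) => //; exact: filtration0.
- exact: compensated_rectangle.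
- apply: (@compensated_ext _ ((`]0, T]%classic `*` setT) `*` B)).
    by apply/seteqP; split=> -[[r w] z] /= [[? ?] [[? ?] ?]].
  apply: (compensated_rectangle (lexx 0) T0 (lexx T)) => //; exact: filtrationT.
Qed.

(** The product sigma-algebra is contained in the one generated by [rects]: the identity is
    measurable because its two components are. *)
Lemma predictable_compensated (D : set (P * U)) : measurable D -> compensated D.
Proof.
move=> mD; apply: (g_sigma_algebra_sub_dynkin rectsI compensated_dynkin rects_compensated).
pose Q := g_sigma_algebraType rects.
have mid : measurable_fun setT (fun q : Q => (q.1, q.2) : (P * U)%type).
  apply: measurable_fun_pair.
    apply: (@measurability _ _ Q P setT (fun q : Q => q.1) (predictable_rectangles T F)) => //.
    move=> _ [A hA <-]; apply: sub_sigma_algebra; exists A; first by left.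
    exists setT => //; rewrite setTI.
    by apply/seteqP; split=> [[x z] []//|[x z] Ax]; split.
  move=> _ B mB; apply: sub_sigma_algebra; exists setT; first by right.
  by exists B.
have := mid measurableT D mD; rewrite setTI.
by congr (<<s _ >>); apply/seteqP; split=> -[x z].
Qed.

Lemma predictable_null (D : set (P * U)) : measurable D ->
  {ae Pr, forall w, N w (mark_section D w) = 0%E} ->
  ((leb \x Pr) \x nu)%E (D `&` base) = 0%E.
Proof.
move=> mD D0; have [mDs mN _ <-] := predictable_compensated mD.
have -> : 0%E = (\int[Pr]_(w in finite_count) cst 0 w)%E by rewrite integral0.
apply: ge0_ae_eq_integral => //; first exact: measurable_finite_count.
by apply: filterS D0 => w -> _.
Qed.

End compensation.

(** * Left limits *)

Section range_of_jumps.
Context {R : realType} {d : measure_display} {Omega : measurableType d}.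
Context {d' : measure_display} {U : measurableType d'}.
Context (Pr : probability Omega R) (T : R) (U0 : set U).
Context (nu : {finite_measure set U -> \bar R}) (W : R -> Omega -> R).
Context (N : Omega -> {measure set (R * U) -> \bar R}).
Hypotheses (T0 : 0 < T) (mU0 : measurable U0).
Hypothesis completeP : measure_is_complete Pr.
Hypothesis mW : forall t : R, 0 <= t <= T -> measurable_fun setT (W t).
Hypothesis PN : poisson_random_measure Pr T U0 nu N.
Hypothesis WN : independent_classes Pr <<s W_events W T >> <<s N_events U0 N T >>.

Let F := augmented_filtration Pr T U0 W N.
Let P := g_sigma_algebraType (predictable_rectangles T F).
Let S0 : set (R * U) := `]0, T]%classic `*` U0.
Let base : set (R * Omega * U) := (`]0, T]%classic `*` setT) `*` U0.

Lemma predictable_strip (s t : R) (A : set Omega) : 0 <= s -> s < t -> t <= T ->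
  F s A -> measurable (`]s, t]%classic `*` A : set P).
Proof.
by move=> s0 st tT FA; apply: sub_sigma_algebra; right; exists s, t, A.
Qed.

Lemma predictable_domain : measurable (`[0, T]%classic `*` setT : set P).
Proof.
have -> : `[0, T]%classic `*` setT =
    ([set 0] `*` setT) `|` (`]0, T]%classic `*` setT) :> set (R * Omega).
  apply/seteqP; split=> -[r w] /=; rewrite !in_itv/=.
    by move=> [/andP[]]; rewrite le_eqVlt => /predU1P[<-|->] ->; [left|right].
  by move=> [[-> _]|[/andP[/ltW -> ->]]]//; rewrite lexx ltW.
apply: measurableU; last by apply: predictable_strip => //; exact: filtrationT.
by apply: sub_sigma_algebra; left; exists setT => //; exact: filtrationT.
Qed.

Section left_limits.
Context (X : R -> Omega -> R).
Hypothesis adX : adapted T F X.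

Let node (n i : nat) : R := T * i%:R / n.+1%:R.

Let node0 n i : 0 <= node n i.
Proof. by rewrite divr_ge0// mulr_ge0// ltW. Qed.

Let node_lt n i j : (i < j)%N -> node n i < node n j.
Proof. by move=> ij; rewrite ltr_pM2r ?invr_gt0// ltr_pM2l// ltr_nat. Qed.

Let node_le n i j : (i <= j)%N -> node n i <= node n j.
Proof. by move=> ij; rewrite ler_pM2r ?invr_gt0// ler_pM2l// ler_nat. Qed.

Let nodeT n i : (i <= n.+1)%N -> node n i <= T.
Proof. by move=> ni; rewrite ler_pdivrMr// ler_pM2l// ler_nat. Qed.

(** On each interval between nodes the value is that of [X] at the earlier node, already known
    there; this is a simple predictable process. *)
Definition left_approx (n : nat) (t : R) (w : Omega) : R :=
  \sum_(i < n.+1)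
    ((fun p => X (node n i) p.2) \_ (`](node n i), (node n i.+1)]%classic `*` setT)) (t, w).

(* A predictable version of the process of left limits, the mark 0 being
   assigned at time 0. *)
Definition pleft (t : R) (w : Omega) : R :=
  fine (limn_esup (fun n => (left_approx n t w)%:E)).

Lemma measurable_left_approx n :
  measurable_fun setT (fun p : P => left_approx n p.1 p.2).
Proof.
apply: measurable_sum => i.
have mstrip : measurable (`](node n i), (node n i.+1)]%classic `*` setT : set P).
  apply: predictable_strip => //; [exact: node_lt|exact: nodeT|exact: filtrationT].
under eq_fun do rewrite -surjective_pairing.
apply/(measurable_restrictT _ mstrip) => _ Y mY.
have -> : (`](node n i), (node n i.+1)]%classic `*` setT) `&`
    (fun p : P => X (node n i) p.2) @^-1` Y =
    `](node n i), (node n i.+1)]%classic `*` (X (node n i) @^-1` Y).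
  by apply/seteqP; split=> -[r w] [] // [].
apply: predictable_strip => //; [exact: node_lt|exact: nodeT|].
apply: adX; first by rewrite node0 nodeT// ltnW.
by exists Y.
Qed.

Lemma predictable_pleft : predictable T F pleft.
Proof.
apply: (@measurable_funTS _ _ P) => /=.
apply: measurableT_comp; first exact: fine_measurable.
apply: measurable_fun_limn_esup => n; apply/measurable_EFinP.
exact: measurable_left_approx.
Qed.

(** The approximation at [t] is [X] at a node strictly before [t] and at most one mesh away. The
    strict inequality is what selects the left limit. *)
Lemma pleftE w t : 0 < t <= T -> cvg (X ^~ w @ t^'-) ->
  pleft t w = left_limit (X ^~ w) t.
Proof.
move=> /andP[t0 tT] cvgX.
have approxE n : exists c, [/\ c < t, t - T / n.+1%:R <= c & left_approx n t w = X c w].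
  have [|i ni /andP[it ti]] := @exists_cell R n.+1 (t * n.+1%:R / T).
    by rewrite divr_gt0 ?mulr_gt0// ler_pdivrMr// mulrC ler_pM2l.
  have it' : node n i < t by rewrite /node ltr_pdivrMr// mulrC -ltr_pdivlMr.
  have ti' : t <= node n i.+1.
    by rewrite /node ler_pdivlMr// [leRHS]mulrC -ler_pdivrMr.
  exists (node n i); split=> //.
    rewrite lerBlDr; apply: (le_trans ti'); rewrite /node -natr1 mulrDr mulr1 mulrDl//.
  rewrite /left_approx (bigD1 (Ordinal ni))//= [X in _ + X]big1 ?addr0.
    by rewrite patchE mem_set//=; split=> //=; rewrite in_itv/= it'.
  move=> j ji; rewrite patchE memNset//= => -[/= + _]; rewrite in_itv/= => /andP[jt tj].
  have {}ji : (i < j)%N || (j < i)%N.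
    by rewrite -neq_ltn; apply: contra_neq ji => ij; apply: val_inj; rewrite /= ij.
  have [ij|ji'] := orP ji.
    have := lt_le_trans jt ti'; apply/negP; rewrite -leNgt; exact: node_le.
  have := lt_le_trans it' tj; apply/negP; rewrite -leNgt; exact: node_le.
have [c cP] := choice approxE.
have cvgc : c n @[n --> \oo] --> t.
  apply: (@squeeze_cvgr _ _ _ _ (fun n => t - T / n.+1%:R) (cst t)).
  - by apply: nearW => n; case: (cP n) => /ltW ct lo _; rewrite lo ct.
  - rewrite -[X in _ --> X]subr0; apply: cvgB; first exact: cvg_cst.
    by rewrite -(mulr0 T); apply: cvgMr; exact: cvg_harmonic.
  - exact: cvg_cst.
have cvgA : left_approx n t w @[n --> \oo] --> left_limit (X ^~ w) t.
  have e n : left_approx n t w = X (c n) w by case: (cP n).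
  rewrite (eq_cvg _ _ e); have /cvg_at_leftP := cvgX; apply; split=> // n.
  by case: (cP n).
have cvgE : (left_approx n t w)%:E @[n --> \oo] --> (left_limit (X ^~ w) t)%:E.
  by apply/fine_cvgP; split; [exact: nearW|exact: cvgA].
rewrite /pleft is_cvg_limn_esupE; last by apply/cvg_ex; exists (left_limit (X ^~ w) t)%:E.
by rewrite (cvg_lim _ cvgE).
Qed.

End left_limits.

Lemma left_limit_range (x : R -> R) (K t : R) : 0 < t <= T -> cvg (x @ t^'-) ->
  (forall s : R, 0 <= s <= T -> 0 < x s <= K) -> 0 <= left_limit x t <= K.
Proof.
move=> /andP[t0 tT] cvgx xK.
have near0 : \forall s \near t^'-, 0 < x s <= K.
  near=> s; apply: xK; apply/andP; split.
    by near: s; apply: nbhs_left_ge.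
  by apply: le_trans tT; near: s; apply: nbhs_left_le.
apply/andP; split.
  by apply: limr_ge => //; apply: filterS near0 => s /andP[/ltW].
by apply: limr_le => //; apply: filterS near0 => s /andP[].
Unshelve. all: by end_near. Qed.

Lemma mark_section_measurable_fun (G : R -> Omega -> U -> R) w :
  predictable_mark T U0 F G ->
  measurable_fun S0 (fun q : R * U => G q.1 w q.2).
Proof.
move=> mG mS0 Y mY.
have mdom : measurable ((`[0, T]%classic `*` setT) `*` U0 : set (P * U)).
  by apply: measurableX => //; exact: predictable_domain.
have [/(_ w) + _ _ _] := predictable_compensated T0 mU0 completeP mW PN WN (mG mdom Y mY).
congr measurable; apply/seteqP; split=> -[t z] /=; first by move=> [[]].
move=> [[/= tT Uz] GY]; split=> //; split=> //; split=> //; split=> //=.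
by move: tT; rewrite !in_itv/= => /andP[/ltW -> ->].
Qed.

Lemma predictable_measurable (D : set P) : measurable D ->
  measurable (D : set (measurableTypeR R * Omega)).
Proof.
move: D; apply: smallest_sub; first exact: sigma_algebra_measurable.
have mF s := @filtration_measurable _ _ _ _ _ _ _ U0 _ _ _ completeP mW PN s.
move=> _ [[A FA ->]|[s [t [A [s0 st tT FA ->]]]]]; apply: measurableX.
- exact: (measurable_set1 0).
- exact: mF FA.
- exact: (measurable_itv `]s, t]).
- exact: mF FA.
Qed.

Lemma predictable_mark_measurable (D : set (P * U)) : measurable D ->
  measurable (D : set (measurableTypeR R * Omega * U)).
Proof.
move=> mD; pose Q := (measurableTypeR R * Omega * U)%type.
have mid : measurable_fun setT (fun q : Q => (q.1, q.2) : (P * U)%type).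
  apply: measurable_fun_pair; last exact: measurable_snd.
  move=> _ B mB; rewrite setTI.
  have := @measurable_fst _ _ (measurableTypeR R * Omega)%type U measurableT _
    (predictable_measurable mB).
  by rewrite setTI.
have := mid measurableT D mD; rewrite setTI.
by congr measurable; apply/seteqP; split=> -[x z].
Qed.

Lemma mark_measurable_fun (G : R -> Omega -> U -> R) :
  predictable_mark T U0 F G ->
  measurable_fun ((`[0, T]%classic `*` setT) `*` U0 : set (measurableTypeR R * Omega * U))
    (fun q : measurableTypeR R * Omega * U => G q.1.1 q.1.2 q.2).
Proof.
move=> mG _ Y mY; apply: predictable_mark_measurable; apply: mG => //.
by apply: measurableX => //; exact: predictable_domain.
Qed.

End range_of_jumps.

(** * The range of the jumps *)

Section product_sigma_finite.
Context {R : realType} d1 d2 (V1 : measurableType d1) (V2 : measurableType d2).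
Variables (m1 : {sigma_finite_measure set V1 -> \bar R}).
Variables (m2 : {sigma_finite_measure set V2 -> \bar R}).

(* The library attaches a sigma-finite structure to [m1 \x m2] only when [m1]
   and [m2] are subprobabilities. *)
Definition sigma_finite_prod : set (V1 * V2) -> \bar R := (m1 \x m2)%E.

HB.instance Definition _ := Measure.copy sigma_finite_prod (m1 \x m2)%E.

Lemma sigma_finite_prodT : sigma_finite setT sigma_finite_prod.
Proof.
have /sigma_finiteP[A [TA ndA Aoo]] := sigma_finiteT m1.
have /sigma_finiteP[B [TB ndB Boo]] := sigma_finiteT m2.
exists (fun n => A n `*` B n).
  rewrite -setXTT TA TB predeqE => -[x y]; split.
    move=> [/= [n _ Anx] [k _ Bky]]; exists (maxn n k) => //; split.
    - by move: x Anx; exact/subsetPset/ndA/leq_maxl.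
    - by move: y Bky; exact/subsetPset/ndB/leq_maxr.
  by move=> [n _ []/= ? ?]; split; exists n.
move=> k; have [? ?] := Aoo k; have [? ?] := Boo k.
split; first exact: measurableX.
by rewrite /sigma_finite_prod product_measure1E// lte_mul_pinfty// ge0_fin_numE.
Qed.

HB.instance Definition _ := Measure_isSigmaFinite.Build _ _ _ sigma_finite_prod
  sigma_finite_prodT.

End product_sigma_finite.

Section almost_everywhere_in_products.
Context {R : realType} d1 d2 (V1 : measurableType d1) (V2 : measurableType d2).
Context (m1 : {measure set V1 -> \bar R}).
Context (m2 : {sigma_finite_measure set V2 -> \bar R}).

Lemma ae_prod1 (Q : V1 * V2 -> Prop) : {ae (m1 \x m2)%E, forall q, Q q} ->
  {ae m1, forall x, {ae m2, forall y, Q (x, y)}}.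
Proof.
move=> [M [mM M0 QM]].
have mxs := measurable_fun_xsection m2 mM.
have /ae_eq_integral_abs : (\int[m1]_x `|(m2 \o xsection M) x| = 0)%E.
  by under eq_integral do rewrite gee0_abs//.
move=> /(_ measurableT mxs) ae0.
apply: filterS ae0 => x /(_ I) /= x0; exists (xsection M x); split=> //.
  exact: measurable_xsection.
by move=> y /= nQ; apply/xsectionP/QM.
Qed.

Lemma ae_snd (Q : V2 -> Prop) : {ae m2, forall y, Q y} ->
  {ae (m1 \x m2)%E, forall q, Q q.2}.
Proof.
move=> [M [mM M0 QM]]; exists (setT `*` M); split.
- exact: measurableX.
- by rewrite product_measure1E// M0 mule0.
- by move=> [x y] /= nQ; split=> //; exact: QM.
Qed.

End almost_everywhere_in_products.

(** Tonelli with the middle variable integrated last: a finite total integral is finite on almost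
    every section. *)
Lemma slice_finite_integral_ae {R : realType} d1 d2 d3
    (V1 : measurableType d1) (V2 : measurableType d2) (V3 : measurableType d3)
    (m1 : {sigma_finite_measure set V1 -> \bar R})
    (m2 : {sigma_finite_measure set V2 -> \bar R})
    (m3 : {sigma_finite_measure set V3 -> \bar R}) (f : V1 * V2 * V3 -> \bar R) :
  measurable_fun setT f -> (forall q, 0 <= f q)%E ->
  (\int[(m1 \x m2) \x m3]_q f q < +oo)%E ->
  {ae m2, forall y, (\int[m1 \x m3]_q f ((q.1, y), q.2) < +oo)%E}.
Proof.
move=> mf f0 If; set H := fubini_F m3 f.
have mH : measurable_fun setT H by exact: measurable_fun_fubini_tonelli_F.
have H0 p : (0 <= H p)%E by exact: integral_ge0.
have E1 : (\int[(m1 \x m2) \x m3]_q f q = \int[m1 \x m2]_p H p)%E.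
  exact: (@fubini_tonelli1 _ _ _ _ _ (sigma_finite_prod m1 m2) m3 f mf f0).
have {E1} If2 : (\int[m1 \x m2]_p H p < +oo)%E by rewrite -E1.
have {If2} : (\int[m2]_y fubini_G m1 H y < +oo)%E.
  by rewrite -(fubini_tonelli2 H mH H0).
have mK := measurable_fun_fubini_tonelli_G (m1 := m1) H mH H0.
have K0 y : (0 <= fubini_G m1 H y)%E by exact: integral_ge0.
move=> IK.
have intK : m2.-integrable setT (fubini_G m1 H).
  by apply/integrableP; split=> //; under eq_integral do rewrite gee0_abs//.
apply: filterS (integrable_ae measurableT intK) => y /(_ I).
rewrite ge0_fin_numE// => Ky.
have mfy : measurable_fun setT (fun q => f ((q.1, y), q.2)).
  apply: (measurableT_comp mf); apply: measurable_fun_pair; last exact: measurable_snd.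
  by apply: measurable_fun_pair; [exact: measurable_fst|exact: measurable_cst].
by rewrite (fubini_tonelli1 _ mfy (fun q => f0 _)).
Qed.

Section range_of_jumps.
Context {R : realType} {d : measure_display} {Omega : measurableType d}.
Context {d' : measure_display} {U : measurableType d'}.
Context (Pr : probability Omega R) (T : R) (U0 : set U).
Context (nu : {finite_measure set U -> \bar R}) (W : R -> Omega -> R).
Context (N : Omega -> {measure set (R * U) -> \bar R}).
Hypotheses (T0 : 0 < T) (mU0 : measurable U0).
Hypothesis completeP : measure_is_complete Pr.
Hypothesis mW : forall t : R, 0 <= t <= T -> measurable_fun setT (W t).
Hypothesis PN : poisson_random_measure Pr T U0 nu N.
Hypothesis WN : independent_classes Pr <<s W_events W T >> <<s N_events U0 N T >>.

Let F := augmented_filtration Pr T U0 W N.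
Let P := g_sigma_algebraType (predictable_rectangles T F).
Let S0 : set (R * U) := `]0, T]%classic `*` U0.
Let base : set (R * Omega * U) := (`]0, T]%classic `*` setT) `*` U0.
Let dom : set (R * Omega * U) := (`[0, T]%classic `*` setT) `*` U0.

(** Almost every section is square integrable on a strip of finite measure, hence integrable since
    the absolute value of [x] is at most [1 + x ^+ 2]. *)
Lemma L2_nu_integrable_ae (G : R -> Omega -> U -> R) : L2_nu Pr T U0 nu F G ->
  {ae Pr, forall w, (leb \x nu)%E.-integrable S0 (EFin \o (fun q => G q.1 w q.2))}.
Proof.
move=> [mG G2]; pose V := (measurableTypeR R * Omega * U)%type.
have mdom : measurable (dom : set V).
  by apply: measurableX => //; apply: measurableX => //; exact: (measurable_itv `[0, T]).
have mGd := mark_measurable_fun T0 mU0 completeP mW PN mG.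
pose f : V -> \bar R := (fun q : V => (G q.1.1 q.1.2 q.2 ^+ 2)%:E) \_ dom.
have mf : measurable_fun setT f.
  apply/(measurable_restrictT _ mdom)/measurable_EFinP.
  exact: measurable_funX.
have f0 q : (0 <= f q)%E by rewrite /f patchE; case: ifP => // _; rewrite lee_fin sqr_ge0.
have If : (\int[(leb \x Pr) \x nu]_q f q < +oo)%E.
  by rewrite /f -integral_mkcond.
apply: filterS (slice_finite_integral_ae mf f0 If) => w Ifw0.
pose fw (q : measurableTypeR R * U) := f ((q.1, w), q.2).
have mfw : measurable_fun setT fw.
  apply: (measurableT_comp mf); apply: measurable_fun_pair; last exact: measurable_snd.
  by apply: measurable_fun_pair; [exact: measurable_fst|exact: measurable_cst].
have Ifw : (\int[leb \x nu]_q fw q < +oo)%E by exact: Ifw0.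
have mS0 : measurable (S0 : set (measurableTypeR R * U)).
  by apply: measurableX => //; exact: (measurable_itv `]0, T]).
have mGw := mark_section_measurable_fun T0 mU0 completeP mW PN WN w mG.
have nS0 : ((leb \x nu) S0 < +oo)%E.
  rewrite leb_nu_strip ?ltW// ltey_eq fin_numM//.
  exact: fin_num_measure.
have int2 : (leb \x nu)%E.-integrable S0 (EFin \o (fun q => G q.1 w q.2 ^+ 2)).
  apply/integrableP; split; first by apply/measurable_EFinP; exact: measurable_funX.
  apply: le_lt_trans Ifw; rewrite [leLHS]integral_mkcond.
  apply: ge0_le_integral => //.
  - by move=> q _; rewrite patchE; case: ifP.
  - apply/(measurable_restrictT _ mS0); apply: measurableT_comp => //.
    by apply/measurable_EFinP; exact: measurable_funX.
  - move=> q _; rewrite patchE; case: ifPn => [|_]; last exact: f0.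
    rewrite inE => -[/= qT Uq]; rewrite /fw /f patchE mem_set/=.
      by rewrite ger0_norm// sqr_ge0.
    by split=> //; split=> //=; move: qT; rewrite !in_itv/= => /andP[/ltW -> ->].
have int1 : (leb \x nu)%E.-integrable S0 (EFin \o (cst 1 : R * U -> R)).
  apply: measurable_bounded_integrable => //.
  by exists 1; split; rewrite ?num_real// => x x1 q _; rewrite /= normr1 ltW.
have := integrableD mS0 int1 int2.
apply: le_integrable => //; first by apply/measurable_EFinP.
move=> q Sq /=; rewrite lee_fin [leRHS]ger0_norm ?addr_ge0 ?sqr_ge0//.
by have [h|h] := ger0P (G q.1 w q.2); nra.
Qed.

Theorem jump_range (X L : R -> Omega -> R) (G : R -> Omega -> U -> R)
    (f : R -> Omega -> \bar R) (xi : Omega -> R) (K : R) :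
  backward_sde Pr T U0 nu F W N f xi X L G ->
  {ae Pr, forall w (t : R), 0 <= t <= T -> 0 < X t w <= K} ->
  {ae ((leb \x Pr) \x nu)%E, forall q : R * Omega * U, 0 < q.1.1 <= T -> U0 q.2 ->
    0 <= pleft T X q.1.1 q.1.2 + G q.1.1 q.1.2 q.2 <= K}.
Proof.
move=> [adX cadX _ LG intf [m [_ ctsm _] Xeq]] XK.
(* Built on [pleft], so that the set [D] below is predictable. *)
pose Y (q : P * U) := pleft T X q.1.1 q.1.2 + G q.1.1 q.1.2 q.2.
have mdomP : measurable (`[0, T]%classic `*` setT : set P).
  exact: predictable_domain.
have mdom : measurable (dom : set (P * U)) by exact: measurableX.
have mpl : measurable_fun (dom : set (P * U)) (fun q : P * U => pleft T X q.1.1 q.1.2).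
  move=> _ B mB; have h := predictable_pleft T0 adX mdomP mB.
  have -> : dom `&` (fun q : P * U => pleft T X q.1.1 q.1.2) @^-1` B =
      ((`[0, T]%classic `*` setT) `&` (fun p : P => pleft T X p.1 p.2) @^-1` B) `*` U0.
    by apply/seteqP; split=> -[p z] /=; [move=> [[? ?] ?]|move=> [[? ?] ?]].
  exact: measurableX.
have mY : measurable_fun (dom : set (P * U)) Y.
  by apply: measurable_funD => //; case: LG.
pose D : set (P * U) := dom `&` Y @^-1` (~` `[0, K]%classic).
have mD : measurable D.
  by apply: mY => //; apply: measurableC; exact: measurable_itv.
have mS0 : measurable S0 by apply: measurableX => //; exact: measurable_itv.
have S0S : S0 `<=` `[0, T]%classic `*` U0.
  by move=> [t z] [/= + ?]; rewrite in_itv/= => /andP[t0 tT]; split=> //=;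
    rewrite in_itv/= (ltW t0).
have D0 : {ae Pr, forall w, N w (mark_section T U0 D w) = 0%E}.
  have intG := L2_nu_integrable_ae LG.
  have simple := count_simple_ae T0 mU0 PN.
  have fin := finite_count_ae mU0 PN.
  near=> w.
  have cad : cadlag T (X ^~ w) by near: w.
  have cm : {within `[0, T], continuous (m ^~ w)} by near: w.
  have If : leb.-integrable `[0, T] (f ^~ w) by near: w.
  have eqw : forall t : R, 0 <= t <= T ->
      X t w = xi w + fine (\int[leb]_(s in `[t, T]) f s w)%E
              - (m T w - m t w)
              - (compensated_integral U0 nu N G T w - compensated_integral U0 nu N G t w).
    by near: w.
  have XKw : forall t : R, 0 <= t <= T -> 0 < X t w <= K by near: w.
  have IG : (leb \x nu)%E.-integrable S0 (EFin \o (fun q => G q.1 w q.2)) by near: w.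
  have N1 : forall t : R, 0 < t <= T -> (N w ([set t] `*` U0) <= 1)%E by near: w.
  have [n0 Nfin] : finite_count T U0 N w by near: w.
  have intN A : measurable A -> A `<=` S0 -> exists n : nat, N w A = n%:R%:E.
    move=> mA AS; have [oo|//] := prm_integer PN w mA (subset_trans AS S0S).
    have : (N w A <= N w S0)%E by apply: le_measure; rewrite ?inE.
    by rewrite oo Nfin leye_eq.
  have mGw := mark_section_measurable_fun T0 mU0 completeP mW PN WN w (proj1 LG).
  have mDw : measurable (mark_section T U0 D w).
    by case: (predictable_compensated T0 mU0 completeP mW PN WN mD).
  have DS : mark_section T U0 D w `<=` S0 by move=> q [].
  apply: contrapT => DN0.
  have intND A : measurable A -> A `<=` mark_section T U0 D w -> exists n : nat, N w A = n%:R%:E.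
    by move=> mA AD; apply: intN => //; exact: subset_trans DS.
  (* Applied to the time coordinate: if [N w] charges the bad section, it charges the part of it at
     a single time [t]. *)
  have [t Dt] := iv_atom mDw intND (measurable_funTS measurable_fst) DN0.
  set A := mark_section T U0 D w `&` fst @^-1` [set t] in Dt.
  have mA : measurable A.
    by apply: (measurable_funTS measurable_fst) => //; exact: measurable_set1.
  have tT : 0 < t <= T.
    apply: contrapT => tT; apply: Dt; rewrite (_ : A = set0) ?measure0//.
    apply/seteqP; split=> // -[r z] [[_ [/= rT _]] /= rt].
    by apply: tT; rewrite -rt; move: rT; rewrite in_itv.
  have slS : [set t] `*` U0 `<=` S0 by move=> [r z] [/= -> ?]; split=> //=; rewrite in_itv.
  have msl : measurable ([set t] `*` U0 : set (R * U)) by exact: measurableX.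
  have Asl : A `<=` [set t] `*` U0 by move=> [r z] [[_ [_ ?]] /= ?].
  (* The mass of the slice is an integer, nonzero because it dominates that of [A], and at most
     1. *)
  have sl1 : N w ([set t] `*` U0) = 1%E.
    have := N1 t tT; have [n Nn] := intN _ msl slS.
    have : (N w A <= N w ([set t] `*` U0))%E by apply: le_measure; rewrite ?inE.
    rewrite Nn; case: n {Nn} => [|[|n]]//.
      by rewrite measure_le0 => /eqP.
    by rewrite lee_fin (_ : 1 = 1%:R)// ler_nat.
  have intNs B : measurable B -> B `<=` [set t] `*` U0 -> exists n : nat, N w B = n%:R%:E.
    by move=> mB Bs; apply: intN => //; exact: subset_trans slS.
  (* The coefficient is a constant [c] for almost every mark of the slice under [N w], and its
     integral, the jump of the path at [t], equals [c]. *)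
  have [c [slc Ic]] := iv_one msl intNs (measurable_funS mS0 slS mGw) sl1.
  have cvgX : cvg (X ^~ w @ t^'-) by case: cad => _; apply.
  have INw := iv_integrable mS0 intN mGw.
  have jump := @jump_of_path _ _ U T U0 mU0 nu (N w) (X ^~ w) (m ^~ w) (f ^~ w)
    (fun q => G q.1 w q.2) (xi w) t cvgX cm If INw IG eqw tT.
  (* Where the coefficient is [c], [Y] equals [X t w] and lies in [[0, K]]. So [A] is contained in
     the rest of the slice, which is null for [N w]. *)
  apply: Dt; apply/eqP; rewrite -measure_le0.
  apply: le_trans (eq_ind_r (fun x => x <= 0)%E (lexx 0%E) slc).
  have mc := (measurable_funS mS0 slS mGw) msl [set c] (measurable_set1 c).
  apply: le_measure; rewrite ?inE//; first exact: measurableD.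
  move=> [r z] Aq; split; first exact: Asl.
  move=> [[/= rt Uz] /= Gc]; case: Aq => -[[_ /= nY] _] _; apply: nY.
  rewrite rt in Gc; rewrite /Y/= rt (pleftE T0 tT cvgX) Gc -Ic -jump in_itv/=.
  by case/andP: tT => t0 tT; case/andP: (XKw t (introT andP (conj (ltW t0) tT))) => /ltW -> ->.
have := predictable_null T0 mU0 completeP mW PN WN mD D0.
have mDb : measurable (D `&` base : set (measurableTypeR R * Omega * U)).
  by case: (predictable_compensated T0 mU0 completeP mW PN WN mD).
move=> null; exists (D `&` base); split=> //.
move=> [[t w] z] /= /not_implyP[tT /not_implyP[Uz nY]].
have t0T : [set` `[0, T]] t by rewrite /= in_itv/=; case/andP: tT => /ltW -> ->.
have t0T' : [set` `]0, T]] t by rewrite /= in_itv.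
split; first split.
- by split.
- by move=> /= Yi; apply: nY; move: Yi; rewrite in_itv.
- by split.
Unshelve. all: by end_near. Qed.

End range_of_jumps.

(** * Measurability of the saddle point *)

Lemma ae_null_diff {R : realType} d (V : measurableType d)
    (mu : {measure set V -> \bar R}) (D : set V) (Q : V -> Prop) :
  measurable D -> {ae mu, forall z, D z -> Q z} ->
  exists Z, [/\ measurable Z, Z `<=` D, mu (D `\` Z) = 0%E & forall z, Z z -> Q z].
Proof.
move=> mD [N [mN N0 subN]]; exists (D `\` N); split.
- exact: measurableD.
- by move=> z [].
- apply/eqP; rewrite -measure_le0 -N0; apply: le_measure; rewrite ?inE//.
    by apply: measurableD => //; exact: measurableD.
  by move=> z [Dz nZ]; apply: contrapT => nN; apply: nZ.
- move=> z [Dz nNz]; apply: contrapT => h; apply: nNz; apply: subN => /= h'.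
  by apply: h; exact: h'.
Qed.

Lemma Rintegral_null_diff {R : realType} d (V : measurableType d)
    (mu : {measure set V -> \bar R}) (D Z : set V) (f : V -> R) :
  measurable D -> measurable Z -> Z `<=` D -> mu (D `\` Z) = 0%E ->
  measurable_fun D f -> \int[mu]_(x in D) f x = \int[mu]_(x in Z) f x.
Proof.
move=> mD mZ ZD null mf; rewrite /Rintegral; congr fine.
have eZ : Z = D `&` Z by apply/esym/setIidr.
have mf' : measurable_fun D (EFin \o f) by exact/measurable_EFinP.
rewrite [in RHS]eZ [RHS]integral_mkcondr; apply: ae_eq_integral => //.
  by apply/measurable_restrict => //; rewrite -eZ; exact: measurable_funS mf'.
exists (D `\` Z); split=> //; first exact: measurableD.
move=> x /= nx; split; apply: contrapT => h; apply: nx => // Dx.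
by rewrite patchE mem_set//; exact: contrapT.
Qed.

Section measurability.
Context {R : realType} {d : measure_display} {V : measurableType d}.

(** Extend the integrand by 0 outside the product and apply Tonelli's measurability to its positive
    and negative parts separately. *)
Lemma measurable_Rintegral d' (U : measurableType d') (D : set V) (Z : set U)
    (nu : {finite_measure set U -> \bar R}) (f : V -> U -> R) :
  measurable D -> measurable Z ->
  measurable_fun (D `*` Z) (fun q => f q.1 q.2) ->
  measurable_fun D (fun v => \int[nu]_(z in Z) f v z).
Proof.
move=> mD mZ mf; have mDZ : measurable (D `*` Z) by exact: measurableX.
pose h : V * U -> \bar R := (EFin \o (fun q => f q.1 q.2)) \_ (D `*` Z).
have mh : measurable_fun setT h.
  by apply/(measurable_restrictT _ mDZ)/measurable_EFinP.
pose I v : \bar R := (fubini_F nu h^\+ v - fubini_F nu h^\- v)%E.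
apply: (@eq_measurable_fun _ _ _ _ _ (fine \o I)) => [v|].
  rewrite inE => Dv; rewrite /= /Rintegral [in RHS]integral_mkcond integralE.
  congr (fine (_ - _)%E); apply: eq_integral => z _.
    by rewrite !funeposE /h !patchE in_setX mem_set.
  by rewrite !funenegE /h !patchE in_setX mem_set.
apply: measurableT_comp; first exact: fine_measurable.
apply: measurable_funTS; apply: emeasurable_funB.
  apply: measurable_fun_fubini_tonelli_F => [|q]; first exact: measurable_funepos.
  exact: funepos_ge0.
apply: measurable_fun_fubini_tonelli_F => [|q]; first exact: measurable_funeneg.
exact: funeneg_ge0.
Qed.

Lemma measurable_fine_limn_esup (D : set V) (f : nat -> V -> R) :
  measurable D -> (forall k, measurable_fun D (f k)) ->
  measurable_fun D (fun v => fine (limn_esup (fun k => (f k v)%:E))).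
Proof.
move=> mD mf; apply: measurableT_comp; first exact: fine_measurable.
by apply: measurable_fun_limn_esup => k; exact/measurable_EFinP.
Qed.

(* [x] is rounded to multiples of [1/(k+1)]: the composite with [g] then takes
   countably many values. *)
Lemma measurable_nonexpansive n (D : set V) (x : V -> 'cV[R]_n) (g : 'cV[R]_n -> R) :
  measurable D -> (forall i, measurable_fun D (fun v => x v i 0)) ->
  (forall y z, `|g y - g z| <= enorm (y - z)) ->
  measurable_fun D (fun v => g (x v)).
Proof.
move=> mD mx g1.
pose q (k : nat) v : 'cV[R]_n :=
  \col_i ((Num.floor (k.+1%:R * x v i 0))%:~R / k.+1%:R).
have k0 k : 0 < k.+1%:R :> R by rewrite ltr0n.
have mq k : measurable_fun D (fun v => g (q k v)).
  move=> _ B mB.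
  pose A (z : 'cV[int]_n) := if g (\col_i ((z i 0)%:~R / k.+1%:R)) \in B
    then D `&` \bigcap_i (D `&` [set v | Num.floor (k.+1%:R * x v i 0) = z i 0])
    else set0.
  have -> : D `&` (fun v => g (q k v)) @^-1` B = \bigcup_z A z.
    apply/seteqP; split=> [v [Dv /= gB]|v [z _]].
      exists (\col_i Num.floor (k.+1%:R * x v i 0)) => //; rewrite /A.
      rewrite (_ : (\col_i _) = q k v) ?mem_set//.
        by split=> // i _; split=> //=; rewrite mxE.
      by apply/colP => i; rewrite !mxE.
    rewrite /A; case: ifPn => // gB [Dv Fv]; split=> //=.
    suff -> : q k v = \col_i ((z i 0)%:~R / k.+1%:R) by exact: set_mem.
    by apply/colP => i; rewrite !mxE; case: (Fv i I) => _ /= ->.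
  apply: countable_bigcupT_measurable => // z.
  rewrite /A; case: ifP => // _; apply: measurableI => //.
  apply: fin_bigcap_measurable => // i _.
  rewrite (_ : [set v | _] = (fun v => x v i 0) @^-1`
      `[(z i 0)%:~R / k.+1%:R, (z i 0 + 1)%:~R / k.+1%:R[).
    by apply: mx => //; exact: measurable_itv.
  apply/seteqP; split=> v /=; rewrite in_itv/= ler_pdivrMr// ltr_pdivlMr// (mulrC (x v i 0)).
    by move=> /eqP; rewrite floor_eq.
  by rewrite -floor_eq => /eqP.
apply: (measurable_fun_cvg mq) => v Dv.
apply/cvgrPdist_le => e e0.
have [k0' _ k0'P] := near_infty_natSinv_lt (PosNum (divr_gt0 e0 (ltr_pwDr ltr01 (ler0n R n)))).
exists k0' => // k /k0'P /= kn; apply: le_trans (g1 _ _) _.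
rewrite -enorm_le; last exact: ltW.
apply: (@le_trans _ _ (n%:R * (k.+1%:R^-1) ^+ 2)).
  apply: enormsq_le => i; rewrite !mxE.
  have /andP[] := real_floor_itv (num_real (k.+1%:R * x v i 0)).
  rewrite intrD -ler_pdivrMl// -ltr_pdivlMl// mulrDr mulr1 mulrC => h1 h2.
  by rewrite ger0_norm ?subr_ge0// lerBlDr addrC ltW// mulrC.
rewrite ltr_pdivlMr in kn; last exact: ltr_pwDr ltr01 (ler0n R n).
have i0 : 0 <= k.+1%:R^-1 :> R by rewrite invr_ge0.
have n0 : 0 <= n%:R :> R by [].
set y := k.+1%:R^-1 in kn i0 *; set m : R := n%:R in kn n0 *.
have : (y * (m + 1)) ^+ 2 <= e ^+ 2.
  rewrite /= in kn; have ym : 0 <= y * (m + 1) by rewrite mulr_ge0// addr_ge0.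
  by rewrite ler_pXn2r ?nnegrE ?(ltW e0)// ltW.
by apply: le_trans; rewrite exprMn mulrC ler_wpM2l ?sqr_ge0//; nra.
Qed.

End measurability.

Section measurability_of_iterates.
Context {R : realType} {d d' : measure_display} {V : measurableType d}.
Context {U : measurableType d'} (nu : {finite_measure set U -> \bar R}).
Context (X : set V) (Z : set U) (m1 m2 : nat).
Local Notation n := (m1 + m2)%N.
Context (M : V -> 'M[R]_n) (D b : V -> 'cV[R]_n) (p : V -> R).
Context (F : V -> U -> 'cV[R]_n) (E a c : V -> U -> R).
Hypotheses (mX : measurable X) (mZ : measurable Z).
Hypothesis mM : forall i j, measurable_fun X (fun v => M v i j).
Hypothesis mD : forall i, measurable_fun X (fun v => D v i 0).
Hypothesis mb : forall i, measurable_fun X (fun v => b v i 0).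
Hypothesis mp : measurable_fun X p.
Hypothesis mF : forall i, measurable_fun (X `*` Z) (fun q => F q.1 q.2 i 0).
Hypothesis mE : measurable_fun (X `*` Z) (fun q => E q.1 q.2).
Hypothesis ma : measurable_fun (X `*` Z) (fun q => a q.1 q.2).
Hypothesis mc : measurable_fun (X `*` Z) (fun q => c q.1 q.2).

Lemma flipE (v : 'cV[R]_n) i :
  flip v i 0 = if (i < m1)%N then v i 0 else - v i 0.
Proof.
rewrite /flip; case: (split_ordP i) => j ->.
  by rewrite col_mxEu mxE.
by rewrite col_mxEd !mxE.
Qed.

Lemma measurable_cylinder_fst (f : V -> R) : measurable_fun X f ->
  measurable_fun (X `*` Z) (fun q => f q.1).
Proof.
move=> mf _ B mB.
rewrite (_ : _ `&` _ = (X `&` f @^-1` B) `*` Z); first by apply: measurableX => //; exact: mf.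
by apply/seteqP; split=> -[v z] /= [[? ?] ?].
Qed.

Lemma measurable_ham_grad (x : V -> 'cV[R]_n) i :
  (forall j, measurable_fun X (fun v => x v j 0)) ->
  measurable_fun X (fun v => ham_grad nu Z (M v) (D v) (b v) (p v)
                     (F v) (E v) (a v) (c v) (x v) i 0).
Proof.
move=> mx; under eq_fun do rewrite !mxE.
have mdot : measurable_fun (X `*` Z) (fun q => dot (F q.1 q.2) (x q.1)).
  apply: measurable_sum => j; apply: measurable_funM => //.
  exact: (measurable_cylinder_fst (mx j)).
have mmax (f : V * U -> R) : measurable_fun (X `*` Z) f ->
    measurable_fun (X `*` Z) (fun q => pospart (f q)).
  by move=> mf; apply: measurable_maxr => //; exact: measurable_cst.
have mmin (f : V * U -> R) : measurable_fun (X `*` Z) f ->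
    measurable_fun (X `*` Z) (fun q => negpart (f q)).
  by move=> mf; apply: measurable_maxr; [exact: measurableT_comp|exact: measurable_cst].
have m1E : measurable_fun (X `*` Z) (fun q => 1 + E q.1 q.2 + dot (F q.1 q.2) (x q.1)).
  by apply: measurable_funD => //; apply: measurable_funD.
apply: measurable_funD; last first.
  apply: (@measurable_Rintegral _ _ _ _ U X Z nu
    (fun v z => jump_slope (p v) (E v) (a v) (c v) z (dot (F v z) (x v)) * F v z i 0)) => //.
  apply: measurable_funM => //; apply: measurable_funB; first apply: measurable_funB.
  - by apply: measurable_funM; [exact: measurable_funM|exact: mmax].
  - by apply: measurable_funM; [exact: measurable_funM|exact: mmin].
  - apply: measurable_funM => //; exact: measurable_cylinder_fst.
apply: measurable_funD; last exact: measurable_funM.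
apply: measurable_funD.
  apply: measurable_funM => //; apply: measurable_sum => j.
  exact: measurable_funM.
apply: measurable_funM => //; apply: measurable_funM; first exact: measurable_funM.
by apply: measurable_sum => j; exact: measurable_funM.
Qed.

Context (Pi1 : set 'cV[R]_m1) (Pi2 : set 'cV[R]_m2).
Hypotheses (cone1 : closed_convex_cone Pi1) (cone2 : closed_convex_cone Pi2).

(** Each coordinate of the projection is 1-Lipschitz for the Euclidean norm, so
    [measurable_nonexpansive] carries measurability through it; the flip only changes signs of
    entries. *)
Lemma measurable_proj_iter (tau : R) k i :
  measurable_fun X (fun v => proj_iter (cone_prod Pi1 Pi2)
    (saddle_op nu Z (M v) (D v) (b v) (p v) (F v) (E v) (a v) (c v)) tau k i 0).
Proof.
elim: k i => [|k IH] i; first by under eq_fun do rewrite mxE; exact: measurable_cst.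
rewrite /proj_iter; under eq_fun do rewrite iterS.
pose y v := proj_iter (cone_prod Pi1 Pi2)
  (saddle_op nu Z (M v) (D v) (b v) (p v) (F v) (E v) (a v) (c v)) tau k.
pose y' v := y v - tau *: saddle_op nu Z (M v) (D v) (b v) (p v) (F v) (E v) (a v) (c v) (y v).
have my' j : measurable_fun X (fun v => y' v j 0).
  pose G v := ham_grad nu Z (M v) (D v) (b v) (p v) (F v) (E v) (a v) (c v) (y v).
  rewrite (_ : (fun v => y' v j 0) =
    (fun v => y v j 0 - tau * (if (j < m1)%N then G v j 0 else - G v j 0))).
    apply: measurable_funB; first exact: IH.
    apply: measurable_funM => //; case: (j < m1)%N; first exact: measurable_ham_grad.
    by apply: measurableT_comp => //; exact: measurable_ham_grad.
  have entry (u w : 'cV[R]_n) : (u - tau *: w) j 0 = u j 0 - tau * w j 0.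
    by rewrite !mxE.
  by apply/funext => v; rewrite -flipE; exact: entry.
have lip1 (u v : 'cV[R]_n) :
  `|metric_proj (cone_prod Pi1 Pi2) u i 0 - metric_proj (cone_prod Pi1 Pi2) v i 0| <= enorm (u - v).
  have nonexp := proj_nonexpansive (ex_intro _ 0 (cone_prod0 cone1 cone2))
    (cone_prod_closed cone1 cone2) (cone_prod_convex cone1 cone2) u v.
  by apply: le_trans nonexp; apply: le_trans (ler_abs_enorm _ i); rewrite !mxE.
exact: (measurable_nonexpansive mX my' lip1).
Qed.

End measurability_of_iterates.

(** * From the coefficients to the Hamiltonian *)

Section stacked_data.
Context {R : realType}.

Lemma bilE m n (v : 'cV[R]_m) (A : 'M[R]_(m, n)) w : bil v A w = dot v (A *m w).
Proof. by rewrite /bil -mulmxA dotE. Qed.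

Lemma mulmx_outer m n (x : 'cV[R]_m) (y w : 'cV[R]_n) :
  (x *m y^T) *m w = dot y w *: x.
Proof. by apply/colP => i; rewrite -mulmxA !mxE big_ord1 dotE mulrC. Qed.

Lemma bil_Mmx m (v D : 'cV[R]_m) (A : 'M[R]_m) p :
  bil v (Mmx A D p) v = dot v (A *m v) + p * dot D v ^+ 2.
Proof.
by rewrite bilE /Mmx mulmxDl -scalemxAl mulmx_outer dotDr !dotZr (dotC v D) expr2.
Qed.

Context {d : measure_display} {Omega : measurableType d}.
Context {d' : measure_display} {U : measurableType d'} (m1 m2 : nat).
Context (U0 : set U) (nu : {finite_measure set U -> \bar R}).
Context (co : coefficients R Omega U m1 m2) (t : R) (w : Omega).

(** The rank-one part of [Mmx] is left out: [ham] carries it as [p * dot D v ^+ 2], with [D] the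
    stacked vector, which also accounts for the mixed term in [D1] and [D2]. *)
Definition stack_M : 'M[R]_(m1 + m2) :=
  block_mx (cR11 co t w) (cR12 co t w) (cR12 co t w)^T (cR22 co t w).
Definition stack_D : 'cV[R]_(m1 + m2) := col_mx (cD1 co t w) (cD2 co t w).
Definition stack_F (z : U) : 'cV[R]_(m1 + m2) := col_mx (cF1 co t w z) (cF2 co t w z).
Definition stack_b (p l : R) : 'cV[R]_(m1 + m2) :=
  p *: col_mx (cB1 co t w) (cB2 co t w) + (p * cC co t w + l) *: stack_D.

Lemma H1E p1 p2 l g1 g2 v1 v2 :
  H1 U0 nu co t w p1 p2 l g1 g2 v1 v2 =
  ham nu U0 stack_M stack_D (stack_b p1 l) p1 stack_F (cE co t w)
    (fun z => p1 + g1 z) (fun z => p2 + g2 z) (col_mx v1 v2).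
Proof.
rewrite /H1 /ham; congr (_ + _); last first.
  by apply: eq_Rintegral => z _; rewrite /jump_cost /stack_F dot_col_mx !dotE.
have NrowE m (B D x : 'cV[R]_m) p :
    (Nrow B D (cC co t w) p l *m x) 0 0 = p * dot B x + (p * cC co t w + l) * dot D x.
  have D00 (A A' : 'M[R]_1) : (A + A') 0 0 = A 0 0 + A' 0 0 by rewrite mxE.
  have Z00 k (A : 'M[R]_1) : (k *: A) 0 0 = k * A 0 0 by rewrite mxE.
  by rewrite /Nrow !mulmxDl -!scalemxAl !D00 !Z00 !dotE mulrDl addrA.
rewrite !bil_Mmx !bilE !NrowE /stack_M /stack_b /stack_D mul_block_col !dot_col_mx.
rewrite mulmxDl -scalemxAl mulmx_outer !dotDr !dotZr !dotDl !dotZl !dot_col_mx.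
have -> : dot v2 ((cR12 co t w)^T *m v1) = dot v1 (cR12 co t w *m v2).
  by rewrite dotC -!dotE trmx_mul trmxK mulmxA.
rewrite (dotC v1 (cD1 co t w)).
ring.
Qed.

Lemma H2E p1 p2 l g1 g2 v1 v2 :
  H2 U0 nu co t w p1 p2 l g1 g2 v1 v2 = H1 U0 nu co t w p2 p1 l g2 g1 (- v1) (- v2).
Proof.
have bilNN m n (x : 'cV[R]_m) (A : 'M[R]_(m, n)) y : bil (- x) A (- y) = bil x A y.
  by rewrite !bilE mulmxN dotNr dotNl opprK.
have NmulN m (A : 'rV[R]_m) (y : 'cV[R]_m) : (A *m - y) 0 0 = - (A *m y) 0 0.
  by rewrite mulmxN mxE.
rewrite /H2 /H1 !bilNN !NmulN !mulrN; congr (_ + _).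
apply: eq_Rintegral => z _; rewrite !NmulN.
set x := (_ *m v1) 0 0; set y := (_ *m v2) 0 0; set e := cE co t w z.
have -> : negpart (- 1 - e + (x + y)) = pospart (1 + e + (- x - y)).
  by rewrite /negpart /pospart; congr (Num.max _ _); ring.
have -> : negpart (1 + e + (- x - y)) = pospart (- 1 - e + (x + y)).
  by rewrite /negpart /pospart; congr (Num.max _ _); ring.
ring.
Qed.

End stacked_data.

(** * Opposite cones and opposite controls *)

Section reflection.
Context {R : realType}.

Definition oppset m (Pi : set 'cV[R]_m) : set 'cV[R]_m := [set v | Pi (- v)].

Lemma oppset_cone m (Pi : set 'cV[R]_m) :
  closed_convex_cone Pi -> closed_convex_cone (oppset Pi).
Proof.
case=> [[v Piv] clPi cvPi scPi]; split.
- by exists (- v); rewrite /oppset/= opprK.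
- by apply: (closed_comp _ clPi) => x _; exact: continuousN.
- move=> x y l xPi yPi; have := cvPi (- x) (- y) l.
  rewrite !inE in xPi yPi *; move=> /(_ xPi yPi); rewrite /oppset/=.
  by congr Pi; rewrite /conv/= !scalerN -opprD.
- by move=> a u a0 Piu; rewrite /oppset/= -scalerN; exact: scPi.
Qed.

Context (m n : nat) (Pi1 : set 'cV[R]_m) (Pi2 : set 'cV[R]_n).

Lemma saddle_point_opp H th1 th2 :
  saddle_point (oppset Pi1) (oppset Pi2) H th1 th2 <->
  saddle_point Pi1 Pi2 (fun v1 v2 => H (- v1) (- v2)) (- th1) (- th2).
Proof.
split=> -[P1 P2 sad]; split=> // v1 v2 Pv1 Pv2.
  by have := sad (- v1) (- v2); rewrite !opprK; apply; rewrite /oppset/= opprK.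
by have := sad (- v1) (- v2) Pv1 Pv2; rewrite !opprK.
Qed.

Lemma supinf_opp H : supinf (oppset Pi1) (oppset Pi2) H =
  supinf Pi1 Pi2 (fun v1 v2 => H (- v1) (- v2)).
Proof.
congr ereal_sup; apply/seteqP; split=> _ [v2 /= Pv2 <-]; exists (- v2);
  rewrite /oppset/= ?opprK//; congr ereal_inf; apply/seteqP;
  by split=> _ [v1 /= Pv1 <-]; exists (- v1); rewrite /oppset/= ?opprK.
Qed.

End reflection.

Section pointwise_game.
Context {R : realType}.

Lemma enorm_le_entries n (v : 'cV[R]_n) (c : R) : 0 <= c ->
  (forall i, `|v i 0| <= c) -> enorm v <= n%:R * c.
Proof.
move=> c0 vc; rewrite -enorm_le ?mulr_ge0//.
apply: (le_trans (enormsq_le vc)); rewrite exprMn ler_wpM2r ?sqr_ge0//.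
by rewrite -natrX ler_nat; case: n {v vc} => // n; rewrite leq_pmulr.
Qed.

(** [ham_growth] has degree two in [(be, e)] jointly, and [x >= 1] absorbs the lower-order terms.
    With [x = 1 + la] this gives the quadratic growth of the value. *)
Lemma ham_growth_scale m1 m2 (K kappa nuZ be e x : R) : 0 <= K -> 0 <= kappa ->
  0 <= nuZ -> 0 <= be -> 0 <= e -> 1 <= x ->
  ham_growth m1 m2 K kappa nuZ (be * x) (e * x) <=
  ham_growth m1 m2 K kappa nuZ be e * x ^+ 2.
Proof.
move=> K0 k0 n0 be0 e0 x1; rewrite /ham_growth.
set y := _ * (kappa * e); have -> : (m1 + m2)%:R * (kappa * (e * x)) = y * x by rewrite /y; ring.
have y0 : 0 <= y by rewrite /y !mulr_ge0.
set m := (m1 + m2)%:R in y y0 *; have x0 : 0 <= x := le_trans ler01 x1.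
have h1 : (1 + kappa + y * x) ^+ 2 <= ((1 + kappa + y) * x) ^+ 2.
  rewrite ler_pXn2r// ?nnegrE ?addr_ge0 ?mulr_ge0 ?addr_ge0//.
  by rewrite (mulrDl (1 + kappa)) lerD2r ler_peMr// addr_ge0.
have x2 : 1 <= x ^+ 2 by rewrite exprn_ege1.
have h2 : kappa + y * x <= (kappa + y) * x ^+ 2.
  rewrite mulrDl lerD//; first by rewrite ler_peMr.
  by rewrite ler_wpM2l// expr2 ler_peMr.
have h3 : K * ((1 + kappa + y * x) ^+ 2 *+ 2 + 1) <=
    K * ((1 + kappa + y) ^+ 2 *+ 2 + 1) * x ^+ 2.
  rewrite -mulrA ler_wpM2l// mulrDl mul1r lerD// -mulrnAl.
  by move: h1; rewrite exprMn; lra.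
have h4 : 2 * K * (kappa + y * x) <= 2 * K * (kappa + y) * x ^+ 2.
  by rewrite -(mulrA (2 * K)) ler_wpM2l// mulr_ge0.
have h5 := ler_wpM2r n0 (lerD h3 h4).
rewrite (mulrDl _ _ (x ^+ 2)); apply: lerD.
  by rewrite le_eqVlt; apply/orP; left; apply/eqP; rewrite /y; ring.
by apply: le_trans h5 _; rewrite le_eqVlt; apply/orP; left; apply/eqP; ring.
Qed.

Context {d : measure_display} {U : measurableType d}.
Context (nu : {finite_measure set U -> \bar R}) (U0 : set U) (m1 m2 : nat).
Local Notation n := (m1 + m2)%N.
Context (K kappa beta dlow dbar : R).
Context (Pi1 : set 'cV[R]_m1) (Pi2 : set 'cV[R]_m2).
Hypotheses (mU0 : measurable U0) (kappa0 : 0 <= kappa) (beta0 : 0 <= beta).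
Hypotheses (dlow0 : 0 < dlow) (dbar0 : 0 < dbar).
Hypotheses (cone1 : closed_convex_cone Pi1) (cone2 : closed_convex_cone Pi2).

Let nu0 : R := fine (nu U0).

(** The factor of [saddle_pt_bound] times the bound of [ham_grad0_le] at [be = beta], the dimension
    accounting for the passage from entries to the norm. *)
Definition saddle_growth : R :=
  step m1 m2 K kappa nu0 dlow dbar / (1 - rate m1 m2 K kappa nu0 dlow dbar) *
  (n%:R * (2 * beta + (2 * K * (1 + kappa) *+ 2 + 2 * K) * kappa * nu0)).

(** The first summand serves the saddle point, the second the value. *)
Definition game_growth : R :=
  saddle_growth + ham_growth m1 m2 K kappa nu0 beta saddle_growth.

Context (M : 'M[R]_n) (D b : 'cV[R]_n) (p la : R).
Context (F : U -> 'cV[R]_n) (E a c : U -> R).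

Record game_hypotheses : Prop := {
  game_sym : M^T = M ;
  game_mE : measurable_fun U0 E ;
  game_ma : measurable_fun U0 a ;
  game_mc : measurable_fun U0 c ;
  game_mF : forall i, measurable_fun U0 (fun z => F z i 0) ;
  game_E : {ae nu, forall z, U0 z -> `|E z| <= kappa} ;
  game_a : {ae nu, forall z, U0 z -> 0 <= a z <= K} ;
  game_c : {ae nu, forall z, U0 z -> 0 <= c z <= K} ;
  game_F : {ae nu, forall z, U0 z -> forall i, `|F z i 0| <= kappa} ;
  game_p : 0 <= p <= K ;
  game_D : forall i, `|D i 0| <= kappa ;
  game_M : forall i j, `|M i j| <= kappa ;
  game_b : forall i, `|b i 0| <= beta * (1 + la) ;
  game_la : 0 <= la ;
  game_low : forall u : 'cV[R]_m1,
    dlow * enormsq u <= dot (col_mx u 0) (M *m col_mx u 0) ;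
  game_upp : forall u : 'cV[R]_m2,
    dot (col_mx 0 u) (M *m col_mx 0 u) +
    K * (dot D (col_mx 0 u) ^+ 2 + \int[nu]_(z in U0) dot (F z) (col_mx 0 u) ^+ 2)
    <= - dbar * enormsq u }.

Theorem game_solution (s := saddle_pt nu U0 M D b p F E a c K kappa nu0 dlow dbar Pi1 Pi2)
    (H := fun v1 v2 => ham nu U0 M D b p F E a c (col_mx v1 v2)) :
  game_hypotheses ->
  [/\ proj_iter (cone_prod Pi1 Pi2) (saddle_op nu U0 M D b p F E a c)
        (step m1 m2 K kappa nu0 dlow dbar) k @[k --> \oo] --> s,
      saddle_point Pi1 Pi2 H (usubmx s) (dsubmx s),
      forall v1 v2, saddle_point Pi1 Pi2 H v1 v2 -> v1 = usubmx s /\ v2 = dsubmx s,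
      (`|supinf Pi1 Pi2 H| <= (game_growth * (1 + la) ^+ 2)%:E)%E &
      enorm s <= game_growth * (1 + la)].
Proof.
case=> symM mE ma mc mF Ele aitv citv Fle p_itv Dle Mle ble la0 low upp.
(* The previous section asks for bounds at every mark; they hold at every mark of [Z], and replacing
   [U0] by [Z] changes neither the Hamiltonian nor the operator. *)
have [Z [mZ ZU null Zok]] : exists Z, [/\ measurable Z, Z `<=` U0, nu (U0 `\` Z) = 0%E &
    forall z, Z z -> [/\ `|E z| <= kappa, 0 <= a z <= K, 0 <= c z <= K &
      forall i, `|F z i 0| <= kappa]].
  apply: ae_null_diff => //; apply: filterS (filterI (filterI Ele aitv) (filterI citv Fle)).
  by move=> z [[h1 h2] [h3 h4]] Uz; split; auto.
(* The constants are formed with the mass of [U0], so that they do not depend on [Z], which varies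
   with the point. *)
have muZ : fine (nu Z) <= nu0.
  by rewrite /nu0 fine_le ?fin_num_measure//; apply: le_measure; rewrite ?inE.
have toZ (f : U -> R) : measurable_fun U0 f ->
    \int[nu]_(z in U0) f z = \int[nu]_(z in Z) f z.
  exact: Rintegral_null_diff.
have mdotF v : measurable_fun U0 (fun z => dot (F z) v).
  by apply: measurable_sum => j; exact: measurable_funM.
have mpos (f : U -> R) : measurable_fun U0 f -> measurable_fun U0 (fun z => pospart (f z)).
  by move=> mf; apply: measurable_maxr => //; exact: measurable_cst.
have mneg (f : U -> R) : measurable_fun U0 f -> measurable_fun U0 (fun z => negpart (f z)).
  by move=> mf; apply: mpos; exact: measurableT_comp.
have m1E v : measurable_fun U0 (fun z => 1 + E z + dot (F z) v).
  by apply: measurable_funD => //; apply: measurable_funD.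
have hamZ : ham nu U0 M D b p F E a c = ham nu Z M D b p F E a c.
  apply/funext => v; rewrite /ham toZ//; apply: measurable_funD.
    apply: measurable_funB.
      apply: measurable_funM => //; apply: measurable_funB => //.
      by apply: measurable_funX; exact: mpos.
    by apply: measurable_funM => //; exact: measurable_funD.
  by apply: measurable_funM => //; apply: measurable_funX; exact: mneg.
have gradZ : ham_grad nu U0 M D b p F E a c = ham_grad nu Z M D b p F E a c.
  apply/funext => v; rewrite /ham_grad; congr (_ + _); apply/colP => i.
  rewrite !mxE toZ//; apply: measurable_funM => //.
  apply: measurable_funB => //; apply: measurable_funB.
    by apply: measurable_funM; [exact: measurable_funM|exact: mpos].
  by apply: measurable_funM; [exact: measurable_funM|exact: mneg].
have opZ : saddle_op nu U0 M D b p F E a c = saddle_op nu Z M D b p F E a c.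
  by rewrite /saddle_op gradZ.
have sZ : s = saddle_pt nu Z M D b p F E a c K kappa nu0 dlow dbar Pi1 Pi2.
  by rewrite /s /saddle_pt opZ.
have mEZ := measurable_funS mU0 ZU mE; have maZ := measurable_funS mU0 ZU ma.
have mcZ := measurable_funS mU0 ZU mc.
have mFZ i := measurable_funS mU0 ZU (mF i).
have EZ z (h : Z z) : `|E z| <= kappa by case: (Zok z h).
have aZ z (h : Z z) : 0 <= a z <= K by case: (Zok z h).
have cZ z (h : Z z) : 0 <= c z <= K by case: (Zok z h).
have FZ z (h : Z z) i : `|F z i 0| <= kappa by case: (Zok z h).
have uppZ (u : 'cV[R]_m2) : dot (col_mx 0 u) (M *m col_mx 0 u) +
    K * (dot D (col_mx 0 u) ^+ 2 + \int[nu]_(z in Z) dot (F z) (col_mx 0 u) ^+ 2)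
    <= - dbar * enormsq u.
  by rewrite -toZ; [exact: upp|exact: measurable_funX].
have K0 : 0 <= K by case/andP: p_itv; exact: le_trans.
have nu00 : 0 <= nu0 by exact: fine_ge0.
have x1 : 1 <= 1 + la by rewrite lerDl.
have x0 : 0 <= 1 + la := le_trans ler01 x1.
have rate1 : rate m1 m2 K kappa nu0 dlow dbar < 1.
  by case/andP: (rate_itv m1 m2 p_itv kappa0 muZ dlow0 dbar0).
have step0 : 0 < step m1 m2 K kappa nu0 dlow dbar.
  exact: (step_gt0 m1 m2 p_itv kappa0 muZ dlow0 dbar0).
have [c0 c0E] : exists c0, c0 = (2 * K * (1 + kappa) *+ 2 + 2 * K) * kappa * nu0 by eexists.
have c00 : 0 <= c0 by rewrite c0E mulr2n !(mulr_ge0, addr_ge0).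
have [q qE] : exists q, q = step m1 m2 K kappa nu0 dlow dbar /
    (1 - rate m1 m2 K kappa nu0 dlow dbar) by eexists.
have q0 : 0 <= q by rewrite qE; apply: divr_ge0; [exact: ltW|rewrite subr_ge0; exact: ltW].
have sgE : saddle_growth = q * (n%:R * (2 * beta + c0)).
  by rewrite qE c0E.
have grad0 i : `|ham_grad nu Z M D b p F E a c 0 i 0| <= (2 * beta + c0) * (1 + la).
  apply: le_trans (ham_grad0_le M D mZ mEZ maZ mcZ mFZ EZ aZ cZ FZ p_itv kappa0
    muZ ble i) _.
  by rewrite -c0E (mulrDl (2 * beta)) mulrA lerD2l ler_peMr.
have h := saddle_pt_bound b mZ symM mEZ maZ mcZ mFZ EZ aZ cZ FZ p_itv
  kappa0 muZ Dle Mle dlow0 dbar0 low uppZ cone1 cone2.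
rewrite -sZ -qE in h.
have g0 : 0 <= 2 * beta + c0 by exact: (addr_ge0 (mulr_ge0 (ler0n R 2) beta0) c00).
have sbound : enorm s <= saddle_growth * (1 + la).
  apply: (le_trans h); rewrite sgE -2!mulrA; apply: (ler_wpM2l q0).
  exact: (enorm_le_entries (mulr_ge0 g0 x0) grad0).
have sg0 : 0 <= saddle_growth.
  by rewrite sgE; exact: (mulr_ge0 q0 (mulr_ge0 (ler0n R n) g0)).
have hg0 : 0 <= ham_growth m1 m2 K kappa nu0 beta saddle_growth.
  by rewrite /ham_growth mulr2n; move: (saddle_growth) sg0 => g sg0;
    rewrite !(addr_ge0, mulr_ge0, sqr_ge0).
split.
- rewrite sZ opZ; exact: (saddle_pt_cvg mZ symM mEZ maZ mcZ mFZ EZ aZ cZ FZ p_itv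
    kappa0 muZ Dle Mle dlow0 dbar0 low uppZ cone1 cone2).
- rewrite sZ /H hamZ; exact: (saddle_pt_saddle b mZ symM mEZ maZ mcZ mFZ EZ aZ cZ FZ p_itv
    kappa0 muZ Dle Mle dlow0 dbar0 low uppZ cone1 cone2).
- rewrite sZ /H hamZ; exact: (saddle_pt_unique mZ symM mEZ maZ mcZ mFZ EZ aZ cZ FZ p_itv
    kappa0 muZ Dle Mle dlow0 dbar0 low uppZ cone1 cone2).
- have -> : supinf Pi1 Pi2 H = (ham nu Z M D b p F E a c s)%:E.
    rewrite sZ /H hamZ; exact: (supinf_saddle_pt b mZ symM mEZ maZ mcZ mFZ EZ aZ cZ FZ p_itv
    kappa0 muZ Dle Mle dlow0 dbar0 low uppZ cone1 cone2).
  rewrite lee_fin; apply: le_trans (ham_le mZ mEZ maZ mcZ mFZ EZ aZ cZ FZ p_itv kappa0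
    muZ Dle Mle ble (fun i => le_trans (ler_abs_enorm s i) sbound) _ _) _.
  + by rewrite mulr_ge0.
  + by rewrite mulr_ge0.
  apply: le_trans (ham_growth_scale _ _ K0 kappa0 nu00 beta0 sg0 x1) _.
  by apply: (ler_wpM2r (sqr_ge0 _)); rewrite /game_growth lerDr; exact: sg0.
- apply: (le_trans sbound); apply: (ler_wpM2r x0).
  by rewrite /game_growth lerDl; exact: hg0.
Qed.

End pointwise_game.

Section game_at_a_point.
Context {R : realType}.

Lemma mx_entry_le m n (A : 'M[R]_(m, n)) (c : R) i j : `|A| <= c -> `|A i j| <= c.
Proof.
apply: le_trans; rewrite [leRHS]mx_normrE.
exact: (le_bigmax _ (fun ij : 'I_m * 'I_n => `|A ij.1 ij.2|) (i, j)).
Qed.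

Context {d' : measure_display} {U : measurableType d'}.
Context (U0 : set U) (nu : {finite_measure set U -> \bar R}).
Hypothesis mU0 : measurable U0.

Lemma gram_quadratic m (F : U -> 'cV[R]_m) (kappa : R) (u : 'cV[R]_m) :
  (forall i, measurable_fun U0 (fun z => F z i 0)) ->
  {ae nu, forall z, U0 z -> forall i, `|F z i 0| <= kappa} ->
  dot u ((\matrix_(i, j) \int[nu]_(z in U0) (F z i 0 * F z j 0)) *m u) =
  \int[nu]_(z in U0) dot (F z) u ^+ 2.
Proof.
move=> mF /(ae_null_diff mU0)[Z [mZ ZU null FZ]].
have mdotF v : measurable_fun U0 (fun z => dot (F z) v).
  by apply: measurable_sum => j; exact: measurable_funM.
have mFZ i := measurable_funS mU0 ZU (mF i).
have bF i : bdmeas Z (fun z => F z i 0) by split=> //; exists kappa => z /FZ.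
have bdot : bdmeas Z (fun z => dot (F z) u).
  by apply: bdmeas_sum => i; apply: bdmeasM => //; exact: bdmeas_cst.
rewrite (@Rintegral_null_diff _ _ _ nu U0 Z)//; last exact: measurable_funX.
have int f := @dot_col_Rintegral _ _ _ nu Z 0 m F kappa mZ mFZ FZ f u.
rewrite dotC; transitivity (dot (\col_i \int[nu]_(z in Z) (dot (F z) u * F z i 0)) u).
  congr dot; apply/colP => i; rewrite !mxE.
  transitivity (dot (\col_j \int[nu]_(z in Z) (F z i 0 * F z j 0)) u).
    apply: eq_bigr => j _; rewrite !mxE (@Rintegral_null_diff _ _ _ nu U0 Z)//.
    exact: measurable_funM.
  by rewrite int//; apply: eq_Rintegral => z _; rewrite mulrC.
by rewrite int.
Qed.

Context {d : measure_display} {Omega : measurableType d} (m1 m2 : nat).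
Context (co : coefficients R Omega U m1 m2) (t : R) (w : Omega).
Context (cbar dlow dbar K kappa : R) (p p' l : R) (g g' : U -> R).

(** The entries of [stack_b] are at most [K * kappa], from [B], plus [(K * kappa + x) * kappa], from
    [D], where [x] is the absolute value of [l]; the sum is at most [drift_growth * (1 + x)]. *)
Definition drift_growth : R := K * kappa + (K * kappa + 1) * kappa.

Record data_at_point : Prop := {
  at_E : measurable_fun U0 (cE co t w) ;
  at_F1 : forall i, measurable_fun U0 (fun z => cF1 co t w z i 0) ;
  at_F2 : forall i, measurable_fun U0 (fun z => cF2 co t w z i 0) ;
  at_g : measurable_fun U0 g ;
  at_g' : measurable_fun U0 g' ;
  at_E_le : {ae nu, forall z, U0 z -> `|cE co t w z| <= kappa} ;
  at_F1_le : {ae nu, forall z, U0 z -> `|cF1 co t w z| <= kappa} ;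
  at_F2_le : {ae nu, forall z, U0 z -> `|cF2 co t w z| <= kappa} ;
  at_pg : {ae nu, forall z, U0 z -> 0 <= p + g z <= K} ;
  at_pg' : {ae nu, forall z, U0 z -> 0 <= p' + g' z <= K} ;
  at_p : 0 <= p <= K ;
  at_C : `|cC co t w| <= kappa ;
  at_B1 : `|cB1 co t w| <= kappa ;
  at_B2 : `|cB2 co t w| <= kappa ;
  at_D1 : `|cD1 co t w| <= kappa ;
  at_D2 : `|cD2 co t w| <= kappa ;
  at_R11 : `|cR11 co t w| <= kappa ;
  at_R22 : `|cR22 co t w| <= kappa ;
  at_R12 : `|cR12 co t w| <= kappa ;
  at_sym1 : (cR11 co t w)^T = cR11 co t w ;
  at_sym2 : (cR22 co t w)^T = cR22 co t w ;
  at_low : loewner_le dlow%:M (cR11 co t w) ;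
  at_upp : loewner_le (cR22 co t w) (- (dbar + K * cbar))%:M ;
  at_gram : loewner_le (diffusion_gram U0 nu (cD2 co t w) (cF2 co t w)) cbar%:M }.

Lemma data_game_hypotheses : data_at_point -> 0 <= kappa ->
  game_hypotheses nu U0 K kappa drift_growth dlow dbar (stack_M co t w) (stack_D co t w)
    (stack_b co t w p l) p `|l| (stack_F co t w) (cE co t w)
    (fun z => p + g z) (fun z => p' + g' z).
Proof.
case=> mE mF1 mF2 mg mg' E_le F1_le F2_le pg pg' p_itv C_le B1_le B2_le D1_le D2_le
  R11_le R22_le R12_le sym1 sym2 low upp gram kappa0.
have K0 : 0 <= K by case/andP: p_itv; exact: le_trans.
have col_le (x1 : 'cV[R]_m1) (x2 : 'cV[R]_m2) i : `|x1| <= kappa -> `|x2| <= kappa ->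
    `|col_mx x1 x2 i 0| <= kappa.
  move=> h1 h2; case: (split_ordP i) => j ->; rewrite ?col_mxEu ?col_mxEd;
  exact: mx_entry_le.
have scal_le m (u : 'cV[R]_m) (x : R) : dot u (x%:M *m u) = x * enormsq u.
  by rewrite mul_scalar_mx dotZr enormsqE.
split=> //.
- by rewrite /stack_M tr_block_mx sym1 sym2 trmxK.
- by apply: measurable_funD => //; exact: measurable_cst.
- by apply: measurable_funD => //; exact: measurable_cst.
- move=> i; case: (split_ordP i) => j ->; rewrite /stack_F.
    by rewrite (_ : (fun z => _) = (fun z => cF1 co t w z j 0))//; apply/funext => z; rewrite col_mxEu.
  by rewrite (_ : (fun z => _) = (fun z => cF2 co t w z j 0))//; apply/funext => z; rewrite col_mxEd.
- apply: filterS2 F1_le F2_le => z h1 h2 Uz i; apply: col_le; [exact: h1|exact: h2].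
- by move=> i; exact: col_le.
- move=> i j; rewrite /stack_M; case: (split_ordP i) => i' ->; case: (split_ordP j) => j' ->;
  rewrite ?block_mxEul ?block_mxEur ?block_mxEdl ?block_mxEdr ?mxE; exact: mx_entry_le.
- move=> i; have Bi := col_le _ _ i B1_le B2_le; have Di := col_le _ _ i D1_le D2_le.
  have -> : stack_b co t w p l i 0 = p * col_mx (cB1 co t w) (cB2 co t w) i 0
      + (p * cC co t w + l) * stack_D co t w i 0 by rewrite !mxE.
  rewrite -/(stack_D co t w) in Di; case/andP: p_itv => p0 pK.
  apply: le_trans (ler_normD _ _) _; rewrite !normrM (ger0_norm p0) /drift_growth.
  have h1 : `|p * cC co t w + l| <= K * kappa + `|l|.
    apply: le_trans (ler_normD _ _) _; rewrite lerD2r normrM (ger0_norm p0).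
    exact: ler_pM.
  have h2 : p * `|col_mx (cB1 co t w) (cB2 co t w) i 0| <= K * kappa by exact: ler_pM.
  have h3 : `|p * cC co t w + l| * `|stack_D co t w i 0| <= (K * kappa + `|l|) * kappa.
    exact: ler_pM.
  have Kk : 0 <= K * kappa by exact: mulr_ge0.
  have := mulr_ge0 Kk (normr_ge0 l); have := mulr_ge0 (mulr_ge0 Kk kappa0) (normr_ge0 l).
  move: (K * kappa) `|l| Kk h1 h2 h3 => k la; nra.
- move=> u; rewrite /stack_M mul_block_col !mulmx0 !addr0 dot_col_mx dot0l addr0.
  by have := low u; rewrite bilE mulmxBl dotBr scal_le subr_ge0.
(* [R22] is at most [- (dbar + K * cbar)] and [K] times the Gram matrix at most [K * cbar]; what
   remains is [- dbar]. *)
- move=> u; rewrite /stack_M /stack_D mul_block_col !mulmx0 !add0r !dot_col_mx dot0l dot0r !add0r.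
  have := upp u; rewrite bilE mulmxBl dotBr scal_le subr_ge0 => upp'.
  have := gram u; rewrite bilE mulmxBl dotBr scal_le subr_ge0 /diffusion_gram.
  have F2_le' : {ae nu, forall z, U0 z -> forall i, `|cF2 co t w z i 0| <= kappa}.
    by apply: filterS F2_le => z h Uz i; apply: mx_entry_le; exact: h.
  rewrite mulmxDl dotDr mulmx_outer dotZr (gram_quadratic u mF2 F2_le') (dotC u) -expr2.
  under [X in _ -> _ + K * (_ + X) <= _]eq_Rintegral do rewrite dot_col_mx dot0r add0r.
  set J := \int[nu]_(z in U0) _; nra.
Qed.

End game_at_a_point.

(** * Predictable saddle points *)

Section almost_everywhere_dt_dP.
Context {R : realType} {d : measure_display} {Omega : measurableType d}.
Context (Pr : probability Omega R) (T : R).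

Lemma ae_dt_dP_mono (Q Q' : R -> Omega -> Prop) :
  (forall (t : R) w, 0 <= t <= T -> Q t w -> Q' t w) ->
  ae_dt_dP Pr T Q -> ae_dt_dP Pr T Q'.
Proof.
move=> QQ' [M [mM M0 sub]]; exists M; split=> // p /= nQ'; apply: sub => /= hQ.
by apply: nQ' => pT; exact: QQ' pT (hQ pT).
Qed.

Lemma ae_dt_dP_and (Q Q' : R -> Omega -> Prop) :
  ae_dt_dP Pr T Q -> ae_dt_dP Pr T Q' -> ae_dt_dP Pr T (fun t w => Q t w /\ Q' t w).
Proof.
move=> hQ hQ'; have := negligibleU hQ hQ'; apply: negligibleS => p /= nQQ'.
apply: contrapT => /not_orP[/= /contrapT h /contrapT h']; apply: nQQ' => pT.
by split; [exact: h|exact: h'].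
Qed.

End almost_everywhere_dt_dP.

Section game_along_processes.
Context {R : realType} {d : measure_display} {Omega : measurableType d}.
Context {d' : measure_display} {U : measurableType d'} (m1 m2 : nat).
Context (Pr : probability Omega R) (T : R) (U0 : set U).
Context (nu : {finite_measure set U -> \bar R}) (F : R -> set (set Omega)).
Context (co : coefficients R Omega U m1 m2).
Context (Pi1 : set 'cV[R]_m1) (Pi2 : set 'cV[R]_m2).
Context (cbar dlow dbar K : R).

Let P := g_sigma_algebraType (predictable_rectangles T F).
Let X : set P := `[0, T]%classic `*` setT.

Hypotheses (mU0 : measurable U0) (mX : measurable X).
Hypotheses (A1 : assumption_A1 Pr T U0 nu F co) (A2 : assumption_A2 Pr T F co).
Hypotheses (cone1 : closed_convex_cone Pi1) (cone2 : closed_convex_cone Pi2).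
Hypotheses (bnd : bounded_by Pr T U0 nu co cbar).
Hypotheses (asS : assumption_S Pr T U0 nu co cbar dlow dbar K).

Lemma ae_marks (Q : R -> Omega -> U -> Prop) : ae_dt_dP_dnu Pr T U0 nu Q ->
  ae_dt_dP Pr T (fun t w => {ae nu, forall z, U0 z -> Q t w z}).
Proof.
move=> /ae_prod1; apply: filterS => -[t w] /= h tT.
by apply: filterS h => z; apply.
Qed.

Lemma measurable_mark (phi : R -> Omega -> U -> R) (t : R) w :
  predictable_mark T U0 F phi -> 0 <= t <= T -> measurable_fun U0 (phi t w).
Proof.
move=> mphi tT _ B mB.
have tw : X (t, w) by split=> //=; rewrite in_itv.
rewrite (_ : _ `&` _ = xsection ((X `*` U0) `&`
    (fun q : P * U => phi q.1.1 q.1.2 q.2) @^-1` B) (t, w)).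
  by apply: measurable_xsection; exact: (mphi (measurableX mX mU0)).
apply/seteqP; split=> z; rewrite /xsection/= inE/=; first by move=> [? ?]; split.
by move=> [[_ ?] ?].
Qed.

Lemma game_coefficients_bound : exists2 kappa : R, 0 <= kappa &
  ae_dt_dP Pr T (fun t w =>
    [/\ {ae nu, forall z, U0 z -> `|cE co t w z| <= kappa},
        {ae nu, forall z, U0 z -> `|cF1 co t w z| <= kappa} &
        {ae nu, forall z, U0 z -> `|cF2 co t w z| <= kappa}] /\
    [/\ `|cC co t w| <= kappa, `|cB1 co t w| <= kappa, `|cB2 co t w| <= kappa,
        `|cD1 co t w| <= kappa & `|cD2 co t w| <= kappa] /\
    [/\ `|cR11 co t w| <= kappa, `|cR22 co t w| <= kappa & `|cR12 co t w| <= kappa]).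
Proof.
have [_ [cC hC]] := A1_C A1; have [_ [cB1 hB1]] := A1_B1 A1.
have [_ [cB2 hB2]] := A1_B2 A1; have [_ [cD1 hD1]] := A1_D1 A1.
have [_ [cD2 hD2]] := A1_D2 A1; have [_ [cE /ae_marks hE]] := A1_E A1.
have [_ [cF1 /ae_marks hF1]] := A1_F1 A1; have [_ [cF2 /ae_marks hF2]] := A1_F2 A1.
have [_ [cR11 hR11]] := A2_R11 A2; have [_ [cR22 hR22]] := A2_R22 A2.
have [_ [cR12 hR12]] := A2_R12 A2.
pose s := [:: cC; cB1; cB2; cD1; cD2; cE; cF1; cF2; cR11; cR22; cR12].
(* One constant above all eleven essential bounds, whatever their signs. *)
pose kappa : R := \sum_(x <- s) `|x|.
exists kappa; first by rewrite sumr_ge0.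
have up k y : (k < size s)%N -> y <= nth 0 s k -> y <= kappa.
  move=> ks /le_trans; apply; rewrite /kappa (big_rem (nth 0 s k)) ?mem_nth//=.
  by apply: (le_trans (ler_norm _)); rewrite lerDl sumr_ge0.
have wk (V : normedModType R) (phi : R -> Omega -> V) k : (k < size s)%N ->
    ae_dt_dP Pr T (fun t w => `|phi t w| <= nth 0 s k) ->
    ae_dt_dP Pr T (fun t w => `|phi t w| <= kappa).
  by move=> ks; apply: ae_dt_dP_mono => t w _; exact: up.
have wkm (V : normedModType R) (phi : R -> Omega -> U -> V) k : (k < size s)%N ->
    ae_dt_dP Pr T (fun t w => {ae nu, forall z, U0 z -> `|phi t w z| <= nth 0 s k}) ->
    ae_dt_dP Pr T (fun t w => {ae nu, forall z, U0 z -> `|phi t w z| <= kappa}).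
  move=> ks; apply: ae_dt_dP_mono => t w _; apply: filterS => z h' Uz.
  exact: up ks (h' Uz).
move: (wk _ _ 0%N isT hC) (wk _ _ 1%N isT hB1) (wk _ _ 2%N isT hB2) (wk _ _ 3%N isT hD1)
  (wk _ _ 4%N isT hD2) (wkm _ _ 5%N isT hE) (wkm _ _ 6%N isT hF1) (wkm _ _ 7%N isT hF2)
  (wk _ _ 8%N isT hR11) (wk _ _ 9%N isT hR22) (wk _ _ 10%N isT hR12).
move=> {}hC {}hB1 {}hB2 {}hD1 {}hD2 {}hE {}hF1 {}hF2 {}hR11 {}hR22 {}hR12.
have := ae_dt_dP_and (ae_dt_dP_and (ae_dt_dP_and hE hF1) (ae_dt_dP_and hF2 hC))
  (ae_dt_dP_and (ae_dt_dP_and (ae_dt_dP_and hB1 hB2) (ae_dt_dP_and hD1 hD2))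
  (ae_dt_dP_and hR11 (ae_dt_dP_and hR22 hR12))).
apply: ae_dt_dP_mono => t w _ [[[kE kF1] [kF2 kC]] [[[kB1 kB2] [kD1 kD2]] [kR11 [kR22 kR12]]]].
by do !split.
Qed.

Theorem game_along (p p' l : R -> Omega -> R) (g g' : R -> Omega -> U -> R)
    (H := fun t w => H1 U0 nu co t w (p t w) (p' t w) (l t w) (g t w) (g' t w)) :
  predictable T F p -> predictable T F p' -> predictable T F l ->
  predictable_mark T U0 F g -> predictable_mark T U0 F g' ->
  ae_dt_dP Pr T (fun t w => 0 <= p t w <= K) ->
  ae_dt_dP_dnu Pr T U0 nu (fun t w z => 0 <= p t w + g t w z <= K) ->
  ae_dt_dP_dnu Pr T U0 nu (fun t w z => 0 <= p' t w + g' t w z <= K) ->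
  exists (th1 : R -> Omega -> 'cV[R]_m1) (th2 : R -> Omega -> 'cV[R]_m2),
    [/\ predictable_mx T F th1, predictable_mx T F th2 &
      exists2 c : R, 0 < c & ae_dt_dP Pr T (fun t w =>
        [/\ saddle_point Pi1 Pi2 (H t w) (th1 t w) (th2 t w),
            forall v1 v2, saddle_point Pi1 Pi2 (H t w) v1 v2 ->
              v1 = th1 t w /\ v2 = th2 t w,
            (`|supinf Pi1 Pi2 (H t w)| <= (c * (1 + l t w ^+ 2))%:E)%E &
            enorm_pair (th1 t w) (th2 t w) <= c * (1 + `|l t w|)])].
Proof.
move=> mp mp' ml mg mg' p_itv /ae_marks a_itv /ae_marks c_itv.
have [kappa kappa0 co_le] := game_coefficients_bound.
have K0 : 0 <= K by apply: (le_trans ler01); exact: (S_K asS).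
have beta0 : 0 <= drift_growth K kappa.
  by rewrite /drift_growth !(addr_ge0, mulr_ge0).
pose tau := step m1 m2 K kappa (fine (nu U0)) dlow dbar.
pose op t w := saddle_op nu U0 (stack_M co t w) (stack_D co t w)
  (stack_b co t w (p t w) (l t w)) (p t w) (stack_F co t w) (cE co t w)
  (fun z => p t w + g t w z) (fun z => p' t w + g' t w z).
(* An upper limit is defined and measurable at every point, including the exceptional ones; where
   the iterates converge it is their limit. *)
pose th t w : 'cV[R]_(m1 + m2) := \col_i
  fine (limn_esup (fun k => (proj_iter (cone_prod Pi1 Pi2) (op t w) tau k i 0)%:E)).
have mcol (x1 : R -> Omega -> 'cV[R]_m1) (x2 : R -> Omega -> 'cV[R]_m2) :
    predictable_mx T F x1 -> predictable_mx T F x2 ->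
    forall i, measurable_fun X (fun v : P => col_mx (x1 v.1 v.2) (x2 v.1 v.2) i 0).
  move=> mx1 mx2 i; case: (split_ordP i) => j ->.
    rewrite (_ : (fun v => _) = (fun v : P => x1 v.1 v.2 j 0)); first exact: mx1.
    by apply/funext => v; rewrite col_mxEu.
  rewrite (_ : (fun v => _) = (fun v : P => x2 v.1 v.2 j 0)); first exact: mx2.
  by apply/funext => v; rewrite col_mxEd.
have mfst (f : R -> Omega -> R) : predictable T F f ->
    measurable_fun (X `*` U0) (fun q : P * U => f q.1.1 q.1.2).
  by move=> mf; exact: (measurable_cylinder_fst (f := fun v : P => f v.1 v.2) mX mU0 mf).
have mD := mcol _ _ (proj1 (A1_D1 A1)) (proj1 (A1_D2 A1)).
have mth i : measurable_fun X (fun v : P => th v.1 v.2 i 0).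
  rewrite (_ : (fun v => _) = (fun v : P => fine (limn_esup (fun k =>
      (proj_iter (cone_prod Pi1 Pi2) (op v.1 v.2) tau k i 0)%:E)))); last first.
    by apply/funext => v; rewrite mxE.
  apply: measurable_fine_limn_esup => // k.
  apply: (measurable_proj_iter (V := P) (M := fun v => stack_M co v.1 v.2)
    (D := fun v => stack_D co v.1 v.2)
    (b := fun v => stack_b co v.1 v.2 (p v.1 v.2) (l v.1 v.2))
    (p := fun v => p v.1 v.2) (F := fun v => stack_F co v.1 v.2)
    (E := fun v => cE co v.1 v.2) (a := fun v z => p v.1 v.2 + g v.1 v.2 z)
    (c := fun v z => p' v.1 v.2 + g' v.1 v.2 z) nu mX mU0) => //.
  - move=> i' j'; case: (split_ordP i') => i1 ->; case: (split_ordP j') => j1 ->.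
    + rewrite (_ : (fun v => _) = (fun v : P => cR11 co v.1 v.2 i1 j1)).
        exact: (proj1 (A2_R11 A2) i1 j1).
      by apply/funext => v; rewrite /stack_M block_mxEul.
    + rewrite (_ : (fun v => _) = (fun v : P => cR12 co v.1 v.2 i1 j1)).
        exact: (proj1 (A2_R12 A2) i1 j1).
      by apply/funext => v; rewrite /stack_M block_mxEur.
    + rewrite (_ : (fun v => _) = (fun v : P => cR12 co v.1 v.2 j1 i1)).
        exact: (proj1 (A2_R12 A2) j1 i1).
      by apply/funext => v; rewrite /stack_M block_mxEdl mxE.
    + rewrite (_ : (fun v => _) = (fun v : P => cR22 co v.1 v.2 i1 j1)).
        exact: (proj1 (A2_R22 A2) i1 j1).
      by apply/funext => v; rewrite /stack_M block_mxEdr.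
  - move=> j; rewrite (_ : (fun v => _) = (fun v : P =>
      p v.1 v.2 * col_mx (cB1 co v.1 v.2) (cB2 co v.1 v.2) j 0 +
      (p v.1 v.2 * cC co v.1 v.2 + l v.1 v.2) * stack_D co v.1 v.2 j 0)).
      apply: measurable_funD; apply: measurable_funM => //.
        exact: mcol (proj1 (A1_B1 A1)) (proj1 (A1_B2 A1)) j.
      by apply: measurable_funD => //; apply: measurable_funM => //; case: (A1_C A1).
    by apply/funext => v; rewrite /stack_b !mxE.
  - move=> j; case: (split_ordP j) => j' ->.
      rewrite (_ : (fun q => _) = (fun q : P * U => cF1 co q.1.1 q.1.2 q.2 j' 0)).
        exact: (proj1 (A1_F1 A1) j' 0).
      by apply/funext => q; rewrite /stack_F col_mxEu.
    rewrite (_ : (fun q => _) = (fun q : P * U => cF2 co q.1.1 q.1.2 q.2 j' 0)).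
      exact: (proj1 (A1_F2 A1) j' 0).
    by apply/funext => q; rewrite /stack_F col_mxEd.
  - exact: (proj1 (A1_E A1)).
  - by apply: measurable_funD => //; exact: mfst.
  - by apply: measurable_funD => //; exact: mfst.
exists (fun t w => usubmx (th t w)), (fun t w => dsubmx (th t w)); split.
- move=> i j; rewrite /predictable (_ : (fun v => _) = (fun v : P => th v.1 v.2 (lshift m2 i) 0)).
    exact: mth.
  by apply/funext => v; rewrite (ord1 j) mxE.
- move=> i j; rewrite /predictable (_ : (fun v => _) = (fun v : P => th v.1 v.2 (rshift m1 i) 0)).
    exact: mth.
  by apply/funext => v; rewrite (ord1 j) mxE.
set gg := game_growth nu U0 m1 m2 K kappa (drift_growth K kappa) dlow dbar.
(* The 2 comes from [(1 + x) ^+ 2 <= 2 * (1 + x ^+ 2)]; the absolute value and the 1 make the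
   constant positive. *)
exists (2 * `|gg| + 1); first by rewrite ltr_pwDr// mulr_ge0.
have := ae_dt_dP_and (ae_dt_dP_and (ae_dt_dP_and p_itv a_itv) (ae_dt_dP_and c_itv co_le))
  (ae_dt_dP_and (ae_dt_dP_and (S_R11 asS) (S_R22 asS)) (bb_D2 bnd)).
apply: ae_dt_dP_mono => t w tT [[[tp ta] [tc [[tE tF1 tF2] [[tC tB1 tB2 tD1 tD2] [t11 t22 t12]]]]]
  [[tlow tupp] tgram]].
have data : data_at_point U0 nu co t w cbar dlow dbar K kappa (p t w) (p' t w) (g t w) (g' t w).
  split=> //.
  - exact: (@measurable_mark _ t w (proj1 (A1_E A1)) tT).
  - by move=> i; exact: (@measurable_mark (fun t w z => cF1 co t w z i 0) t w (proj1 (A1_F1 A1) i 0) tT).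
  - by move=> i; exact: (@measurable_mark (fun t w z => cF2 co t w z i 0) t w (proj1 (A1_F2 A1) i 0) tT).
  - exact: measurable_mark.
  - exact: measurable_mark.
  - exact: (A2_sym1 A2).
  - exact: (A2_sym2 A2).
have := game_solution mU0 kappa0 beta0 (S_dlow asS) (S_dbar asS) cone1 cone2
  (data_game_hypotheses mU0 (l t w) data kappa0).
set s := saddle_pt _ _ _ _ _ _ _ _ _ _ _ _ _ _ _ _ _.
move=> [cvg_s sad uniq_s sup_s norm_s].
have -> : H t w = fun v1 v2 => ham nu U0 (stack_M co t w) (stack_D co t w)
    (stack_b co t w (p t w) (l t w)) (p t w) (stack_F co t w) (cE co t w)
    (fun z => p t w + g t w z) (fun z => p' t w + g' t w z) (col_mx v1 v2).
  by apply/funext => v1; apply/funext => v2; exact: H1E.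
have -> : th t w = s.
  apply/colP => i; rewrite mxE.
  have /cvg_limn_einf_sup[_ ->//] : (proj_iter (cone_prod Pi1 Pi2) (op t w) tau k i 0)%:E
      @[k --> \oo] --> (s i 0)%:E.
  by apply: cvg_EFin; [exact: nearW|exact: (cvg_entrywise cvg_s)].
split=> //.
  apply: (le_trans sup_s); rewrite lee_fin -/gg.
  have := ler_norm gg; have := normr_ge0 gg; have := normr_ge0 (l t w).
  have : `|l t w| ^+ 2 = l t w ^+ 2 by rewrite real_normK// num_real.
  move: `|gg| `|l t w| (l t w ^+ 2) => G x _ <- x0 G0 gG.
  apply: (@le_trans _ _ (G * (1 + x) ^+ 2)); first by rewrite ler_wpM2r ?sqr_ge0.
  have : G * (1 + x) ^+ 2 <= G * (2 * (1 + x ^+ 2)).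
    by rewrite ler_wpM2l//; have := sqr_ge0 (1 - x); nra.
  have := sqr_ge0 x; nra.
rewrite /enorm_pair -enormsq_col_mx vsubmxK; apply: (le_trans norm_s).
rewrite -/gg ler_wpM2r ?addr_ge0//.
have := ler_norm gg; have := normr_ge0 gg; lra.
Qed.

End game_along_processes.

(** * Time 0 is negligible *)

Section positive_times.
Context {R : realType} {d : measure_display} {Omega : measurableType d}.
Context {d' : measure_display} {U : measurableType d'}.
Context (Pr : probability Omega R) (T : R) (U0 : set U).
Context (nu : {finite_measure set U -> \bar R}).

Lemma leb_Pr_time0 : (leb \x Pr)%E ([set 0%R] `*` setT : set (R * Omega)) = 0%E.
Proof.
apply: etrans (product_measure1E leb Pr (measurable_set1 _) measurableT) _.
by apply: etrans (congr1 (fun x => x * _)%E (lebesgue_measure_set1 0)) _; rewrite mul0e.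
Qed.

Lemma ae_dt_dP_pos (Q : R -> Omega -> Prop) :
  {ae (leb \x Pr)%E, forall p : R * Omega, 0 < p.1 <= T -> Q p.1 p.2} ->
  ae_dt_dP Pr T Q.
Proof.
move=> [M [mM M0 subM]].
have m0 : measurable ([set 0%R] `*` setT : set (measurableTypeR R * Omega)).
  by apply: measurableX => //; exact: measurable_set1.
apply: negligibleS (negligibleU (ex_intro _ M (And3 mM M0 (@subset_refl _ M)))
  (ex_intro _ _ (And3 m0 leb_Pr_time0 (@subset_refl _ _)))).
move=> [t w] /= /not_implyP[/andP[t0 tT] nQ].
have [->|tn0] := eqVneq t 0; first by right.
by left; apply: subM => /= h; apply: nQ; apply: h; rewrite lt_neqAle eq_sym tn0 t0.
Qed.

Lemma ae_dt_dP_dnu_pos (Q : R -> Omega -> U -> Prop) :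
  {ae ((leb \x Pr) \x nu)%E, forall q : R * Omega * U, 0 < q.1.1 <= T -> U0 q.2 ->
    Q q.1.1 q.1.2 q.2} ->
  ae_dt_dP_dnu Pr T U0 nu Q.
Proof.
move=> [M [mM M0 subM]].
have m0 : measurable (([set 0%R] `*` setT) `*` setT : set (measurableTypeR R * Omega * U)).
  by apply: measurableX => //; apply: measurableX => //; exact: measurable_set1.
have n0 : ((leb \x Pr) \x nu)%E (([set 0%R] `*` setT) `*` setT : set (measurableTypeR R * Omega * U)) = 0%E.
  apply: etrans (product_measure1E (leb \x Pr)%E nu _ measurableT) _.
    by apply: measurableX => //; exact: measurable_set1.
  have e := leb_Pr_time0; apply: etrans (congr1 (fun x => x * _)%E e) _.
  by rewrite mul0e.
apply: negligibleS (negligibleU (ex_intro _ M (And3 mM M0 (@subset_refl _ M)))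
  (ex_intro _ _ (And3 m0 n0 (@subset_refl _ _)))).
move=> [[t w] z] /= /not_implyP[/andP[t0 tT] /not_implyP[Uz nQ]].
have [->|tn0] := eqVneq t 0; first by right.
by left; apply: subM => /= h; apply: nQ; apply: h => //; rewrite lt_neqAle eq_sym tn0 t0.
Qed.

Lemma pleft_ae (X : R -> Omega -> R) (K : R) : 0 < T ->
  {ae Pr, forall w, cadlag T (X ^~ w)} ->
  {ae Pr, forall w (t : R), 0 <= t <= T -> 0 < X t w <= K} ->
  ae_dt_dP Pr T (fun t w => pleft T X t w = left_limit (X ^~ w) t /\
    0 <= pleft T X t w <= K).
Proof.
move=> T0 cadX XK; apply: ae_dt_dP_pos.
have := @ae_snd _ _ _ _ _ leb Pr _ (filterI cadX XK).
move=> [M [mM M0 subM]]; exists M; split=> // -[t w] /= nQ.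
apply: subM => /= -[cad XKw]; apply: nQ => tT.
have cvgX : cvg (X ^~ w @ t^'-) by case: cad => _; apply.
by rewrite (pleftE T0 tT cvgX); split=> //; exact: left_limit_range tT cvgX XKw.
Qed.

End positive_times.

Theorem proposition4p1 (R : realType) (d : measure_display)
    (Omega : measurableType d) (Pr : probability Omega R) (T : R)
    (l m1 m2 : nat) (U0 : set (borelrV R l))
    (nu : {finite_measure set (borelrV R l) -> \bar R})
    (W : R -> Omega -> R)
    (N : Omega -> {measure set (R * borelrV R l) -> \bar R})
    (co : coefficients R Omega (borelrV R l) m1 m2)
    (Pi1 : set 'cV[R]_m1) (Pi2 : set 'cV[R]_m2)
    (cbar dlow dbar K : R)
    (S : riccati_processes R Omega (borelrV R l)) :
  let F := augmented_filtration Pr T U0 W N in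
  0 < T ->
  measure_is_complete Pr ->
  measurable U0 -> U0 !=set0 ->
  brownian_motion Pr T W ->
  poisson_random_measure Pr T U0 nu N ->
  independent_classes Pr <<s W_events W T >> <<s N_events U0 N T >> ->
  assumption_A1 Pr T U0 nu F co ->
  assumption_A2 Pr T F co ->
  closed_convex_cone Pi1 -> closed_convex_cone Pi2 ->
  bounded_by Pr T U0 nu co cbar ->
  assumption_S Pr T U0 nu co cbar dlow dbar K ->
  riccati_solution Pr T U0 nu F Pi1 Pi2 W N co S ->
  {ae Pr, forall w (t : R), 0 <= t <= T -> 0 < rP1 S t w <= K} ->
  {ae Pr, forall w (t : R), 0 <= t <= T -> 0 < rP2 S t w <= K} ->
  ae_dt_dP Pr T (fun t w =>
    (exists! th : 'cV[R]_m1 * 'cV[R]_m2,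
       saddle_point Pi1 Pi2 (H1_along U0 nu co S t w) th.1 th.2) /\
    (exists! th : 'cV[R]_m1 * 'cV[R]_m2,
       saddle_point Pi1 Pi2 (H2_along U0 nu co S t w) th.1 th.2)) /\
  exists (Tp1 : R -> Omega -> 'cV[R]_m1) (Tp2 : R -> Omega -> 'cV[R]_m2)
         (Tm1 : R -> Omega -> 'cV[R]_m1) (Tm2 : R -> Omega -> 'cV[R]_m2),
    [/\ predictable_mx T F Tp1 /\ predictable_mx T F Tp2,
        predictable_mx T F Tm1 /\ predictable_mx T F Tm2,
        ae_dt_dP Pr T (fun t w =>
          saddle_point Pi1 Pi2 (H1_along U0 nu co S t w) (Tp1 t w) (Tp2 t w) /\
          saddle_point Pi1 Pi2 (H2_along U0 nu co S t w) (Tm1 t w) (Tm2 t w)) &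
        exists2 c : R, 0 < c &
          ae_dt_dP Pr T (fun t w =>
            [/\ (`|H1star U0 nu Pi1 Pi2 co S t w|
                   <= (c * (1 + rL1 S t w ^+ 2))%:E)%E,
                (`|H2star U0 nu Pi1 Pi2 co S t w|
                   <= (c * (1 + rL2 S t w ^+ 2))%:E)%E,
                enorm_pair (Tp1 t w) (Tp2 t w) <= c * (1 + `|rL1 S t w|) &
                enorm_pair (Tm1 t w) (Tm2 t w) <= c * (1 + `|rL2 S t w|)])].
Proof.
move=> F T0 completeP mU0 _ W_bm PN WN A1 A2 cone1 cone2 bnd asS [sde1 sde2] P1K P2K.
have mW := bm_measurable W_bm.
have mX : measurable (`[0, T]%classic `*` setT :
    set (g_sigma_algebraType (predictable_rectangles T F))).
  exact: predictable_domain.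
have mp1 := predictable_pleft T0 (bsde_adapted sde1).
have mp2 := predictable_pleft T0 (bsde_adapted sde2).
have j1 : ae_dt_dP_dnu Pr T U0 nu
    (fun t w z => 0 <= pleft T (rP1 S) t w + rG1 S t w z <= K).
  by apply: ae_dt_dP_dnu_pos; exact: (jump_range T0 mU0 completeP mW PN WN sde1 P1K).
have j2 : ae_dt_dP_dnu Pr T U0 nu
    (fun t w z => 0 <= pleft T (rP2 S) t w + rG2 S t w z <= K).
  by apply: ae_dt_dP_dnu_pos; exact: (jump_range T0 mU0 completeP mW PN WN sde2 P2K).
have r1 := pleft_ae T0 (bsde_cadlag sde1) P1K.
have r2 := pleft_ae T0 (bsde_cadlag sde2) P2K.
have i1 := ae_dt_dP_mono (fun t w _ => @proj2 _ _) r1.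
have i2 := ae_dt_dP_mono (fun t w _ => @proj2 _ _) r2.
have mL1 := proj1 (bsde_L sde1); have mL2 := proj1 (bsde_L sde2).
have mG1 := proj1 (bsde_G sde1); have mG2 := proj1 (bsde_G sde2).
have [Tp1 [Tp2 [mTp1 mTp2 [c1 c10 sol1]]]] := game_along mU0 mX A1 A2 cone1 cone2 bnd asS
  mp1 mp2 mL1 mG1 mG2 i1 j1 j2.
(* The second game is the first one with the two processes exchanged, played on the opposite cones;
   its solution is the opposite of [Theta^-]. *)
have [th1 [th2 [mth1 mth2 [c2 c20 sol2]]]] := game_along mU0 mX A1 A2
  (oppset_cone cone1) (oppset_cone cone2) bnd asS mp2 mp1 mL2 mG2 mG1 i2 j2 j1.
have sol : ae_dt_dP Pr T (fun t w =>
    [/\ saddle_point Pi1 Pi2 (H1_along U0 nu co S t w) (Tp1 t w) (Tp2 t w),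
        forall v1 v2, saddle_point Pi1 Pi2 (H1_along U0 nu co S t w) v1 v2 ->
          v1 = Tp1 t w /\ v2 = Tp2 t w,
        (`|H1star U0 nu Pi1 Pi2 co S t w| <= (c1 * (1 + rL1 S t w ^+ 2))%:E)%E &
        enorm_pair (Tp1 t w) (Tp2 t w) <= c1 * (1 + `|rL1 S t w|)] /\
    [/\ saddle_point Pi1 Pi2 (H2_along U0 nu co S t w) (- th1 t w) (- th2 t w),
        forall v1 v2, saddle_point Pi1 Pi2 (H2_along U0 nu co S t w) v1 v2 ->
          v1 = - th1 t w /\ v2 = - th2 t w,
        (`|H2star U0 nu Pi1 Pi2 co S t w| <= (c2 * (1 + rL2 S t w ^+ 2))%:E)%E &
        enorm_pair (- th1 t w) (- th2 t w) <= c2 * (1 + `|rL2 S t w|)]).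
  have := ae_dt_dP_and (ae_dt_dP_and sol1 sol2) (ae_dt_dP_and r1 r2).
  apply: ae_dt_dP_mono => t w _ [[s1 s2] [[e1 _] [e2 _]]].
  (* The games were solved for [pleft]; almost everywhere it is the left limit that appears in
     [H1_along] and [H2_along]. *)
  rewrite e1 e2 in s1 s2; split=> //.
  pose H := H1 U0 nu co t w (left_limit (rP2 S ^~ w) t) (left_limit (rP1 S ^~ w) t)
    (rL2 S t w) (rG2 S t w) (rG1 S t w).
  have H2N : H2_along U0 nu co S t w = fun v1 v2 => H (- v1) (- v2).
    by apply/funext => v1; apply/funext => v2; exact: H2E.
  case: s2 => sad uniq_sad sup norm; split.
  - by rewrite H2N; exact: (saddle_point_opp Pi1 Pi2 H _ _).1.
  - move=> v1 v2; rewrite H2N -(opprK v1) -(opprK v2) => h.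
    by have [-> ->] := uniq_sad _ _ ((saddle_point_opp Pi1 Pi2 H _ _).2 h).
  - by rewrite /H2star H2N -supinf_opp.
  - by rewrite /enorm_pair !enormsqN.
split.
  apply: ae_dt_dP_mono sol => t w _ [[sad1 uniq1 _ _] [sad2 uniq2 _ _]]; split.
    exists (Tp1 t w, Tp2 t w); split=> // -[v1 v2] /= /uniq1[-> ->//].
  by exists (- th1 t w, - th2 t w); split=> // -[v1 v2] /= /uniq2[-> ->].
have mopp m (f : R -> Omega -> 'cV[R]_m) : predictable_mx T F f ->
    predictable_mx T F (fun t w => - f t w).
  move=> mf i j.
  rewrite /predictable (_ : (fun p => _) = (fun p => - f p.1 p.2 i j)).
    by apply: measurableT_comp => //; exact: mf.
  by apply/funext => p; rewrite mxE.
exists Tp1, Tp2, (fun t w => - th1 t w), (fun t w => - th2 t w); split=> //.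
- by split; exact: mopp.
- by apply: ae_dt_dP_mono sol => t w _ [[? _ _ _] [? _ _ _]].
exists (c1 + c2); first exact: addr_gt0.
apply: ae_dt_dP_mono sol => t w _ [[_ _ a1 b1] [_ _ a2 b2]]; split.
- apply: (le_trans a1); rewrite lee_fin ler_wpM2r ?addr_ge0 ?sqr_ge0//.
  by rewrite lerDl ltW.
- apply: (le_trans a2); rewrite lee_fin ler_wpM2r ?addr_ge0 ?sqr_ge0//.
  by rewrite lerDr ltW.
- by apply: (le_trans b1); rewrite ler_wpM2r ?addr_ge0// lerDl ltW.
- by apply: (le_trans b2); rewrite ler_wpM2r ?addr_ge0// lerDr ltW.
Qed.
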